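(* Let $k\geq 1$ be an integer and let $B_k=\Lambda\mathbb{C}^k\rtimes\mathbb{C}[\mathbb{Z}_2]$. For the Davydov-Yetter cohomologies of the identity functor on $B_k\mathrm{-mod}$ and of the forgetful functor $\mathcal{U}_{B_k}\colon B_k\mathrm{-mod}\to\mathrm{Vec}_{\mathbb{C}}$ one has, for all $n\ge 0$, $$\dim H^n_{DY}(B_k\mathrm{-mod})=\dim H^n_{DY}(\mathcal{U}_{B_k})=\begin{cases}0&\text{for } n \text{ odd},\\ \binom{k+n-1}{n}&\text{for } n\text{ even}.\end{cases}$$
   Context: **The Hopf algebra.** $B_k$ is the $2^{k+1}$-dimensional Hopf algebra over $\mathbb{C}$ generated as an algebra by $g,x_1,\dots,x_k$ with relations $gx_i=-x_ig$, $x_i^2=0$, $x_ix_j=-x_jx_i$, $g^2=1$, with coproduct $\Delta(g)=g\otimes g$, $\Delta(x_i)=1\otimes x_i+x_i\otimes g$, counit $\varepsilon(g)=1$, $\varepsilon(x_i)=0$, and antipode $S(g)=g$, $S(x_i)=gx_i$. $B_k\mathrm{-mod}$ is the tensor category of finite-dimensional left $B_k$-modules. **Davydov-Yetter cohomology.** Let $F\colon\mathcal{C}\to\mathcal{D}$ be a tensor functor ($\mathbb{C}$-linear monoidal functor) between tensor categories over $\mathbb{C}$; coherence isomorphisms are suppressed. Let $F^{\times n}$ be $F$ applied componentwise to $n$ arguments and $\otimes^n$ the $n$-fold tensor product functor. Set $C^n_{DY}(F)=\mathrm{Nat}(\otimes^n\circ F^{\times n},\otimes^n\circ F^{\times n})$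 for $n\ge1$ and $C^0_{DY}(F)=\mathrm{End}_{\mathcal{D}}(I)$, with differential $$\delta^n(f)_{X_0,\dots,X_n}=\mathrm{id}_{F(X_0)}\otimes f_{X_1,\dots,X_n}+\sum_{i=1}^n(-1)^if_{X_0,\dots,X_{i-1}\otimes X_i,\dots,X_n}+(-1)^{n+1}f_{X_0,\dots,X_{n-1}}\otimes\mathrm{id}_{F(X_n)}.$$ $H^{\bullet}_{DY}(F)$ is the cohomology of this complex, and $H^{\bullet}_{DY}(\mathcal{C}):=H^{\bullet}_{DY}(\mathrm{id}_{\mathcal{C}})$. *)

(* Defs.v *)
From HB Require Import structures.
From mathcomp Require Import all_boot all_order all_algebra falgebra.
From mathcomp Require Import boolp reals complex.
Set Implicit Arguments.
Unset Strict Implicit.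
Unset Printing Implicit Defensive.
Import GRing.Theory VectorInternalTheory.
Local Open Scope ring_scope.

Section Tensor.
Variable K : fieldType.

(* V ⊗ W as matrices of coordinates in the bases of V and W carried by their
   vectType structures; tliftE and tens_ext give the universal property.  For
   algebras A and B, tens A B is given below the ring structure
   (a ⊗ b)(c ⊗ d) = ac ⊗ bd, which is unrelated to the product of matrices. *)
Definition tens (V W : vectType K) : Type := 'M[K]_(dim V, dim W).

HB.instance Definition _ (V W : vectType K) :=
  Vector.copy (tens V W) 'M[K]_(dim V, dim W).

Definition pure (V W : vectType K) (v : V) (w : W) : tens V W :=
  (v2r v)^T *m v2r w.

Definition tbas (V : vectType K) (i : 'I_(dim V)) : V := r2v (delta_mx 0 i).

Definition bilin (V W U : vectType K) (b : V -> W -> U) : Prop :=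
  (forall v, linear (b v)) /\ (forall w, linear (b^~ w)).

Lemma pure_bilin (V W : vectType K) : bilin (@pure V W).
Proof.
split=> [v a x y|w a x y]; rewrite /pure [v2r (_ + _)]linearP /=.
  by rewrite mulmxDr -scalemxAr.
by rewrite linearD linearZ /= mulmxDl -scalemxAl.
Qed.

Section Lift.
Variables V W U : vectType K.
Implicit Type b : V -> W -> U.

(* The linear map V ⊗ W -> U induced by b; it is meaningful when b is bilinear. *)
Definition tlift_def (b : V -> W -> U) (t : tens V W) : U :=
  \sum_i \sum_j (t : 'M_(_, _)) i j *: b (tbas i) (tbas j).

Lemma tlift_linear b : linear (tlift_def b).
Proof.
move=> a s t; rewrite /tlift_def scaler_sumr -big_split; apply: eq_bigr => i _.
rewrite scaler_sumr -big_split; apply: eq_bigr => j _ /=.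
by rewrite !mxE scalerDl scalerA.
Qed.

HB.instance Definition _ b :=
  GRing.isSemilinear.Build K (tens V W) U _ (tlift_def b)
    (GRing.semilinear_linear (tlift_linear b)).

Definition tlift (b : V -> W -> U) : 'Hom(tens V W, U) := linfun (tlift_def b).

Lemma tbas_sum (X : vectType K) (v : X) :
  v = \sum_i (v2r v 0 i) *: tbas i.
Proof.
apply: v2r_inj; rewrite linear_sum {1}[v2r v]row_sum_delta.
by apply: eq_bigr => i _; rewrite linearZ /= r2vK.
Qed.

Lemma bilin_suml b (I : finType) (F : I -> V) w :
  bilin b -> b (\sum_i F i) w = \sum_i b (F i) w.
Proof.
case=> _ /(_ w) bl.
pose g := HB.pack_for {linear V -> U} (b^~ w)
  (GRing.isSemilinear.Build K V U _ (b^~ w) (GRing.semilinear_linear bl)).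
exact: (linear_sum g).
Qed.

Lemma bilin_sumr b (I : finType) v (F : I -> W) :
  bilin b -> b v (\sum_i F i) = \sum_i b v (F i).
Proof.
case=> /(_ v) bl _.
pose g := HB.pack_for {linear W -> U} (b v)
  (GRing.isSemilinear.Build K W U _ (b v) (GRing.semilinear_linear bl)).
exact: (linear_sum g).
Qed.

Lemma bilinZl b a v w : bilin b -> b (a *: v) w = a *: b v w.
Proof.
case=> _ bl; have b0 : b 0 w = 0.
  have := bl w 1 0 0; rewrite !scale1r addr0 => /eqP.
  by rewrite -subr_eq0 opprD addrA subrr sub0r oppr_eq0 => /eqP.
by have := bl w a v 0; rewrite !addr0 b0 addr0.
Qed.

Lemma bilinZr b a v w : bilin b -> b v (a *: w) = a *: b v w.
Proof.
case=> bl _; have b0 : b v 0 = 0.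
  have := bl v 1 0 0; rewrite !scale1r addr0 => /eqP.
  by rewrite -subr_eq0 opprD addrA subrr sub0r oppr_eq0 => /eqP.
by have := bl v a w 0; rewrite !addr0 b0 addr0.
Qed.

Lemma tliftE b v w : bilin b -> tlift b (pure v w) = b v w.
Proof.
move=> bl; rewrite lfunE /= /tlift_def.
rewrite {2}[v]tbas_sum bilin_suml //; apply: eq_bigr => i _.
rewrite {2}[w]tbas_sum bilin_sumr //; apply: eq_bigr => j _.
by rewrite bilinZl // bilinZr // scalerA mxE big_ord1 mxE.
Qed.

Lemma tens_sum (t : tens V W) :
  t = \sum_i \sum_j (t : 'M_(_, _)) i j *: pure (tbas i) (tbas j).
Proof.
rewrite {1}[t]matrix_sum_delta; apply: eq_bigr => i _; apply: eq_bigr => j _.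
by congr (_ *: _); rewrite /pure !r2vK trmx_delta mul_delta_mx.
Qed.

Lemma tens_ext (f g : tens V W -> U) : linear f -> linear g ->
  (forall v w, f (pure v w) = g (pure v w)) -> f =1 g.
Proof.
move=> lf lg fg t.
pose F := HB.pack_for {linear tens V W -> U} f
  (GRing.isSemilinear.Build K _ U _ f (GRing.semilinear_linear lf)).
pose G := HB.pack_for {linear tens V W -> U} g
  (GRing.isSemilinear.Build K _ U _ g (GRing.semilinear_linear lg)).
rewrite [t]tens_sum -[f]/(F : _ -> _) -[g]/(G : _ -> _) !linear_sum.
apply: eq_bigr => i _; rewrite !linear_sum; apply: eq_bigr => j _.
by rewrite !linearZ /= fg.
Qed.

Lemma tens_lfun_ext (f g : 'Hom(tens V W, U)) :
  (forall v w, f (pure v w) = g (pure v w)) -> f = g.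
Proof. by move=> fg; apply/lfunP; apply: tens_ext => //; apply: linearP. Qed.

End Lift.
End Tensor.

Section TensorMaps.
Variable K : fieldType.
Implicit Types U V W X Y Z : vectType K.

Lemma bilin_comp V W V' W' U (b : V' -> W' -> U) (f : V -> V') (g : W -> W') :
  linear f -> linear g -> bilin b -> bilin (fun v w => b (f v) (g w)).
Proof.
by move=> lf lg [bl br]; split=> [v a x y|w a x y] /=; rewrite ?lf ?lg ?bl ?br.
Qed.

Definition tmap V V' W W' (f : 'Hom(V, V')) (g : 'Hom(W, W')) :
  'Hom(tens V W, tens V' W') := tlift (fun v w => pure (f v) (g w)).

Lemma tmapE V V' W W' (f : 'Hom(V, V')) (g : 'Hom(W, W')) v w :
  tmap f g (pure v w) = pure (f v) (g w).
Proof. by rewrite tliftE //; apply: bilin_comp (pure_bilin _ _); apply: linearP. Qed.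

Lemma tmap_bilin V V' W W' : bilin (@tmap V V' W W').
Proof.
split=> [f a g h|g a f h]; apply: tens_lfun_ext => v w;
  rewrite add_lfunE scale_lfunE !tmapE add_lfunE scale_lfunE.
  exact: (pure_bilin _ _).1.
exact: (pure_bilin _ _).2.
Qed.

Lemma tmap_id V W : tmap \1%VF \1%VF = \1%VF :> 'End(tens V W).
Proof. by apply: tens_lfun_ext => v w; rewrite tmapE !id_lfunE. Qed.

Lemma tmap_comp V V' V'' W W' W'' (f' : 'Hom(V', V'')) (f : 'Hom(V, V'))
    (g' : 'Hom(W', W'')) (g : 'Hom(W, W')) :
  tmap (f' \o f)%VF (g' \o g)%VF = (tmap f' g' \o tmap f g)%VF.
Proof. by apply: tens_lfun_ext => v w; rewrite comp_lfunE !tmapE !comp_lfunE. Qed.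

Definition pureh V W (v : V) : 'Hom(W, tens V W) := linfun (pure v).

Lemma purehE V W (v : V) (w : W) : pureh W v w = pure v w.
Proof.
pose F := HB.pack_for {linear W -> tens V W} (pure v)
  (GRing.isSemilinear.Build K _ _ _ (pure v)
     (GRing.semilinear_linear ((pure_bilin V W).1 v))).
exact: (lfunE F).
Qed.

Definition rpureh V W (w : W) : 'Hom(V, tens V W) := linfun (@pure _ V W ^~ w).

Lemma rpurehE V W (v : V) (w : W) : rpureh V w v = pure v w.
Proof.
pose F := HB.pack_for {linear V -> tens V W} (@pure _ V W ^~ w)
  (GRing.isSemilinear.Build K _ _ _ (@pure _ V W ^~ w)
     (GRing.semilinear_linear ((pure_bilin V W).2 w))).
exact: (lfunE F).
Qed.

Lemma pureh_linear V W : linear (@pureh V W).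
Proof.
move=> a x y; apply/lfunP => w.
by rewrite add_lfunE scale_lfunE !purehE (pure_bilin _ _).2.
Qed.

Lemma rpureh_linear V W : linear (@rpureh V W).
Proof.
move=> a x y; apply/lfunP => w.
by rewrite add_lfunE scale_lfunE !rpurehE (pure_bilin _ _).1.
Qed.

Lemma bilin_lfunl V W U (L : V -> 'Hom(W, U)) :
  linear L -> bilin (fun v w => L v w).
Proof.
move=> lL; split=> [v a x y|w a x y] /=; first by rewrite linearP.
by rewrite lL add_lfunE scale_lfunE.
Qed.

Lemma bilin_lfunr V W U (L : W -> 'Hom(V, U)) :
  linear L -> bilin (fun v w => L w v).
Proof.
move=> lL; split=> [v a x y|w a x y] /=; last by rewrite linearP.
by rewrite lL add_lfunE scale_lfunE.
Qed.

Definition tassoc U V W : 'Hom(tens (tens U V) W, tens U (tens V W)) :=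
  tlift (fun t w => tmap \1%VF (rpureh V w) t).

Definition tassoc' U V W : 'Hom(tens U (tens V W), tens (tens U V) W) :=
  tlift (fun u t => tmap (pureh V u) \1%VF t).

Lemma tassocE U V W (u : U) (v : V) (w : W) :
  tassoc U V W (pure (pure u v) w) = pure u (pure v w).
Proof.
rewrite tliftE ?tmapE ?id_lfunE ?rpurehE //.
apply: (bilin_lfunr (L := fun w => tmap \1%VF (rpureh V w))) => a x y.
by rewrite rpureh_linear (tmap_bilin _ _ _ _).1.
Qed.

Lemma tassoc'E U V W (u : U) (v : V) (w : W) :
  tassoc' U V W (pure u (pure v w)) = pure (pure u v) w.
Proof.
rewrite tliftE ?tmapE ?id_lfunE ?purehE //.
apply: (bilin_lfunl (L := fun u => tmap (pureh V u) \1%VF)) => a x y.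
by rewrite pureh_linear (tmap_bilin _ _ _ _).2.
Qed.

Lemma tens_lfun_ext3 U V W X (f g : 'Hom(tens (tens U V) W, X)) :
  (forall u v w, f (pure (pure u v) w) = g (pure (pure u v) w)) -> f = g.
Proof.
move=> fg; apply: tens_lfun_ext => t w.
suff: (f \o rpureh _ w)%VF = (g \o rpureh _ w)%VF.
  by move/lfunP/(_ t); rewrite !comp_lfunE !rpurehE.
by apply: tens_lfun_ext => u v; rewrite !comp_lfunE !rpurehE.
Qed.

Lemma tens_lfun_ext3' U V W X (f g : 'Hom(tens U (tens V W), X)) :
  (forall u v w, f (pure u (pure v w)) = g (pure u (pure v w))) -> f = g.
Proof.
move=> fg; apply: tens_lfun_ext => u t.
suff: (f \o pureh _ u)%VF = (g \o pureh _ u)%VF.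
  by move/lfunP/(_ t); rewrite !comp_lfunE !purehE.
by apply: tens_lfun_ext => v w; rewrite !comp_lfunE !purehE.
Qed.

Lemma tens_lfun_ext4 U V W Y X (f g : 'Hom(tens (tens (tens U V) W) Y, X)) :
  (forall u v w y, f (pure (pure (pure u v) w) y) =
                   g (pure (pure (pure u v) w) y)) -> f = g.
Proof.
move=> fg; apply: tens_lfun_ext => t y.
suff: (f \o rpureh _ y)%VF = (g \o rpureh _ y)%VF.
  by move/lfunP/(_ t); rewrite !comp_lfunE !rpurehE.
by apply: tens_lfun_ext3 => u v w; rewrite !comp_lfunE !rpurehE.
Qed.

Definition tlunit V : 'Hom(tens K^o V, V) := tlift (fun (a : K^o) v => a *: v).
Definition tlunit' V : 'Hom(V, tens K^o V) := pureh V (1 : K^o).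
Definition trunit V : 'Hom(tens V K^o, V) := tlift (fun v (a : K^o) => a *: v).
Definition trunit' V : 'Hom(V, tens V K^o) := rpureh V (1 : K^o).

Lemma tlunitE V (a : K^o) (v : V) : tlunit V (pure a v) = a *: v.
Proof.
rewrite tliftE //; split=> [b c x y|x b c d].
  by rewrite scalerDr !scalerA mulrC.
by rewrite scalerDl scalerA.
Qed.

Lemma trunitE V (a : K^o) (v : V) : trunit V (pure v a) = a *: v.
Proof.
rewrite tliftE //; split=> [x b c d|b c x y].
  by rewrite scalerDl scalerA.
by rewrite scalerDr !scalerA mulrC.
Qed.

Lemma pureZl V W a (v : V) (w : W) : pure (a *: v) w = a *: pure v w.
Proof. exact/bilinZl/pure_bilin. Qed.
Lemma pureZr V W a (v : V) (w : W) : pure v (a *: w) = a *: pure v w.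
Proof. exact/bilinZr/pure_bilin. Qed.
Lemma pureDl V W (v v' : V) (w : W) : pure (v + v') w = pure v w + pure v' w.
Proof. by have := (pure_bilin V W).2 w 1 v v'; rewrite !scale1r. Qed.
Lemma pureDr V W (v : V) (w w' : W) : pure v (w + w') = pure v w + pure v w'.
Proof. by have := (pure_bilin V W).1 v 1 w w'; rewrite !scale1r. Qed.

End TensorMaps.

Section TensorAlgebra.
Variables (K : fieldType) (A B : falgType K).

Definition tmulh : 'Hom(tens A B, 'End(tens A B)) :=
  tlift (fun a b => tmap (amull a) (amull b)).

Definition tmul (s t : tens A B) : tens A B := tmulh s t.

Lemma tmulE a b c d : tmul (pure a b) (pure c d) = pure (a * c) (b * d).
Proof.
rewrite /tmul tliftE ?tmapE ?lfunE ?[in LHS]lfunE //=.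
by apply: bilin_comp (tmap_bilin _ _ _ _); apply: linearP.
Qed.

Lemma tmulPl t : linear (tmul^~ t).
Proof. by move=> a x y; rewrite /tmul linearP add_lfunE scale_lfunE. Qed.

Lemma tmulPr t : linear (tmul t).
Proof. by move=> a x y; rewrite /tmul linearP. Qed.

Lemma tmulDl : left_distributive tmul +%R.
Proof. by move=> x y t; have := tmulPl t 1 x y; rewrite !scale1r. Qed.

Lemma tmulDr : right_distributive tmul +%R.
Proof. by move=> t x y; have := tmulPr t 1 x y; rewrite !scale1r. Qed.

Lemma tmulZl a s t : tmul (a *: s) t = a *: tmul s t.
Proof. by rewrite /tmul linearZ scale_lfunE. Qed.

Lemma tmulZr a s t : tmul s (a *: t) = a *: tmul s t.
Proof. by rewrite /tmul linearZ. Qed.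

Lemma tmulA : associative tmul.
Proof.
move=> s t u.
apply: (tens_ext (f := fun s => tmul s (tmul t u))
                 (g := fun s => tmul (tmul s t) u)) s => [||a b].
- exact: tmulPl.
- by move=> a x y; rewrite tmulPl tmulPl.
apply: (tens_ext (f := fun t => tmul (pure a b) (tmul t u))
                 (g := fun t => tmul (tmul (pure a b) t) u)) t => [||c d].
- by move=> e x y; rewrite tmulPl tmulPr.
- by move=> e x y; rewrite tmulPr tmulPl.
apply: (tens_ext (f := fun u => tmul (pure a b) (tmul (pure c d) u))
                 (g := fun u => tmul (tmul (pure a b) (pure c d)) u)) u => [||e f].
- by move=> h x y; rewrite !tmulPr.
- exact: tmulPr.
by rewrite !tmulE !mulrA.
Qed.

Lemma tmul1l : left_id (pure 1 1) tmul.
Proof.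
move=> t; apply: (tens_ext (f := tmul (pure 1 1)) (g := id)) t => [||a b] //.
  exact: tmulPr.
by rewrite tmulE !mul1r.
Qed.

Lemma tmul1r : right_id (pure 1 1) tmul.
Proof.
move=> t; apply: (tens_ext (f := tmul^~ (pure 1 1)) (g := id)) t => [||a b] //.
  exact: tmulPl.
by rewrite tmulE !mulr1.
Qed.

Lemma pure_neq0 (V W : vectType K) (v : V) (w : W) :
  v != 0 -> w != 0 -> pure v w != 0.
Proof.
move=> v0 w0; apply/eqP=> /matrixP vw0.
have /rV0Pn[i vi] : v2r v != 0 by apply: contraNneq v0; rewrite -(linear0 v2r) => /v2r_inj ->.
have /rV0Pn[j wj] : v2r w != 0 by apply: contraNneq w0; rewrite -(linear0 v2r) => /v2r_inj ->.
have := vw0 i j; rewrite !mxE big_ord1 mxE => /eqP.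
by rewrite mulf_eq0 (negPf vi) (negPf wj).
Qed.

Lemma tmul_nonzero : pure 1 1 != 0 :> tens A B.
Proof. by apply: pure_neq0; apply: oner_neq0. Qed.

HB.instance Definition _ := GRing.Zmodule_isNzRing.Build (tens A B)
  tmulA tmul1l tmul1r tmulDl tmulDr tmul_nonzero.

HB.instance Definition _ := GRing.Lmodule_isLalgebra.Build K (tens A B)
  (fun a s t => esym (tmulZl a s t)).

HB.instance Definition _ := GRing.Lalgebra_isAlgebra.Build K (tens A B)
  (fun a s t => esym (tmulZr a s t)).

HB.instance Definition _ := Algebra_isFalgebra.Build K (tens A B).

Lemma pureM (a c : A) (b d : B) : pure a b * pure c d = pure (a * c) (b * d).
Proof. exact: tmulE. Qed.

Lemma pure1 : pure 1 1 = 1 :> tens A B. Proof. by []. Qed.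

End TensorAlgebra.

Section MonoidalCategories.
Variable K : fieldType.

(* K-linear categories, K-linear monoidal categories and K-linear (strong)
   monoidal functors, with all coherence isomorphisms explicit.  Primed
   structure maps are the inverses of the corresponding unprimed ones. *)
Record category := Category {
  ob :> Type;
  hom : ob -> ob -> lmodType K;
  idm : forall X, hom X X;
  comp : forall X Y Z, hom Y Z -> hom X Y -> hom X Z;
  comp_linearl : forall X Y Z (f : hom X Y), linear (fun g : hom Y Z => comp g f);
  comp_linearr : forall X Y Z (g : hom Y Z), linear (fun f : hom X Y => comp g f);
  comp1m : forall X Y (f : hom X Y), comp (idm Y) f = f;
  compm1 : forall X Y (f : hom X Y), comp f (idm X) = f;
  compA : forall X Y Z T (h : hom Z T) (g : hom Y Z) (f : hom X Y),
    comp h (comp g f) = comp (comp h g) f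
}.

Definition inverses (C : category) (X Y : C) (f : hom X Y) (g : hom Y X) : Prop :=
  comp g f = idm X /\ comp f g = idm Y.

Record monoidalCategory := MonoidalCategory {
  moncat :> category;
  unit_ob : moncat;
  ten : moncat -> moncat -> moncat;
  tenm : forall X X' Y Y' : moncat,
    hom X X' -> hom Y Y' -> hom (ten X Y) (ten X' Y');
  tenm_linearl : forall (X X' Y Y' : moncat) (g : hom Y Y'),
    linear (fun f : hom X X' => tenm f g);
  tenm_linearr : forall (X X' Y Y' : moncat) (f : hom X X'),
    linear (fun g : hom Y Y' => tenm f g);
  tenm1 : forall X Y : moncat, tenm (idm X) (idm Y) = idm (ten X Y);
  tenm_comp : forall (X X' X'' Y Y' Y'' : moncat)
    (f' : hom X' X'') (f : hom X X') (g' : hom Y' Y'') (g : hom Y Y'),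
    tenm (comp f' f) (comp g' g) = comp (tenm f' g') (tenm f g);
  asc : forall X Y Z : moncat, hom (ten (ten X Y) Z) (ten X (ten Y Z));
  asc' : forall X Y Z : moncat, hom (ten X (ten Y Z)) (ten (ten X Y) Z);
  lun : forall X : moncat, hom (ten unit_ob X) X;
  lun' : forall X : moncat, hom X (ten unit_ob X);
  run : forall X : moncat, hom (ten X unit_ob) X;
  run' : forall X : moncat, hom X (ten X unit_ob);
  ascK : forall X Y Z, inverses (asc X Y Z) (asc' X Y Z);
  lunK : forall X, inverses (lun X) (lun' X);
  runK : forall X, inverses (run X) (run' X);
  asc_nat : forall (X X' Y Y' Z Z' : moncat)
    (f : hom X X') (g : hom Y Y') (h : hom Z Z'),
    comp (asc X' Y' Z') (tenm (tenm f g) h) =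
    comp (tenm f (tenm g h)) (asc X Y Z);
  lun_nat : forall (X X' : moncat) (f : hom X X'),
    comp (lun X') (tenm (idm unit_ob) f) = comp f (lun X);
  run_nat : forall (X X' : moncat) (f : hom X X'),
    comp (run X') (tenm f (idm unit_ob)) = comp f (run X);
  pentagon : forall X Y Z T : moncat,
    comp (asc X Y (ten Z T)) (asc (ten X Y) Z T) =
    comp (tenm (idm X) (asc Y Z T))
      (comp (asc X (ten Y Z) T) (tenm (asc X Y Z) (idm T)));
  triangle : forall X Y : moncat,
    comp (tenm (idm X) (lun Y)) (asc X unit_ob Y) = tenm (run X) (idm Y)
}.

Record tensorFunctor (C D : monoidalCategory) := TensorFunctor {
  fob :> C -> D;
  fmap : forall X Y : C, hom X Y -> hom (fob X) (fob Y);
  fmap_linear : forall X Y : C, linear (@fmap X Y);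
  fmap1 : forall X : C, fmap (idm X) = idm (fob X);
  fmap_comp : forall (X Y Z : C) (g : hom Y Z) (f : hom X Y),
    fmap (comp g f) = comp (fmap g) (fmap f);
  f2 : forall X Y : C, hom (ten (fob X) (fob Y)) (fob (ten X Y));
  f2' : forall X Y : C, hom (fob (ten X Y)) (ten (fob X) (fob Y));
  f0 : hom (unit_ob D) (fob (unit_ob C));
  f0' : hom (fob (unit_ob C)) (unit_ob D);
  f2K : forall X Y, inverses (f2 X Y) (f2' X Y);
  f0K : inverses f0 f0';
  f2_nat : forall (X X' Y Y' : C) (f : hom X X') (g : hom Y Y'),
    comp (f2 X' Y') (tenm (fmap f) (fmap g)) = comp (fmap (tenm f g)) (f2 X Y);
  f2_asc : forall X Y Z : C,
    comp (fmap (asc X Y Z))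
      (comp (f2 (ten X Y) Z) (tenm (f2 X Y) (idm (fob Z)))) =
    comp (f2 X (ten Y Z))
      (comp (tenm (idm (fob X)) (f2 Y Z)) (asc (fob X) (fob Y) (fob Z)));
  f2_lun : forall X : C,
    comp (fmap (lun X)) (comp (f2 (unit_ob C) X) (tenm f0 (idm (fob X)))) =
    lun (fob X);
  f2_run : forall X : C,
    comp (fmap (run X)) (comp (f2 X (unit_ob C)) (tenm (idm (fob X)) f0)) =
    run (fob X)
}.

Local Obligation Tactic := idtac.

Program Definition idFunctor (C : monoidalCategory) : tensorFunctor C C :=
  @TensorFunctor C C id (fun _ _ => id) _ _ _
    (fun X Y => idm (ten X Y)) (fun X Y => idm (ten X Y)) (idm _) (idm _)
    _ _ _ _ _ _.
Next Obligation. by []. Qed.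
Next Obligation. by []. Qed.
Next Obligation. by []. Qed.
Next Obligation. by move=> C X Y; split; rewrite comp1m. Qed.
Next Obligation. by move=> C; split; rewrite comp1m. Qed.
Next Obligation. by move=> C *; rewrite comp1m compm1. Qed.
Next Obligation. by move=> C *; rewrite !tenm1 !comp1m !compm1. Qed.
Next Obligation. by move=> C *; rewrite tenm1 !compm1. Qed.
Next Obligation. by move=> C *; rewrite tenm1 !compm1. Qed.

End MonoidalCategories.

Section DavydovYetter.
Variables (K : fieldType) (C D : monoidalCategory K) (F : tensorFunctor C D).

(* C^n, as right-nested tuples, and its morphisms. *)
Fixpoint obs (n : nat) : Type := if n is m.+1 then (C * obs m)%type else unit.

Fixpoint homs n : obs n -> obs n -> Type :=
  match n return obs n -> obs n -> Type with
  | 0 => fun _ _ => unit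
  | m.+1 => fun X Y => (hom X.1 Y.1 * homs X.2 Y.2)%type
  end.

(* The functor ⊗^n ∘ F^n.  The n-fold tensor product is bracketed to the right
   and ends with the unit object,
     F X_1 ⊗ (F X_2 ⊗ (... ⊗ (F X_n ⊗ I))),
   so that the empty product is I and families of endomorphisms indexed by C^0
   are the endomorphisms of I. *)
Fixpoint tpow n : obs n -> D :=
  match n return obs n -> D with
  | 0 => fun _ => unit_ob D
  | m.+1 => fun X => ten (F X.1) (tpow X.2)
  end.

Fixpoint tpowm n : forall X Y : obs n, homs X Y -> hom (tpow X) (tpow Y) :=
  match n return forall X Y : obs n, homs X Y -> hom (tpow X) (tpow Y) with
  | 0 => fun _ _ _ => idm (unit_ob D)
  | m.+1 => fun X Y u => tenm (fmap F u.1) (tpowm u.2)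
  end.

(* (X_0, ..., X_{n+1}) |-> (X_0, ..., X_i ⊗ X_{i+1}, ..., X_{n+1}), with the
   coherence isomorphism between the corresponding tensor products.  When i > n
   the last two entries are tensored; this case is never used. *)
Definition merge0 n (X : obs n.+2) : obs n.+1 := (ten X.1 X.2.1, X.2.2).

Definition mergem0 n (X : obs n.+2) : hom (tpow X) (tpow (merge0 X)) :=
  comp (tenm (f2 F X.1 X.2.1) (@idm K D (@tpow n X.2.2)))
       (asc' (F X.1) (F X.2.1) (@tpow n X.2.2)).

Definition mergem0' n (X : obs n.+2) : hom (tpow (merge0 X)) (tpow X) :=
  comp (asc (F X.1) (F X.2.1) (@tpow n X.2.2))
       (tenm (f2' F X.1 X.2.1) (@idm K D (@tpow n X.2.2))).

Fixpoint merge n (i : nat) : obs n.+2 -> obs n.+1 :=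
  match n, i return obs n.+2 -> obs n.+1 with
  | m.+1, j.+1 => fun X => (X.1, merge j X.2)
  | m.+1, 0 => @merge0 m.+1
  | 0, _ => @merge0 0
  end.

Fixpoint mergem n (i : nat) :
    forall X : obs n.+2, hom (tpow X) (tpow (merge i X)) :=
  match n, i return forall X : obs n.+2, hom (tpow X) (tpow (merge i X)) with
  | m.+1, j.+1 => fun X => tenm (idm (F X.1)) (mergem j X.2)
  | m.+1, 0 => @mergem0 m.+1
  | 0, _ => @mergem0 0
  end.

Fixpoint mergem' n (i : nat) :
    forall X : obs n.+2, hom (tpow (merge i X)) (tpow X) :=
  match n, i return forall X : obs n.+2, hom (tpow (merge i X)) (tpow X) with
  | m.+1, j.+1 => fun X => tenm (idm (F X.1)) (mergem' j X.2)
  | m.+1, 0 => @mergem0' m.+1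
  | 0, _ => @mergem0' 0
  end.

(* (X_0, ..., X_{n-1}) and X_n, with the coherence isomorphism
   (F X_0 ⊗ ... ⊗ F X_{n-1}) ⊗ F X_n -> F X_0 ⊗ ... ⊗ F X_n. *)
Fixpoint ofront n : obs n.+1 -> obs n :=
  match n return obs n.+1 -> obs n with
  | 0 => fun _ => tt
  | m.+1 => fun X => (X.1, ofront X.2)
  end.

Fixpoint olast n : obs n.+1 -> C :=
  match n return obs n.+1 -> C with
  | 0 => fun X => X.1
  | m.+1 => fun X => olast X.2
  end.

Fixpoint snocm n : forall X : obs n.+1,
    hom (ten (tpow (ofront X)) (F (olast X))) (tpow X) :=
  match n return forall X : obs n.+1,
    hom (ten (tpow (ofront X)) (F (olast X))) (tpow X) with
  | 0 => fun X => comp (run' (F X.1)) (lun (F X.1))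
  | m.+1 => fun X =>
      comp (tenm (idm (F X.1)) (snocm X.2))
           (asc (F X.1) (tpow (ofront X.2)) (F (olast X.2)))
  end.

Fixpoint snocm' n : forall X : obs n.+1,
    hom (tpow X) (ten (tpow (ofront X)) (F (olast X))) :=
  match n return forall X : obs n.+1,
    hom (tpow X) (ten (tpow (ofront X)) (F (olast X))) with
  | 0 => fun X => comp (lun' (F X.1)) (run (F X.1))
  | m.+1 => fun X =>
      comp (asc' (F X.1) (tpow (ofront X.2)) (F (olast X.2)))
           (tenm (idm (F X.1)) (snocm' X.2))
  end.

(* The Davydov-Yetter n-cochains are the natural families. *)
Definition family (n : nat) : Type := forall X : obs n, hom (tpow X) (tpow X).

Definition natural n (f : family n) : Prop :=
  forall (X Y : obs n) (u : homs X Y), comp (tpowm u) (f X) = comp (f Y) (tpowm u).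

Definition dy_first n (f : family n) : family n.+1 :=
  fun X => tenm (idm (F X.1)) (f X.2).

Definition dy_merge n (i : nat) (f : family n.+1) : family n.+2 :=
  fun X => comp (mergem' i X) (comp (f (merge i X)) (mergem i X)).

Definition dy_last n (f : family n) : family n.+1 :=
  fun X => comp (snocm X)
    (comp (tenm (f (ofront X)) (idm (F (olast X)))) (snocm' X)).

(* The index i is shifted by one: the i-th term tensors X_i with X_{i+1}. *)
Definition dy_middle n : family n -> family n.+1 :=
  match n return family n -> family n.+1 with
  | 0 => fun _ _ => 0
  | m.+1 => fun f X => \sum_(i < m.+1) (-1) ^+ i.+1 *: dy_merge i f X
  end.

Definition dy_diff n (f : family n) : family n.+1 := fun X =>
  dy_first f X + dy_middle f X + (-1) ^+ n.+1 *: dy_last f X.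

Definition dy_cocycle n (f : family n) : Prop :=
  natural f /\ forall X, dy_diff f X = 0.

Definition dy_coboundary n : family n -> Prop :=
  match n return family n -> Prop with
  | 0 => fun f => forall X, f X = 0
  | m.+1 => fun f => exists2 h : family m, natural h & forall X, f X = dy_diff h X
  end.

(* "H^n_DY(F) has finite dimension d": the classes of c_0, ..., c_{d-1} form a
   basis of the quotient of the n-cocycles by the n-coboundaries. *)
Definition dy_dim (n d : nat) : Prop :=
  exists c : 'I_d -> family n,
    [/\ forall i, dy_cocycle (c i),
        forall f, dy_cocycle f -> exists a : 'I_d -> K,
          dy_coboundary (fun X => f X - \sum_i a i *: c i X)
      & forall a : 'I_d -> K,
          dy_coboundary (fun X => \sum_i a i *: c i X) -> forall i, a i = 0].

Lemma inv_comp (E : category K) (X Y Z : E) (f : hom X Y) (f' : hom Y X)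
    (g : hom Y Z) (g' : hom Z Y) :
  inverses f f' -> inverses g g' -> inverses (comp g f) (comp f' g').
Proof.
move=> [ff' f'f] [gg' g'g]; split.
  by rewrite -compA (compA g') gg' comp1m.
by rewrite -compA (compA f) f'f comp1m.
Qed.

Lemma inv_tenm (E : monoidalCategory K) (X X' Y Y' : E) (f : hom X X')
    (f' : hom X' X) (g : hom Y Y') (g' : hom Y' Y) :
  inverses f f' -> inverses g g' -> inverses (tenm f g) (tenm f' g').
Proof.
by move=> [ff' f'f] [gg' g'g]; split; rewrite -tenm_comp ?ff' ?gg' ?f'f ?g'g tenm1.
Qed.

Lemma inv_id (E : category K) (X : E) : inverses (idm X) (idm X).
Proof. by split; rewrite comp1m. Qed.

Lemma inv_sym (E : category K) (X Y : E) (f : hom X Y) (g : hom Y X) :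
  inverses f g -> inverses g f.
Proof. by case. Qed.

Lemma mergem0K n (X : obs n.+2) : inverses (mergem0 X) (mergem0' X).
Proof.
by apply: inv_comp; [apply/inv_sym/ascK | apply/inv_tenm/inv_id/f2K].
Qed.

Lemma mergemK n i (X : obs n.+2) : inverses (mergem i X) (mergem' i X).
Proof.
elim: n i X => [|n IH] [|i] X; try exact: mergem0K.
by apply: inv_tenm; [apply: inv_id | apply: IH].
Qed.

Lemma snocmK n (X : obs n.+1) : inverses (snocm X) (snocm' X).
Proof.
elim: n X => [|n IH] X.
  by apply: inv_comp; [apply: lunK | apply/inv_sym/runK].
by apply: inv_comp; [apply: ascK | apply: inv_tenm (IH _); apply: inv_id].
Qed.

End DavydovYetter.

Section VectorSpaces.
Variable K : fieldType.

Lemma lfun_compDl (U V W : vectType K) (f : 'Hom(U, V)) :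
  linear (fun g : 'Hom(V, W) => (g \o f)%VF).
Proof. by move=> a g h; rewrite comp_lfunDl comp_lfunZl. Qed.

Lemma lfun_compDr (U V W : vectType K) (g : 'Hom(V, W)) :
  linear (fun f : 'Hom(U, V) => (g \o f)%VF).
Proof. by move=> a f h; rewrite comp_lfunDr comp_lfunZr. Qed.

Definition VecCat : category K :=
  @Category K (vectType K) (fun U V => 'Hom(U, V)) (fun U => \1%VF)
    (fun U V W g f => (g \o f)%VF) lfun_compDl lfun_compDr
    (fun U V f => comp_lfun1l f) (fun U V f => comp_lfun1r f)
    (fun U V W X h g f => comp_lfunA h g f).

Lemma tassocK (U V W : vectType K) :
  (tassoc' U V W \o tassoc U V W = \1)%VF /\
  (tassoc U V W \o tassoc' U V W = \1)%VF.
Proof.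
by split; [apply: tens_lfun_ext3 | apply: tens_lfun_ext3'] => u v w;
  rewrite comp_lfunE id_lfunE ?tassocE ?tassoc'E ?tassocE.
Qed.

Lemma tlunitK (V : vectType K) :
  (tlunit' V \o tlunit V = \1)%VF /\ (tlunit V \o tlunit' V = \1)%VF.
Proof.
split; last first.
  by apply/lfunP=> v; rewrite comp_lfunE id_lfunE purehE tlunitE scale1r.
apply: tens_lfun_ext => a v; rewrite comp_lfunE id_lfunE purehE tlunitE.
by rewrite pureZr -pureZl [_ *: _]mulr1.
Qed.

Lemma trunitK (V : vectType K) :
  (trunit' V \o trunit V = \1)%VF /\ (trunit V \o trunit' V = \1)%VF.
Proof.
split; last first.
  by apply/lfunP=> v; rewrite comp_lfunE id_lfunE rpurehE trunitE scale1r.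
apply: tens_lfun_ext => v a; rewrite comp_lfunE id_lfunE rpurehE trunitE.
by rewrite pureZl -pureZr [_ *: _]mulr1.
Qed.

Lemma tassoc_nat (U U' V V' W W' : vectType K)
    (f : 'Hom(U, U')) (g : 'Hom(V, V')) (h : 'Hom(W, W')) :
  (tassoc U' V' W' \o tmap (tmap f g) h =
   tmap f (tmap g h) \o tassoc U V W)%VF.
Proof.
by apply: tens_lfun_ext3 => u v w; rewrite !comp_lfunE !(tmapE, tassocE).
Qed.

Lemma tlunit_nat (V V' : vectType K) (f : 'Hom(V, V')) :
  (tlunit V' \o tmap \1 f = f \o tlunit V)%VF.
Proof.
by apply: tens_lfun_ext => a v;
  rewrite !comp_lfunE tmapE !tlunitE id_lfunE linearZ.
Qed.

Lemma trunit_nat (V V' : vectType K) (f : 'Hom(V, V')) :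
  (trunit V' \o tmap f \1 = f \o trunit V)%VF.
Proof.
by apply: tens_lfun_ext => a v;
  rewrite !comp_lfunE tmapE !trunitE id_lfunE linearZ.
Qed.

Lemma tassoc_pentagon (U V W X : vectType K) :
  (tassoc U V (tens W X) \o tassoc (tens U V) W X =
   tmap \1 (tassoc V W X) \o (tassoc U (tens V W) X \o tmap (tassoc U V W) \1))%VF.
Proof.
apply: tens_lfun_ext4 => u v w x; rewrite !comp_lfunE !tmapE !tassocE.
by rewrite tmapE !id_lfunE tassocE.
Qed.

Lemma tassoc_triangle (U V : vectType K) :
  (tmap \1 (tlunit V) \o tassoc U K^o V = tmap (trunit U) \1)%VF.
Proof.
apply: tens_lfun_ext3 => u a v; rewrite !comp_lfunE !tassocE !tmapE.
by rewrite tlunitE trunitE id_lfunE pureZl pureZr id_lfunE.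
Qed.

Definition Vec : monoidalCategory K :=
  @MonoidalCategory K VecCat K^o (@tens K)
    (@tmap K)
    (fun X X' Y Y' => (tmap_bilin X X' Y Y').2)
    (fun X X' Y Y' => (tmap_bilin X X' Y Y').1)
    (@tmap_id K) (fun X X' X'' Y Y' Y'' => @tmap_comp K X X' X'' Y Y' Y'')
    (@tassoc K) (@tassoc' K) (@tlunit K) (@tlunit' K) (@trunit K) (@trunit' K)
    tassocK tlunitK trunitK tassoc_nat tlunit_nat trunit_nat
    tassoc_pentagon tassoc_triangle.

End VectorSpaces.

Section HopfAlgebras.
Variable K : fieldType.

Record hopfAlgebra := HopfAlgebra {
  hopf_alg :> falgType K;
  comul : 'Hom(hopf_alg, tens hopf_alg hopf_alg);
  counit : 'Hom(hopf_alg, K^o);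
  antipode : 'End(hopf_alg);
  comul1 : comul 1 = 1;
  comulM : forall a b, comul (a * b) = comul a * comul b;
  counit1 : counit 1 = 1;
  counitM : forall a b, counit (a * b) = counit a * counit b;
  comulA : (tassoc _ _ _ \o tmap comul \1 \o comul = tmap \1 comul \o comul)%VF;
  counitl : (tlunit _ \o tmap counit \1 \o comul = \1)%VF;
  counitr : (trunit _ \o tmap \1 counit \o comul = \1)%VF;
  antipodel : forall a,
    tlift (fun b c => antipode b * c) (comul a) = counit a *: 1;
  antipoder : forall a,
    tlift (fun b c => b * antipode c) (comul a) = counit a *: 1
}.

Arguments comul _ : clear implicits.
Arguments counit _ : clear implicits.
Arguments antipode _ : clear implicits.

Variable H : hopfAlgebra.

(* Finite-dimensional left H-modules; the zero module is allowed, so that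
   'End(hmod_space) need not be a nontrivial ring. *)
Record hmodule := HModule {
  hmod_space :> vectType K;
  act : 'Hom(H, 'End(hmod_space));
  act1 : act 1 = \1%VF;
  actM : forall a b, act (a * b) = (act a \o act b)%VF
}.

Arguments act _ : clear implicits.

Definition hlin (X Y : hmodule) : {pred 'Hom(X, Y)} :=
  fun f => `[< forall a, (f \o act X a = act Y a \o f)%VF >].

Arguments hlin _ _ : clear implicits.

Lemma hlinP (X Y : hmodule) (f : 'Hom(X, Y)) :
  reflect (forall a, (f \o act X a = act Y a \o f)%VF) (f \in hlin X Y).
Proof. exact: asboolP. Qed.

Lemma hlin_submod (X Y : hmodule) : submod_closed (hlin X Y).
Proof.
split=> [|a f g /hlinP fP /hlinP gP]; apply/hlinP => h.
  by rewrite comp_lfun0l comp_lfun0r.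
by rewrite lfun_compDl lfun_compDr fP gP.
Qed.

HB.instance Definition _ (X Y : hmodule) :=
  GRing.isSubmodClosed.Build K 'Hom(X, Y) (hlin X Y) (hlin_submod X Y).

Record hhom (X Y : hmodule) := HHom {
  hhom_fun :> 'Hom(X, Y);
  hhom_lin : hhom_fun \in hlin X Y
}.

HB.instance Definition _ (X Y : hmodule) := [isSub for @hhom_fun X Y].
HB.instance Definition _ (X Y : hmodule) := [Choice of hhom X Y by <:].
HB.instance Definition _ (X Y : hmodule) :=
  [SubChoice_isSubLmodule of hhom X Y by <:].

Lemma hhom_inj (X Y : hmodule) : injective (@hhom_fun X Y).
Proof. exact: val_inj. Qed.

Lemma hlin1 (X : hmodule) : \1%VF \in hlin X X.
Proof. by apply/hlinP => a; rewrite comp_lfun1l comp_lfun1r. Qed.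

Lemma hlin_comp (X Y Z : hmodule) (g : hhom Y Z) (f : hhom X Y) :
  (g \o f)%VF \in hlin X Z.
Proof.
apply/hlinP => a; rewrite -comp_lfunA (hlinP _ (hhom_lin f)).
by rewrite comp_lfunA (hlinP _ (hhom_lin g)) comp_lfunA.
Qed.

Definition hid X := HHom (hlin1 X).
Definition hcomp X Y Z (g : hhom Y Z) (f : hhom X Y) := HHom (hlin_comp g f).

Lemma hcomp_linearl X Y Z (f : hhom X Y) : linear (fun g : hhom Y Z => hcomp g f).
Proof. by move=> a g h; apply: hhom_inj; rewrite /= lfun_compDl. Qed.

Lemma hcomp_linearr X Y Z (g : hhom Y Z) : linear (fun f : hhom X Y => hcomp g f).
Proof. by move=> a f h; apply: hhom_inj; rewrite /= lfun_compDr. Qed.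

Lemma hcomp1l X Y (f : hhom X Y) : hcomp (hid Y) f = f.
Proof. by apply: hhom_inj; rewrite /= comp_lfun1l. Qed.

Lemma hcomp1r X Y (f : hhom X Y) : hcomp f (hid X) = f.
Proof. by apply: hhom_inj; rewrite /= comp_lfun1r. Qed.

Lemma hcompA X Y Z T (h : hhom Z T) (g : hhom Y Z) (f : hhom X Y) :
  hcomp h (hcomp g f) = hcomp (hcomp h g) f.
Proof. by apply: hhom_inj; rewrite /= comp_lfunA. Qed.

Definition HmodCat : category K :=
  @Category K hmodule (fun X Y => hhom X Y) hid hcomp
    hcomp_linearl hcomp_linearr hcomp1l hcomp1r hcompA.

(* H acts on X ⊗ Y through the coproduct: a (x ⊗ y) = sum a_1 x ⊗ a_2 y. *)
Definition act2 (X Y : hmodule) : 'Hom(tens H H, 'End(tens X Y)) :=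
  tlift (fun a b => tmap (act X a) (act Y b)).

Lemma act2E (X Y : hmodule) a b :
  act2 X Y (pure a b) = tmap (act X a) (act Y b).
Proof.
rewrite tliftE //; apply: bilin_comp (tmap_bilin _ _ _ _); exact: linearP.
Qed.

Lemma act2_1 (X Y : hmodule) : act2 X Y 1 = \1%VF.
Proof. by rewrite -pure1 act2E !act1 tmap_id. Qed.

Lemma act2M (X Y : hmodule) s t : act2 X Y (s * t) = (act2 X Y s \o act2 X Y t)%VF.
Proof.
apply: (tens_ext (f := fun s => act2 X Y (s * t))
           (g := fun s => (act2 X Y s \o act2 X Y t)%VF)) s => [||a b].
- by move=> c x y; rewrite mulrDl -scalerAl linearP.
- by move=> c x y; rewrite linearP lfun_compDl.
apply: (tens_ext (f := fun t => act2 X Y (pure a b * t))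
           (g := fun t => (act2 X Y (pure a b) \o act2 X Y t)%VF)) t => [||c d].
- by move=> c x y; rewrite mulrDr -scalerAr linearP.
- by move=> c x y; rewrite linearP lfun_compDr.
by rewrite pureM !act2E !actM tmap_comp.
Qed.

Definition htens_act (X Y : hmodule) := (act2 X Y \o comul H)%VF.

Lemma htens_act1 X Y : htens_act X Y 1 = \1%VF.
Proof. by rewrite comp_lfunE comul1 act2_1. Qed.

Lemma htens_actM X Y a b :
  htens_act X Y (a * b) = (htens_act X Y a \o htens_act X Y b)%VF.
Proof. by rewrite !comp_lfunE comulM act2M. Qed.

Definition htens (X Y : hmodule) : hmodule :=
  @HModule (tens X Y) (htens_act X Y) (htens_act1 X Y) (@htens_actM X Y).

Definition hunit_act : 'Hom(H, 'End(K^o)) :=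
  linfun (fun a => counit H a *: (\1%VF : 'End(K^o))).

Lemma hunit_actE a : hunit_act a = counit H a *: \1%VF.
Proof.
pose f a := counit H a *: (\1%VF : 'End(K^o)).
have lf : linear f by move=> c x y; rewrite /f linearP scalerDl scalerA.
pose F := HB.pack_for {linear H -> 'End(K^o)} f
  (GRing.isSemilinear.Build K _ _ _ f (GRing.semilinear_linear lf)).
exact: (lfunE F).
Qed.

Lemma hunit_act1 : hunit_act 1 = \1%VF.
Proof. by rewrite hunit_actE counit1 scale1r. Qed.

Lemma hunit_actM a b : hunit_act (a * b) = (hunit_act a \o hunit_act b)%VF.
Proof.
by rewrite !hunit_actE -comp_lfunZl -comp_lfunZr comp_lfun1l scalerA counitM.
Qed.

Definition hunit : hmodule := @HModule K^o hunit_act hunit_act1 hunit_actM.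

Lemma tmap_hlin (X X' Y Y' : hmodule) (f : hhom X X') (g : hhom Y Y') :
  tmap f g \in hlin (htens X Y) (htens X' Y').
Proof.
apply/hlinP => a; rewrite /= !comp_lfunE; move: (comul H a) => t.
apply: (tens_ext (f := fun t => (tmap f g \o act2 X Y t)%VF)
           (g := fun t => (act2 X' Y' t \o tmap f g)%VF)) t => [||b c].
- by move=> d x y; rewrite linearP lfun_compDr.
- by move=> d x y; rewrite linearP lfun_compDl.
by rewrite !act2E -!tmap_comp (hlinP _ (hhom_lin f)) (hlinP _ (hhom_lin g)).
Qed.

Definition htmap X X' Y Y' (f : hhom X X') (g : hhom Y Y') :
  hhom (htens X Y) (htens X' Y') := HHom (tmap_hlin f g).

Definition act3 (X Y Z : hmodule) : 'Hom(tens H (tens H H), 'End(tens X (tens Y Z))) :=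
  tlift (fun a t => tmap (act X a) (act2 Y Z t)).

Lemma act3E (X Y Z : hmodule) a t :
  act3 X Y Z (pure a t) = tmap (act X a) (act2 Y Z t).
Proof.
rewrite tliftE //; apply: bilin_comp (tmap_bilin _ _ _ _); exact: linearP.
Qed.

Lemma tassoc_hlin (X Y Z : hmodule) :
  tassoc X Y Z \in hlin (htens (htens X Y) Z) (htens X (htens Y Z)).
Proof.
apply/hlinP => a; rewrite /= !comp_lfunE.
have r t : act2 X (htens Y Z) t = act3 X Y Z (tmap \1%VF (comul H) t).
  apply: (tens_ext (f := act2 X (htens Y Z))
    (g := fun t => act3 X Y Z (tmap \1%VF (comul H) t))) t => [||b c].
  - exact: linearP.
  - by move=> d x y; rewrite !linearP.
  by rewrite act2E tmapE act3E id_lfunE /= comp_lfunE.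
have l t : (tassoc X Y Z \o act2 (htens X Y) Z t =
    act3 X Y Z (tassoc _ _ _ (tmap (comul H) \1%VF t)) \o tassoc X Y Z)%VF.
  apply: (tens_ext (f := fun t => (tassoc X Y Z \o act2 (htens X Y) Z t)%VF)
    (g := fun t => (act3 X Y Z (tassoc _ _ _ (tmap (comul H) \1%VF t))
                     \o tassoc X Y Z)%VF)) t => [||b c].
  - by move=> d x y; rewrite linearP lfun_compDr.
  - by move=> d x y; rewrite !linearP lfun_compDl.
  rewrite act2E tmapE id_lfunE /= comp_lfunE; move: (comul H b) => s.
  apply: (tens_ext (f := fun s => (tassoc X Y Z \o tmap (act2 X Y s) (act Z c))%VF)
    (g := fun s => (act3 X Y Z (tassoc _ _ _ (pure s c)) \o tassoc X Y Z)%VF)) s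
    => [||d e].
  - by move=> d x y; rewrite linearP (tmap_bilin _ _ _ _).2 lfun_compDr.
  - by move=> d x y; rewrite (pure_bilin _ _).2 !linearP lfun_compDl.
  by rewrite act2E tassocE act3E act2E tassoc_nat.
rewrite l r; congr (act3 _ _ _ _ \o _)%VF.
by have /lfunP/(_ a) := comulA H; rewrite !comp_lfunE.
Qed.

Lemma hlin_inv (X Y : hmodule) (f : 'Hom(X, Y)) (g : 'Hom(Y, X)) :
  (g \o f = \1)%VF -> (f \o g = \1)%VF -> f \in hlin X Y -> g \in hlin Y X.
Proof.
move=> gf fg /hlinP fP; apply/hlinP => a.
rewrite -[LHS]comp_lfun1r -fg comp_lfunA -[in LHS](comp_lfunA g) -fP.
by rewrite comp_lfunA gf comp_lfun1l.
Qed.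

Lemma tlunit_hlin (X : hmodule) : tlunit X \in hlin (htens hunit X) X.
Proof.
apply/hlinP => a; rewrite /= comp_lfunE.
have l t : (tlunit X \o act2 hunit X t =
    act X (tlunit _ (tmap (counit H) \1%VF t)) \o tlunit X)%VF.
  apply: (tens_ext (f := fun t => (tlunit X \o act2 hunit X t)%VF)
    (g := fun t => (act X (tlunit _ (tmap (counit H) \1%VF t)) \o tlunit X)%VF)) t
    => [||b c].
  - by move=> d x y; rewrite linearP lfun_compDr.
  - by move=> d x y; rewrite !linearP lfun_compDl.
  rewrite act2E tmapE id_lfunE tlunitE; apply: tens_lfun_ext => e x.
  rewrite !comp_lfunE tmapE !tlunitE /= hunit_actE scale_lfunE id_lfunE.
  by rewrite !linearZ /= scale_lfunE !scalerA [in RHS]mulrC.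
rewrite l; congr (act X _ \o _)%VF.
by have /lfunP/(_ a) := counitl H; rewrite !comp_lfunE id_lfunE.
Qed.

Lemma trunit_hlin (X : hmodule) : trunit X \in hlin (htens X hunit) X.
Proof.
apply/hlinP => a; rewrite /= comp_lfunE.
have l t : (trunit X \o act2 X hunit t =
    act X (trunit _ (tmap \1%VF (counit H) t)) \o trunit X)%VF.
  apply: (tens_ext (f := fun t => (trunit X \o act2 X hunit t)%VF)
    (g := fun t => (act X (trunit _ (tmap \1%VF (counit H) t)) \o trunit X)%VF)) t
    => [||b c].
  - by move=> d x y; rewrite linearP lfun_compDr.
  - by move=> d x y; rewrite !linearP lfun_compDl.
  rewrite act2E tmapE id_lfunE trunitE; apply: tens_lfun_ext => x e.
  rewrite !comp_lfunE tmapE !trunitE /= hunit_actE scale_lfunE id_lfunE.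
  by rewrite !linearZ /= scale_lfunE !scalerA [in RHS]mulrC.
rewrite l; congr (act X _ \o _)%VF.
by have /lfunP/(_ a) := counitr H; rewrite !comp_lfunE id_lfunE.
Qed.

Definition hassoc X Y Z : hhom (htens (htens X Y) Z) (htens X (htens Y Z)) :=
  HHom (tassoc_hlin X Y Z).
Definition hassoc' (X Y Z : hmodule) :
    hhom (htens X (htens Y Z)) (htens (htens X Y) Z) :=
  HHom (hlin_inv (X := htens (htens X Y) Z) (Y := htens X (htens Y Z))
          (tassocK X Y Z).1 (tassocK X Y Z).2 (tassoc_hlin X Y Z)).
Definition hlunit X : hhom (htens hunit X) X := HHom (tlunit_hlin X).
Definition hlunit' X : hhom X (htens hunit X) :=
  HHom (hlin_inv (X := htens hunit X) (tlunitK X).1 (tlunitK X).2 (tlunit_hlin X)).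
Definition hrunit X : hhom (htens X hunit) X := HHom (trunit_hlin X).
Definition hrunit' X : hhom X (htens X hunit) :=
  HHom (hlin_inv (X := htens X hunit) (trunitK X).1 (trunitK X).2 (trunit_hlin X)).

Local Obligation Tactic := idtac.

Program Definition Hmod : monoidalCategory K :=
  @MonoidalCategory K HmodCat hunit htens (fun X X' Y Y' => @htmap X X' Y Y')
    _ _ _ _ hassoc hassoc' hlunit hlunit' hrunit hrunit' _ _ _ _ _ _ _ _.
Next Obligation.
by move=> X X' Y Y' g a f h; apply: hhom_inj; apply: (tmap_bilin _ _ _ _).2.
Qed.
Next Obligation.
by move=> X X' Y Y' f a g h; apply: hhom_inj; apply: (tmap_bilin _ _ _ _).1.
Qed.
Next Obligation. by move=> X Y; apply: hhom_inj; apply: tmap_id. Qed.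
Next Obligation. by move=> *; apply: hhom_inj; apply: tmap_comp. Qed.
Next Obligation.
by move=> X Y Z; split; apply: hhom_inj; [apply: (tassocK _ _ _).1 | apply: (tassocK _ _ _).2].
Qed.
Next Obligation.
by move=> X; split; apply: hhom_inj; [apply: (tlunitK _).1 | apply: (tlunitK _).2].
Qed.
Next Obligation.
by move=> X; split; apply: hhom_inj; [apply: (trunitK _).1 | apply: (trunitK _).2].
Qed.
Next Obligation. by move=> *; apply: hhom_inj; apply: tassoc_nat. Qed.
Next Obligation. by move=> *; apply: hhom_inj; apply: tlunit_nat. Qed.
Next Obligation. by move=> *; apply: hhom_inj; apply: trunit_nat. Qed.
Next Obligation. by move=> *; apply: hhom_inj; apply: tassoc_pentagon. Qed.
Next Obligation. by move=> *; apply: hhom_inj; apply: tassoc_triangle. Qed.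

Program Definition forget : tensorFunctor Hmod (Vec K) :=
  @TensorFunctor K Hmod (Vec K) hmod_space (fun X Y f => hhom_fun f) _ _ _
    (fun X Y => \1%VF) (fun X Y => \1%VF) \1%VF \1%VF _ _ _ _ _ _.
Next Obligation. by []. Qed.
Next Obligation. by []. Qed.
Next Obligation. by []. Qed.
Next Obligation. by move=> X Y; split; apply: comp_lfun1l. Qed.
Next Obligation. by split; apply: comp_lfun1l. Qed.
Next Obligation. by move=> *; rewrite /= comp_lfun1l comp_lfun1r. Qed.
Next Obligation. by move=> *; rewrite /= !tmap_id !comp_lfun1l !comp_lfun1r. Qed.
Next Obligation. by move=> *; rewrite /= tmap_id !comp_lfun1r. Qed.
Next Obligation. by move=> *; rewrite /= tmap_id !comp_lfun1r. Qed.

End HopfAlgebras.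

Lemma eq_bigl_seq (R : Type) (idx : R) (op : R -> R -> R) (I : eqType)
    (r : seq I) (P Q : pred I) (F : I -> R) :
  {in r, P =1 Q} ->
  \big[op/idx]_(i <- r | P i) F i = \big[op/idx]_(i <- r | Q i) F i.
Proof.
move=> PQ; rewrite big_seq_cond [RHS]big_seq_cond; apply: eq_bigl => i.
exact/andb_id2l/PQ.
Qed.

(* The Clifford algebra on anticommuting generators e_i, i < n, with
   e_i ^+ 2 = q i.  Its basis is indexed by subsets S = {i_1 < ... < i_r}, with
   e_S = e_{i_1} ... e_{i_r} (cbas_prod), and e_S e_T is, up to the scalar
   ccoef S T, the basis vector of the symmetric difference: the first factor of
   ccoef is the sign of the reordering, the second one removes the squares. *)
Section CliffordAlgebra.
Variables (K : fieldType) (n : nat) (q : 'I_n -> K).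

Definition clifford of ('I_n -> K) : Type := {ffun {set 'I_n} -> K^o}.
Local Notation cliff := (clifford q).

HB.instance Definition _ := Vector.copy cliff {ffun {set 'I_n} -> K^o}.

Definition symdiff (S T : {set 'I_n}) : {set 'I_n} := (S :\: T) :|: (T :\: S).

Definition ccoef (S T : {set 'I_n}) : K :=
  (\prod_(i in S) \prod_(j in T | (j < i)%N) -1) * \prod_(i in S :&: T) q i.

Definition cbas (S : {set 'I_n}) : cliff := [ffun T => (T == S)%:R].

Definition cmul (f h : cliff) : cliff :=
  \sum_S \sum_T (f S * h T * ccoef S T) *: cbas (symdiff S T).

Lemma cliff_sum (f : cliff) : f = \sum_S (f S : K) *: cbas S.
Proof.
apply/ffunP => T; rewrite sum_ffunE (bigD1 T) //= !ffunE eqxx [_ *: _]mulr1.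
by rewrite big1 ?addr0 // => S /negPf TS; rewrite !ffunE eq_sym TS [_ *: _]mulr0.
Qed.

Lemma cliff_ext (U : vectType K) (f h : cliff -> U) : linear f -> linear h ->
  (forall S, f (cbas S) = h (cbas S)) -> f =1 h.
Proof.
move=> lf lh fh x.
pose F := HB.pack_for {linear cliff -> U} f
  (GRing.isSemilinear.Build K _ _ _ f (GRing.semilinear_linear lf)).
pose G := HB.pack_for {linear cliff -> U} h
  (GRing.isSemilinear.Build K _ _ _ h (GRing.semilinear_linear lh)).
rewrite [x]cliff_sum -[f]/(F : _ -> _) -[h]/(G : _ -> _) !linear_sum.
by apply: eq_bigr => S _; rewrite !linearZ /= fh.
Qed.

Lemma cmul_linearl h : linear (cmul^~ h).
Proof.
move=> a x y; rewrite /cmul scaler_sumr -big_split; apply: eq_bigr => S _.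
rewrite scaler_sumr -big_split; apply: eq_bigr => T _ /=.
by rewrite !ffunE [_ *: x S]/(_ * _) scalerA -scalerDl !mulrDl !mulrA.
Qed.

Lemma cmul_linearr f : linear (cmul f).
Proof.
move=> a x y; rewrite /cmul scaler_sumr -big_split; apply: eq_bigr => S _.
rewrite scaler_sumr -big_split; apply: eq_bigr => T _ /=.
rewrite !ffunE [_ *: x T]/(_ * _) scalerA -scalerDl !(mulrDr, mulrDl) !mulrA.
by rewrite [f S * a]mulrC.
Qed.

Lemma cmulE S T : cmul (cbas S) (cbas T) = ccoef S T *: cbas (symdiff S T).
Proof.
rewrite /cmul (bigD1 S) //= (bigD1 T) //= !ffunE !eqxx !mul1r.
rewrite !big1 ?addr0 // => [S' /negPf S'S|T' /negPf T'T].
  by rewrite big1 // => T' _; rewrite !ffunE S'S !mul0r scale0r.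
by rewrite !ffunE T'T mulr0 mul0r scale0r.
Qed.

Lemma in_symdiff S T i : (i \in symdiff S T) = (i \in S) (+) (i \in T).
Proof. by rewrite !inE; case: (i \in S); case: (i \in T). Qed.

Lemma ccoefE S T : ccoef S T =
  (\prod_(i < n) \prod_(j < n) (if [&& (j < i)%N, i \in S & j \in T] then -1 else 1)) *
  \prod_(i < n) (if (i \in S) && (i \in T) then q i else 1).
Proof.
congr (_ * _); last by rewrite big_mkcond; apply: eq_bigr => i _; rewrite inE.
rewrite big_mkcond; apply: eq_bigr => i _; case: ifP => iS.
  by rewrite big_mkcond; apply: eq_bigr => j _; rewrite andbC.
by rewrite big1 // => j _; rewrite andbF.
Qed.

Lemma ccoef_cocycle S T U :
  ccoef S T * ccoef (symdiff S T) U = ccoef S (symdiff T U) * ccoef T U.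
Proof.
rewrite !ccoefE mulrACA [RHS]mulrACA; congr (_ * _); rewrite -!big_split /=.
  apply: eq_bigr => i _; rewrite -!big_split /=; apply: eq_bigr => j _.
  rewrite !in_symdiff; case: (j < i)%N; rewrite /= ?mulr1 //.
  case: (i \in S) (i \in T) (j \in T) (j \in U) => [] [] [] [] /=.
  all: rewrite ?mulrNN ?mulr1 ?mul1r //.
apply: eq_bigr => i _; rewrite !in_symdiff; case: (i \in S) (i \in T) (i \in U) => [] [] [] /=.
all: by rewrite ?mulr1 ?mul1r.
Qed.

Lemma symdiffA : associative symdiff.
Proof. by move=> S T U; apply/setP => i; rewrite !in_symdiff addbA. Qed.

Lemma cmulA : associative cmul.
Proof.
move=> x y z.
apply: (cliff_ext (f := fun x => cmul x (cmul y z))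
  (h := fun x => cmul (cmul x y) z)) x => [||S].
- exact: cmul_linearl.
- by move=> a x y'; rewrite !cmul_linearl.
apply: (cliff_ext (f := fun y => cmul (cbas S) (cmul y z))
  (h := fun y => cmul (cmul (cbas S) y) z)) y => [||T].
- by move=> a x y; rewrite cmul_linearl cmul_linearr.
- by move=> a x y; rewrite cmul_linearr cmul_linearl.
apply: (cliff_ext (f := fun z => cmul (cbas S) (cmul (cbas T) z))
  (h := fun z => cmul (cmul (cbas S) (cbas T)) z)) z => [||U].
- by move=> a x y; rewrite !cmul_linearr.
- exact: cmul_linearr.
have lZ a x y : cmul x (a *: y) = a *: cmul x y.
  exact: bilinZr (conj cmul_linearr cmul_linearl).
have rZ a x y : cmul (a *: x) y = a *: cmul x y.
  exact: bilinZl (conj cmul_linearr cmul_linearl).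
by rewrite !cmulE lZ rZ !cmulE !scalerA symdiffA ccoef_cocycle mulrC.
Qed.

Lemma symdiff0l S : symdiff set0 S = S.
Proof. by apply/setP => i; rewrite in_symdiff inE. Qed.

Lemma symdiff0r S : symdiff S set0 = S.
Proof. by apply/setP => i; rewrite in_symdiff inE addbF. Qed.

Lemma cmul1l : left_id (cbas set0) cmul.
Proof.
move=> x; apply: (cliff_ext (f := cmul (cbas set0)) (h := id)) x => [||S] //.
  exact: cmul_linearr.
by rewrite cmulE symdiff0l /ccoef set0I !big_set0 mulr1 scale1r.
Qed.

Lemma cmul1r : right_id (cbas set0) cmul.
Proof.
move=> x; apply: (cliff_ext (f := cmul^~ (cbas set0)) (h := id)) x => [||S] //.
  exact: cmul_linearl.
rewrite cmulE symdiff0r /ccoef setI0 big_set0 mulr1.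
by rewrite big1 ?scale1r // => i _; rewrite big_pred0 // => j; rewrite inE.
Qed.

Lemma cmulDl : left_distributive cmul +%R.
Proof. by move=> x y z; have := cmul_linearl z 1 x y; rewrite !scale1r. Qed.

Lemma cmulDr : right_distributive cmul +%R.
Proof. by move=> z x y; have := cmul_linearr z 1 x y; rewrite !scale1r. Qed.

Lemma cone_neq0 : cbas set0 != 0.
Proof.
by apply/eqP => /ffunP/(_ set0)/eqP; rewrite !ffunE eqxx oner_eq0.
Qed.

HB.instance Definition _ := GRing.Zmodule_isNzRing.Build cliff
  cmulA cmul1l cmul1r cmulDl cmulDr cone_neq0.

HB.instance Definition _ := GRing.Lmodule_isLalgebra.Build K cliff
  (fun a x y => esym (bilinZl a x y (conj cmul_linearr cmul_linearl))).

HB.instance Definition _ := GRing.Lalgebra_isAlgebra.Build K cliff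
  (fun a x y => esym (bilinZr a x y (conj cmul_linearr cmul_linearl))).

HB.instance Definition _ := Algebra_isFalgebra.Build K cliff.

Definition cgen (i : 'I_n) : cliff := cbas [set i].

Lemma cbasM S T : cbas S * cbas T = ccoef S T *: cbas (symdiff S T).
Proof. exact: cmulE. Qed.

Lemma ccoef1 i T : ccoef [set i] T =
  (\prod_(j in T | (j < i)%N) -1) * (if i \in T then q i else 1).
Proof.
rewrite /ccoef big_set1; congr (_ * _); rewrite big_mkcond (bigD1 i) //= !inE eqxx /=.
by rewrite big1 ?mulr1 // => j /negPf ji; rewrite !inE ji.
Qed.

Lemma cgenE i : cgen i * cgen i = (q i)%:A.
Proof.
rewrite cbasM ccoef1 inE eqxx big_pred0 ?mul1r => [|j]; last first.
  by rewrite inE; case: eqP => // ->; rewrite ltnn.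
by congr (_ *: cbas _); apply/setP => j; rewrite in_symdiff addbb inE.
Qed.

Lemma cgenN i j : i != j -> cgen i * cgen j = - (cgen j * cgen i).
Proof.
move=> ij; rewrite !cbasM !ccoef1 !inE [j == i]eq_sym (negPf ij) !mulr1 -scaleNr.
congr (_ *: cbas _); last by apply/setP => l; rewrite !in_symdiff addbC.
have e (a b : 'I_n) : \prod_(l in [set a] | (l < b)%N) (-1 : K) = (-1) ^+ (a < b)%N.
  rewrite big_mkcondr big_set1; case: (a < b)%N => //.
have : (i : nat) != j by [].
by rewrite !e; case: ltngtP => //= _ _; rewrite ?opprK.
Qed.

Lemma ord_sorted : sorted (fun i j : 'I_n => (i < j)%N) (index_enum 'I_n).
Proof.
have : sorted ltn (map val (index_enum 'I_n)).
  by rewrite [index_enum _]unlock -enumT val_enum_ord iota_ltn_sorted.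
by rewrite sorted_map.
Qed.

Lemma ord_split (i : 'I_n) : exists r1 r2, [/\ index_enum 'I_n = r1 ++ i :: r2,
  forall j, j \in r1 -> (j < i)%N & forall j, j \in r2 -> (i < j)%N].
Proof.
have tr : transitive (fun i j : 'I_n => (i < j)%N).
  by move=> a b c; apply: ltn_trans.
move: ord_sorted; case/splitPr: (mem_index_enum i) => r1 r2.
rewrite (sorted_pairwise tr) pairwise_cat pairwise_cons => /and4P[/allrelP h _ h2 _].
exists r1, r2; split=> // j jr.
  by apply: h => //; apply: mem_head.
exact: (allP h2).
Qed.

Section Lift.
Variables (A : falgType K) (E : 'I_n -> A).
Hypothesis Esq : forall i, E i * E i = (q i)%:A.
Hypothesis Eanti : forall i j, i != j -> E i * E j = - (E j * E i).

Definition ebas (S : {set 'I_n}) : A := \prod_(i in S) E i.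

Lemma Epass i (T : {set 'I_n}) (r : seq 'I_n) : i \notin r ->
  E i * \prod_(j <- r | j \in T) E j =
  (\prod_(j <- r | j \in T) (-1 : K)) *: (\prod_(j <- r | j \in T) E j * E i).
Proof.
elim: r => [|j r IH]; first by rewrite !big_nil mulr1 mul1r scale1r.
rewrite inE negb_or => /andP[ij ir]; rewrite !big_cons; case: ifP => _; last exact: IH.
rewrite mulrA Eanti // mulNr -[E j * E i * _]mulrA IH // mulN1r scaleNr.
by rewrite -scalerAr mulrA.
Qed.

Lemma Emul i T : E i * ebas T = ccoef [set i] T *: ebas (symdiff [set i] T).
Proof.
have [r1 [r2 [er l1 l2]]] := ord_split i.
have nr1 : i \notin r1 by apply/negP=> /l1; rewrite ltnn.
have sg : \prod_(j in T | (j < i)%N) (-1 : K) = \prod_(j <- r1 | j \in T) -1.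
  rewrite er big_cat /= big_cons ltnn andbF.
  rewrite [X in _ * X = _](_ : _ = 1) ?mulr1.
    by apply: eq_bigl_seq => j jr; rewrite l1 ?andbT.
  rewrite big_seq_cond big_pred0 // => j; apply/negbTE/negP => /and3P[jr _ ji].
  by have := ltn_trans ji (l2 _ jr); rewrite ltnn.
rewrite ccoef1 sg /ebas er !big_cat /= !big_cons !in_symdiff inE eqxx /=.
rewrite mulrA Epass // -scalerAl -mulrA.
have -> : \prod_(j <- r1 | j \in symdiff [set i] T) E j = \prod_(j <- r1 | j \in T) E j.
  apply: eq_bigl_seq => j jr; rewrite in_symdiff inE.
  by case: eqP => // ji; rewrite ji (negPf nr1) in jr.
have -> : \prod_(j <- r2 | j \in symdiff [set i] T) E j = \prod_(j <- r2 | j \in T) E j.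
  apply: eq_bigl_seq => j jr; rewrite in_symdiff inE.
  by case: eqP => // ji; have := l2 _ jr; rewrite ji ltnn.
case: (i \in T); rewrite ?mulr1 -?scalerA //; congr (_ *: _).
by rewrite [E i * (E i * _)]mulrA Esq -scalerAl mul1r -scalerAr.
Qed.

Definition clift_def (f : cliff) : A := \sum_S (f S : K) *: ebas S.

Lemma clift_linear : linear clift_def.
Proof.
move=> a x y; rewrite /clift_def scaler_sumr -big_split; apply: eq_bigr => S _ /=.
by rewrite !ffunE scalerDl -scalerA.
Qed.

HB.instance Definition _ := GRing.isSemilinear.Build K cliff A _ clift_def
  (GRing.semilinear_linear clift_linear).

Definition clift : 'Hom(cliff, A) := linfun clift_def.

Lemma cliftE S : clift (cbas S) = ebas S.
Proof.
rewrite lfunE /= /clift_def (bigD1 S) //= ffunE eqxx scale1r big1 ?addr0 //.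
by move=> T /negPf TS; rewrite ffunE TS scale0r.
Qed.

Lemma clift1 : clift 1 = 1.
Proof. by rewrite cliftE /ebas big_set0. Qed.

Lemma clift_gen i : clift (cgen i) = E i.
Proof. by rewrite cliftE /ebas big_set1. Qed.

Lemma clift_genM i x : clift (cgen i * x) = E i * clift x.
Proof.
apply: (cliff_ext (f := fun x => clift (cgen i * x))
  (h := fun x => E i * clift x)) x => [||T].
- by move=> a x y; rewrite mulrDr -scalerAr linearP.
- by move=> a x y; rewrite linearP mulrDr -scalerAr.
by rewrite cbasM linearZ /= !cliftE Emul.
Qed.

Lemma clift_prodM (r : seq 'I_n) (S : {set 'I_n}) x :
  clift ((\prod_(i <- r | i \in S) cgen i) * x) =
  (\prod_(i <- r | i \in S) E i) * clift x.
Proof.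
elim: r => [|i r IH]; first by rewrite !big_nil !mul1r.
by rewrite !big_cons; case: ifP => // _; rewrite -!mulrA clift_genM IH.
Qed.

End Lift.

Lemma cbas_prod S : cbas S = \prod_(i in S) cgen i.
Proof.
suff h (r : seq 'I_n) : sorted (fun i j : 'I_n => (i < j)%N) r ->
    \prod_(i <- r | i \in S) cgen i = cbas (S :&: [set i in r]).
  rewrite h ?ord_sorted //; congr cbas; apply/setP => i.
  by rewrite !inE mem_index_enum andbT.
have tr : transitive (fun i j : 'I_n => (i < j)%N).
  by move=> a b c; apply: ltn_trans.
elim: r => [|i r IH] sr.
  by rewrite big_nil (_ : _ :&: _ = set0) //; apply/setP => j; rewrite !inE andbF.
move: (sr); rewrite (sorted_pairwise tr) pairwise_cons => /andP[/allP ir _].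
have nir : i \notin r by apply/negP => /ir; rewrite ltnn.
rewrite big_cons (IH (path_sorted sr)); case: ifP => iS; last first.
  congr cbas; apply/setP => j; rewrite !inE; case: eqP => // ->.
  by rewrite iS.
rewrite cbasM ccoef1 !inE iS (negPf nir) mulr1 big_pred0 ?scale1r => [|j].
  congr cbas; apply/setP => j; rewrite in_symdiff !inE.
  by case: eqP => [->|]; rewrite ?iS ?(negPf nir) //= addFb.
apply/negbTE; rewrite !inE; apply/negP => /andP[/andP[_ /ir ij] ji].
by have := ltn_trans ij ji; rewrite ltnn.
Qed.

Lemma cliftM (A : falgType K) (E : 'I_n -> A)
    (Esq : forall i, E i * E i = (q i)%:A)
    (Eanti : forall i j, i != j -> E i * E j = - (E j * E i)) x y :
  clift E (x * y) = clift E x * clift E y.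
Proof.
apply: (cliff_ext (f := fun x => clift E (x * y))
  (h := fun x => clift E x * clift E y)) x => [||S].
- by move=> a x z; rewrite mulrDl -scalerAl linearP.
- by move=> a x z; rewrite linearP mulrDl -scalerAl.
by rewrite {1}cbas_prod clift_prodM // cliftE.
Qed.

Lemma cliff_ind (P : cliff -> Prop) :
  (forall a x y, P x -> P y -> P (a *: x + y)) -> P 1 ->
  (forall x y, P x -> P y -> P (x * y)) -> (forall i, P (cgen i)) ->
  forall x, P x.
Proof.
move=> PD P1 PM Pg x; rewrite [x]cliff_sum.
have P0 : P 0 by rewrite -(addNr 1) -scaleN1r; apply: PD.
elim/big_rec: _ => // S y _ Py; apply: PD => //.
by rewrite cbas_prod; elim/big_rec: _ => // i z _ Pz; apply: PM.
Qed.

End CliffordAlgebra.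

(* The opposite algebra: the antipode is a morphism to it. *)
Section Opposite.
Variables (K : fieldType) (A : falgType K).

Definition opalg : Type := A.
HB.instance Definition _ := Vector.copy opalg A.

Definition opmul (x y : opalg) : opalg := (y : A) * (x : A).
Let omulA : associative opmul. Proof. by move=> x y z; rewrite /opmul mulrA. Qed.
Let omul1l : left_id (1 : A) opmul. Proof. by move=> x; rewrite /opmul mulr1. Qed.
Let omul1r : right_id (1 : A) opmul. Proof. by move=> x; rewrite /opmul mul1r. Qed.
Let omulDl : left_distributive opmul +%R.
Proof. by move=> x y z; rewrite /opmul mulrDr. Qed.
Let omulDr : right_distributive opmul +%R.
Proof. by move=> x y z; rewrite /opmul mulrDl. Qed.
Let one_neq0 : (1 : A) != 0 :> opalg. Proof. exact: oner_neq0. Qed.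

HB.instance Definition _ := GRing.Zmodule_isNzRing.Build opalg
  omulA omul1l omul1r omulDl omulDr one_neq0.

Let oscaleAl a (x y : opalg) : a *: opmul x y = opmul (a *: x) y.
Proof. exact: (scalerAr a (y : A) (x : A)). Qed.
HB.instance Definition _ := GRing.Lmodule_isLalgebra.Build K opalg oscaleAl.

Let oscaleAr a (x y : opalg) : a *: opmul x y = opmul x (a *: y).
Proof. exact: (scalerAl a (y : A) (x : A)). Qed.
HB.instance Definition _ := GRing.Lalgebra_isAlgebra.Build K opalg oscaleAr.
HB.instance Definition _ := Algebra_isFalgebra.Build K opalg.

Lemma opM (x y : opalg) : x * y = opmul x y. Proof. by []. Qed.

End Opposite.

Section TensorMorphisms.
Variable K : fieldType.

Lemma tens_ind (V W : vectType K) (P : tens V W -> Prop) :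
  (forall a x y, P x -> P y -> P (a *: x + y)) -> (forall v w, P (pure v w)) ->
  forall t, P t.
Proof.
move=> PD Pp t; have P0 : P 0 by rewrite -(addNr (pure 0 0)) -scaleN1r; apply: PD.
have PA x y : P x -> P y -> P (x + y) by rewrite -{2}[x]scale1r; apply: PD.
rewrite [t]tens_sum; apply: (big_ind P) => // i _; apply: (big_ind P) => // j _.
by rewrite -[X in P X]addr0; apply: PD.
Qed.

Lemma tmapM (A A' B B' : falgType K) (f : 'Hom(A, A')) (h : 'Hom(B, B')) :
  {morph f : x y / x * y} -> {morph h : x y / x * y} ->
  {morph tmap f h : x y / x * y}.
Proof.
move=> fM hM s t; elim/tens_ind: s => [a x y|a b].
  by rewrite mulrDl -scalerAl !linearP /= mulrDl -scalerAl => -> ->.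
elim/tens_ind: t => [c x y|c d].
  by rewrite mulrDr -scalerAr !linearP /= mulrDr -scalerAr => -> ->.
by rewrite pureM !tmapE pureM fM hM.
Qed.

Lemma tassocM (A B C : falgType K) : {morph tassoc A B C : x y / x * y}.
Proof.
move=> s t; elim/tens_ind: s => [a x y|ab c].
  by rewrite mulrDl -scalerAl !linearP /= mulrDl -scalerAl => -> ->.
elim/tens_ind: ab => [r x y|a b].
  by rewrite pureDl pureZl mulrDl -scalerAl !linearP /= mulrDl -scalerAl => -> ->.
elim/tens_ind: t => [r x y|ab' c'].
  by rewrite mulrDr -scalerAr !linearP /= mulrDr -scalerAr => -> ->.
elim/tens_ind: ab' => [r x y|a' b'].
  by rewrite pureDl pureZl mulrDr -scalerAr !linearP /= mulrDr -scalerAr => -> ->.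
by rewrite pureM pureM !tassocE pureM pureM.
Qed.

Lemma tlunitM (A : falgType K) : {morph tlunit A : x y / x * y}.
Proof.
move=> s t; elim/tens_ind: s => [a x y|a b].
  by rewrite mulrDl -scalerAl !linearP /= mulrDl -scalerAl => -> ->.
elim/tens_ind: t => [c x y|c d].
  by rewrite mulrDr -scalerAr !linearP /= mulrDr -scalerAr => -> ->.
by rewrite (pureM (A := K^o)) !tlunitE -scalerAl -scalerAr scalerA.
Qed.

Lemma trunitM (A : falgType K) : {morph trunit A : x y / x * y}.
Proof.
move=> s t; elim/tens_ind: s => [a x y|a b].
  by rewrite mulrDl -scalerAl !linearP /= mulrDl -scalerAl => -> ->.
elim/tens_ind: t => [c x y|c d].
  by rewrite mulrDr -scalerAr !linearP /= mulrDr -scalerAr => -> ->.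
by rewrite (pureM (B := K^o)) !trunitE -scalerAl -scalerAr scalerA.
Qed.

Lemma pureNl (V W : vectType K) (v : V) (w : W) : pure (- v) w = - pure v w.
Proof. by rewrite -!scaleN1r pureZl. Qed.
Lemma pureNr (V W : vectType K) (v : V) (w : W) : pure v (- w) = - pure v w.
Proof. by rewrite -!scaleN1r pureZr. Qed.
Lemma pure0l (V W : vectType K) (w : W) : pure (0 : V) w = 0.
Proof. by rewrite -[0](scale0r (0 : V)) pureZl scale0r. Qed.
Lemma pure0r (V W : vectType K) (v : V) : pure v (0 : W) = 0.
Proof. by rewrite -[0](scale0r (0 : W)) pureZr scale0r. Qed.

End TensorMorphisms.

Section Bk.
Variables (K : fieldType) (k : nat).

(* Λ K^k ⋊ K[Z_2]: since g anticommutes with the x_i, it is the Clifford algebra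
   on g (index 0) and x_1, ..., x_k, with g^2 = 1 and x_i^2 = 0.  Bk_ind says
   that g and the x_i generate it, and Bk_lift that it is presented by the
   relations Bk_gg, Bk_gx, Bk_xx and Bk_xxN. *)
Definition Bk : falgType K := clifford (fun i : 'I_k.+1 => (i == ord0)%:R : K).

Definition Bk_g : Bk := cgen _ ord0.
Definition Bk_x (i : 'I_k) : Bk := cgen _ (lift ord0 i).

Lemma Bk_gg : Bk_g * Bk_g = 1.
Proof. by rewrite /Bk_g cgenE eqxx scale1r. Qed.

Lemma Bk_gx i : Bk_g * Bk_x i = - (Bk_x i * Bk_g).
Proof. exact: cgenN. Qed.

Lemma Bk_xx i : Bk_x i * Bk_x i = 0.
Proof. by rewrite /Bk_x cgenE scale0r. Qed.

Lemma Bk_xxN i j : Bk_x i * Bk_x j = - (Bk_x j * Bk_x i).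
Proof.
have [->|ij] := eqVneq i j; first by rewrite Bk_xx oppr0.
by apply: cgenN; rewrite (inj_eq lift_inj).
Qed.

Lemma dim_Bk : dim Bk = (2 ^ k.+1)%N.
Proof.
rewrite -[LHS]/(#|{set 'I_k.+1}| * 1)%N muln1 -cardsT -powersetT card_powerset.
by rewrite cardsT card_ord.
Qed.

Lemma Bk_ind (P : Bk -> Prop) :
  (forall a x y, P x -> P y -> P (a *: x + y)) -> P 1 ->
  (forall x y, P x -> P y -> P (x * y)) -> P Bk_g -> (forall i, P (Bk_x i)) ->
  forall x, P x.
Proof.
move=> PD P1 PM Pg Px; apply: cliff_ind => // i.
by case: (unliftP ord0 i) => [j ->|->]; [exact: Px|exact: Pg].
Qed.

Section Lift.
Variables (A : falgType K) (G : A) (X : 'I_k -> A).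

Definition Bk_lift : 'Hom(Bk, A) :=
  clift _ (fun i : 'I_k.+1 => oapp X G (unlift ord0 i)).

Hypothesis GG : G * G = 1.
Hypothesis GX : forall i, G * X i = - (X i * G).
Hypothesis XX : forall i, X i * X i = 0.
Hypothesis XXN : forall i j, X i * X j = - (X j * X i).

Let E (i : 'I_k.+1) := oapp X G (unlift ord0 i).

Let Esq i : E i * E i = ((i == ord0)%:R : K)%:A.
Proof.
rewrite /E; case: unliftP => [j ->|->] /=; first by rewrite XX scale0r.
by rewrite GG scale1r.
Qed.

Let Eanti i j : i != j -> E i * E j = - (E j * E i).
Proof.
rewrite /E; case: unliftP => [a ->|->]; case: unliftP => [b ->|->] //= ne.
by rewrite GX opprK.
Qed.

Lemma Bk_lift1 : Bk_lift 1 = 1. Proof. exact: clift1. Qed.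

Lemma Bk_liftM x y : Bk_lift (x * y) = Bk_lift x * Bk_lift y.
Proof. exact: cliftM. Qed.

Lemma Bk_lift_g : Bk_lift Bk_g = G.
Proof. by rewrite /Bk_lift clift_gen unlift_none. Qed.

Lemma Bk_lift_x i : Bk_lift (Bk_x i) = X i.
Proof. by rewrite /Bk_lift clift_gen liftK. Qed.

End Lift.

Lemma Bk_hom_ext (A : falgType K) (f h : 'Hom(Bk, A)) :
  f 1 = h 1 -> {morph f : x y / x * y} -> {morph h : x y / x * y} ->
  f Bk_g = h Bk_g -> (forall i, f (Bk_x i) = h (Bk_x i)) -> f = h.
Proof.
move=> f1 fM hM fg fx; apply/lfunP; apply: Bk_ind => //.
  by move=> a x y ex ey; rewrite !linearP /= ex ey.
by move=> x y ex ey; rewrite fM hM ex ey.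
Qed.

Let cG : tens Bk Bk := pure Bk_g Bk_g.
Let cX (i : 'I_k) : tens Bk Bk := pure 1 (Bk_x i) + pure (Bk_x i) Bk_g.

Lemma Bk_comul_rel :
  [/\ cG * cG = 1, forall i, cG * cX i = - (cX i * cG),
      forall i, cX i * cX i = 0 & forall i j, cX i * cX j = - (cX j * cX i)].
Proof.
have N i j : cX i * cX j = - (cX j * cX i).
  rewrite /cX !mulrDl !mulrDr !pureM !(mul1r, mulr1) !Bk_gg.
  rewrite (Bk_xxN i j) !Bk_gx !(pureNl, pureNr) !opprD !opprK.
  exact: addrACA.
split=> // [|i|i].
- by rewrite pureM Bk_gg.
- rewrite /cG /cX mulrDl !mulrDr !pureM !(mul1r, mulr1) !Bk_gx.
  by rewrite pureNl pureNr opprD.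
rewrite /cX mulrDl !mulrDr !pureM !(mul1r, mulr1) Bk_xx Bk_gx.
by rewrite pure0l pure0r pureNr add0r addr0 subrr.
Qed.

Definition Bk_comul : 'Hom(Bk, tens Bk Bk) :=
  Bk_lift (pure Bk_g Bk_g) (fun i => pure 1 (Bk_x i) + pure (Bk_x i) Bk_g).

Definition Bk_counit : 'Hom(Bk, K^o) := Bk_lift (A := K^o) 1 (fun=> 0).

Definition Bk_antipode : 'End(Bk) :=
  Bk_lift (A := opalg Bk) Bk_g (fun i => Bk_g * Bk_x i).

Lemma Bk_comulM : {morph Bk_comul : x y / x * y}.
Proof. by case: Bk_comul_rel => *; apply: Bk_liftM. Qed.

Lemma Bk_comul1 : Bk_comul 1 = 1.
Proof. exact: Bk_lift1. Qed.

Lemma Bk_comul_g : Bk_comul Bk_g = pure Bk_g Bk_g.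
Proof. exact: Bk_lift_g. Qed.

Lemma Bk_comul_x i : Bk_comul (Bk_x i) = pure 1 (Bk_x i) + pure (Bk_x i) Bk_g.
Proof. exact: Bk_lift_x. Qed.

Lemma Bk_counitM : {morph Bk_counit : x y / x * y}.
Proof.
by apply: Bk_liftM => *; rewrite ?(mulr1, mulr0, mul0r, mul1r, oppr0).
Qed.

Lemma Bk_counit1 : Bk_counit 1 = 1.
Proof. exact: (Bk_lift1 (A := K^o)). Qed.

Lemma Bk_counit_g : Bk_counit Bk_g = 1.
Proof. exact: (Bk_lift_g (A := K^o)). Qed.

Lemma Bk_counit_x i : Bk_counit (Bk_x i) = 0.
Proof. exact: (Bk_lift_x (A := K^o)). Qed.

Lemma Bk_antipodeM x y : Bk_antipode (x * y) = Bk_antipode y * Bk_antipode x.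
Proof.
apply: (Bk_liftM (A := opalg Bk)) => [|i|i|i j]; rewrite !opM /opmul.
- exact: Bk_gg.
- by rewrite mulrA Bk_gg mul1r Bk_gx mulNr -mulrA Bk_gg mulr1.
- by rewrite {1}Bk_gx mulNr mulrA -(mulrA (Bk_x i)) Bk_gg mulr1 Bk_xx oppr0.
- rewrite {1}Bk_gx [in RHS]Bk_gx !mulNr !mulrA -(mulrA (Bk_x j)) -(mulrA (Bk_x i)).
  by rewrite Bk_gg !mulr1 Bk_xxN.
Qed.

Lemma Bk_antipode1 : Bk_antipode 1 = 1.
Proof. exact: (Bk_lift1 (A := opalg Bk)). Qed.

Lemma Bk_antipode_g : Bk_antipode Bk_g = Bk_g.
Proof. exact: (Bk_lift_g (A := opalg Bk)). Qed.

Lemma Bk_antipode_x i : Bk_antipode (Bk_x i) = Bk_g * Bk_x i.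
Proof. exact: (Bk_lift_x (A := opalg Bk)). Qed.

Lemma Bk_comulA :
  (tassoc _ _ _ \o tmap Bk_comul \1 \o Bk_comul =
   tmap \1 Bk_comul \o Bk_comul)%VF.
Proof.
have idM : {morph (\1%VF : 'End(Bk)) : x y / x * y} by move=> x y; rewrite !id_lfunE.
apply: Bk_hom_ext => [|x y|x y||i].
- rewrite !comp_lfunE Bk_comul1 -pure1 !tmapE !id_lfunE Bk_comul1 -pure1.
  by rewrite tassocE.
- rewrite !comp_lfunE Bk_comulM (tmapM Bk_comulM idM) tassocM //.
- by rewrite !comp_lfunE Bk_comulM (tmapM idM Bk_comulM).
- by rewrite !comp_lfunE Bk_comul_g !tmapE !id_lfunE Bk_comul_g tassocE.
rewrite !comp_lfunE Bk_comul_x !linearD /= !tmapE !id_lfunE.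
rewrite Bk_comul_g Bk_comul_x Bk_comul1 -!pure1 pureDl pureDr linearD /= !tassocE.
by rewrite addrA.
Qed.

Lemma Bk_counitl : (tlunit _ \o tmap Bk_counit \1 \o Bk_comul = \1)%VF.
Proof.
have idM : {morph (\1%VF : 'End(Bk)) : x y / x * y} by move=> x y; rewrite !id_lfunE.
apply: Bk_hom_ext => [|x y|x y||i] //.
- rewrite !comp_lfunE Bk_comul1 -pure1 !tmapE Bk_counit1 tlunitE !id_lfunE.
  by rewrite scale1r.
- by rewrite !comp_lfunE Bk_comulM (tmapM Bk_counitM idM) tlunitM.
- by rewrite !comp_lfunE Bk_comul_g !tmapE Bk_counit_g tlunitE !id_lfunE scale1r.
rewrite !comp_lfunE Bk_comul_x linearD /= !tmapE linearD /= !tlunitE !id_lfunE.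
by rewrite Bk_counit1 Bk_counit_x scale1r scale0r addr0.
Qed.

Lemma Bk_counitr : (trunit _ \o tmap \1 Bk_counit \o Bk_comul = \1)%VF.
Proof.
have idM : {morph (\1%VF : 'End(Bk)) : x y / x * y} by move=> x y; rewrite !id_lfunE.
apply: Bk_hom_ext => [|x y|x y||i] //.
- rewrite !comp_lfunE Bk_comul1 -pure1 !tmapE Bk_counit1 trunitE !id_lfunE.
  by rewrite scale1r.
- by rewrite !comp_lfunE Bk_comulM (tmapM idM Bk_counitM) trunitM.
- by rewrite !comp_lfunE Bk_comul_g !tmapE Bk_counit_g trunitE !id_lfunE scale1r.
rewrite !comp_lfunE Bk_comul_x linearD /= !tmapE linearD /= !trunitE !id_lfunE.
by rewrite Bk_counit_g Bk_counit_x scale1r scale0r add0r.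
Qed.

Let Sl := tlift (fun b c => Bk_antipode b * c).
Let Sr := tlift (fun b c => b * Bk_antipode c).

Let SlE b c : Sl (pure b c) = Bk_antipode b * c.
Proof.
rewrite tliftE //; split=> [v a x y|w a x y].
  by rewrite mulrDr -scalerAr.
by rewrite linearP mulrDl -scalerAl.
Qed.

Let SrE b c : Sr (pure b c) = b * Bk_antipode c.
Proof.
rewrite tliftE //; split=> [v a x y|w a x y].
  by rewrite linearP mulrDr -scalerAr.
by rewrite mulrDl -scalerAl.
Qed.

Lemma Bk_antipodel a : Sl (Bk_comul a) = Bk_counit a *: 1.
Proof.
elim/Bk_ind: a => [a x y ex ey||x y ex ey||i].
- by rewrite !linearP /= ex ey scalerDl scalerA.
- by rewrite Bk_comul1 -pure1 SlE Bk_antipode1 Bk_counit1 scale1r mulr1.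
- rewrite Bk_comulM Bk_counitM -scalerA -ey.
  elim/tens_ind: (Bk_comul y) => [a u v eu ev|b c].
    by rewrite mulrDr -scalerAr !linearP /= eu ev.
  rewrite SlE; transitivity (Bk_antipode b * Sl (Bk_comul x) * c); last first.
    by rewrite ex -scalerAr mulr1 -scalerAl.
  elim/tens_ind: (Bk_comul x) => [a u v eu ev|d e].
    by rewrite mulrDl -scalerAl !linearP /= eu ev mulrDr mulrDl -scalerAr -scalerAl.
  by rewrite pureM !SlE Bk_antipodeM !mulrA.
- by rewrite Bk_comul_g SlE Bk_antipode_g Bk_gg Bk_counit_g scale1r.
rewrite Bk_comul_x linearD /= !SlE Bk_antipode1 Bk_antipode_x mul1r Bk_counit_x.
by rewrite Bk_gx mulNr -mulrA Bk_gg mulr1 subrr scale0r.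
Qed.

Lemma Bk_antipoder a : Sr (Bk_comul a) = Bk_counit a *: 1.
Proof.
elim/Bk_ind: a => [a x y ex ey||x y ex ey||i].
- by rewrite !linearP /= ex ey scalerDl scalerA.
- by rewrite Bk_comul1 -pure1 SrE Bk_antipode1 Bk_counit1 scale1r mulr1.
- rewrite Bk_comulM Bk_counitM mulrC -scalerA -ex.
  elim/tens_ind: (Bk_comul x) => [a u v eu ev|b c].
    by rewrite mulrDl -scalerAl !linearP /= eu ev.
  rewrite SrE; transitivity (b * Sr (Bk_comul y) * Bk_antipode c); last first.
    by rewrite ey -scalerAr mulr1 -scalerAl.
  elim/tens_ind: (Bk_comul y) => [a u v eu ev|d e].
    by rewrite mulrDr -scalerAr !linearP /= eu ev mulrDr mulrDl -scalerAr -scalerAl.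
  by rewrite pureM !SrE Bk_antipodeM !mulrA.
- by rewrite Bk_comul_g SrE Bk_antipode_g Bk_gg Bk_counit_g scale1r.
rewrite Bk_comul_x linearD /= !SrE Bk_antipode_g Bk_antipode_x mul1r Bk_counit_x.
by rewrite Bk_gx addNr scale0r.
Qed.

Definition Bk_hopf : hopfAlgebra K :=
  @HopfAlgebra K Bk Bk_comul Bk_counit Bk_antipode Bk_comul1 Bk_comulM
    Bk_counit1 Bk_counitM Bk_comulA Bk_counitl Bk_counitr
    Bk_antipodel Bk_antipoder.

End Bk.

(* Main.v *)
(** A natural endomorphism of an n-fold tensor product is determined by its
    value at 1 ⊗ ... ⊗ 1 on n copies of the regular module.  This identifies the
    complex of the forgetful functor with the cobar complex of tensor powers of
    B_k, and the complex of the identity functor with the subcomplex of tensors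
    commuting with the iterated coproducts.

    The coalgebra B_k behaves like a category with two objects, the letters 1
    and g: the basis vector g^e x_I goes from the letter e to the letter e + |I|
    (mod 2).  Composable tensors that start and end at the letter 1 commute with
    the coproducts automatically, and applying the counit just before the first
    place where a tensor fails to be composable is a homotopy contracting both
    complexes onto the composable tensors.  Hence the two cohomologies agree.

    Cobar cohomology is computed by a double complex: functions from monomials
    of degree m in k variables to B ⊗ B^{⊗n}, with the cobar differential
    (contracted by the counit) and a Koszul differential (contracted by Euler's
    formula, in characteristic 0).  A zigzag moves H^n to the column of constant
    coefficients, which is S^n(C^k).  Differentiating along x_i changes the left
    letter, so a class of degree m must have left letter m mod 2, whereas
    constants have left letter 0: odd degrees vanish. *)

From HB Require Import structures.
Require Import Defs.
From mathcomp Require Import all_boot all_order all_algebra.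
From mathcomp Require Import reals complex.
From mathcomp Require Import boolp functions falgebra.

Set Implicit Arguments.
Unset Strict Implicit.
Unset Printing Implicit Defensive.
Import GRing.Theory.

(** * Cochains as elements of tensor powers of the regular module *)

(** Both functors are treated at once: a [fiber] is a faithful linear monoidal passage from the
    target category to vector spaces, so in either case a cochain becomes a tensor, and only the
    predicate of admissible tensors differs. The letters are eigenspaces of two commuting
    involutions of B_k. Left and right multiplication by g, or by x_i, move the letters in the same
    way; hence the homotopy [cut] is compatible with both sides and preserves centrality. In the
    double complex the left letter is tied to the parity of the degree m for a reason: every skew
    derivation [pd i] kills g as well as 1, and only prescribing the letter 1 in degree 0 leaves the
    scalars as their common kernel in B_k. The columns tolerate this restriction because projecting
    to a left letter is a map of right comodules. A zigzag is multivalued, so dimensions are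
    transported along linear relations instead of maps. *)

Section LinearMaps.
Local Open Scope ring_scope.
Variables (K : fieldType) (U V : vectType K) (f : 'Hom(U, V)).

Lemma lfunPE c x y : f (c *: x + y) = c *: f x + f y. Proof. exact: linearP. Qed.
Lemma lfun0E : f 0 = 0. Proof. exact: linear0. Qed.
Lemma lfunDE x y : f (x + y) = f x + f y. Proof. exact: linearD. Qed.
Lemma lfunNE x : f (- x) = - f x. Proof. exact: linearN. Qed.
Lemma lfunBE x y : f (x - y) = f x - f y. Proof. exact: linearB. Qed.
Lemma lfunZE c x : f (c *: x) = c *: f x. Proof. exact: linearZ_LR. Qed.
Lemma lfun_sumE (I : finType) (F : I -> U) :
  f (\sum_i F i) = \sum_i f (F i).
Proof. exact: linear_sum. Qed.
End LinearMaps.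

Section Fibers.
Local Open Scope ring_scope.
Variables (K : fieldType) (H : hopfAlgebra K).
Local Notation M := (Hmod H).

(** Bracketed like [tpow], with [K^o] in place of the final unit object, so that coherence morphisms
    translate one factor at a time. *)
Fixpoint tp n : obs M n -> vectType K :=
  match n return obs M n -> vectType K with
  | 0 => fun _ => K^o
  | m.+1 => fun X => tens (hmod_space X.1) (tp X.2)
  end.

Fixpoint tpm n : forall X Y : obs M n, homs X Y -> 'Hom(tp X, tp Y) :=
  match n return forall X Y : obs M n, homs X Y -> 'Hom(tp X, tp Y) with
  | 0 => fun _ _ _ => \1%VF
  | m.+1 => fun X Y u => tmap (hhom_fun u.1) (tpm u.2)
  end.

Fixpoint mrg n (i : nat) : forall X : obs M n.+2,
    'Hom(tp X, tp (Defs.merge i X)) :=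
  match n, i return forall X : obs M n.+2, 'Hom(tp X, tp (Defs.merge i X)) with
  | m.+1, j.+1 => fun X => tmap \1%VF (mrg j X.2)
  | m.+1, 0 => fun X => tassoc' _ _ (@tp m.+1 X.2.2)
  | 0, _ => fun X => tassoc' _ _ (@tp 0 X.2.2)
  end.

Fixpoint mrg' n (i : nat) : forall X : obs M n.+2,
    'Hom(tp (Defs.merge i X), tp X) :=
  match n, i return forall X : obs M n.+2, 'Hom(tp (Defs.merge i X), tp X) with
  | m.+1, j.+1 => fun X => tmap \1%VF (mrg' j X.2)
  | m.+1, 0 => fun X => tassoc _ _ (@tp m.+1 X.2.2)
  | 0, _ => fun X => tassoc _ _ (@tp 0 X.2.2)
  end.

Fixpoint snc n : forall X : obs M n.+1,
    'Hom(tens (tp (ofront X)) (hmod_space (olast X)), tp X) :=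
  match n return forall X : obs M n.+1,
    'Hom(tens (tp (ofront X)) (hmod_space (olast X)), tp X) with
  | 0 => fun X => (trunit' _ \o tlunit _)%VF
  | m.+1 => fun X => (tmap \1 (snc X.2) \o tassoc _ _ _)%VF
  end.

Fixpoint snc' n : forall X : obs M n.+1,
    'Hom(tp X, tens (tp (ofront X)) (hmod_space (olast X))) :=
  match n return forall X : obs M n.+1,
    'Hom(tp X, tens (tp (ofront X)) (hmod_space (olast X))) with
  | 0 => fun X => (tlunit' _ \o trunit _)%VF
  | m.+1 => fun X => (tassoc' _ _ _ \o tmap \1 (snc' X.2))%VF
  end.

Lemma mrgK n i (X : obs M n.+2) :
  (mrg' i X \o mrg i X = \1)%VF /\ (mrg i X \o mrg' i X = \1)%VF.
Proof.
have h (U V W : vectType K) := tassocK U V W.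
elim: n i X => [|n IH] [|i] X /=; try by split; [exact: (h _ _ _).2|exact: (h _ _ _).1].
by case: (IH i X.2) => h1 h2; split; rewrite -tmap_comp ?h1 ?h2 comp_lfun1l tmap_id.
Qed.

Lemma comp_lfun_inv (U V W : vectType K) (f : 'Hom(U, V)) (f' : 'Hom(V, U))
    (g : 'Hom(V, W)) (g' : 'Hom(W, V)) :
  (f' \o f = \1)%VF -> (g' \o g = \1)%VF ->
  ((f' \o g') \o (g \o f) = \1)%VF.
Proof. by move=> ff gg; rewrite -comp_lfunA (comp_lfunA g') gg comp_lfun1l. Qed.

Lemma sncK n (X : obs M n.+1) :
  (snc' X \o snc X = \1)%VF /\ (snc X \o snc' X = \1)%VF.
Proof.
elim: n X => [|n IH] X /=.
  have [a b] := tlunitK (hmod_space X.1); have [c d] := trunitK (hmod_space X.1).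
  by split; apply: comp_lfun_inv.
have [h1 h2] := IH X.2; have h := tassocK.
by split; apply: comp_lfun_inv; rewrite -?tmap_comp ?h1 ?h2 ?comp_lfun1l ?tmap_id;
  try exact: (h _ _ _ _).1; try exact: (h _ _ _ _).2.
Qed.

(* The underlying vector spaces of a target category, with enough structure to
   turn its morphisms into linear maps; both functors at hand have one. *)
Record fiber (D : monoidalCategory K) (F : tensorFunctor M D) := Fiber {
  fw : D -> vectType K;
  fh : forall X Y : D, Defs.hom X Y -> 'Hom(fw X, fw Y);
  fh_linear : forall X Y, linear (@fh X Y);
  fh_inj : forall X Y, injective (@fh X Y);
  fh1 : forall X, fh (idm X) = \1%VF;
  fh_comp : forall (X Y Z : D) (g : Defs.hom Y Z) (f : Defs.hom X Y),
    fh (Defs.comp g f) = (fh g \o fh f)%VF;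
  ft : forall X Y : D, 'Hom(tens (fw X) (fw Y), fw (ten X Y));
  ft' : forall X Y : D, 'Hom(fw (ten X Y), tens (fw X) (fw Y));
  ftK : forall X Y, (ft X Y \o ft' X Y = \1)%VF;
  ftK' : forall X Y, (ft' X Y \o ft X Y = \1)%VF;
  fh_ten : forall (X X' Y Y' : D) (f : Defs.hom X X') (g : Defs.hom Y Y'),
    (fh (tenm f g) \o ft X Y = ft X' Y' \o tmap (fh f) (fh g))%VF;
  fh_asc : forall X Y Z : D,
    (fh (asc X Y Z) \o (ft (ten X Y) Z \o tmap (ft X Y) \1) =
     (ft X (ten Y Z) \o tmap \1 (ft Y Z)) \o tassoc _ _ _)%VF;
  fu : 'Hom(K^o, fw (unit_ob D));
  fu' : 'Hom(fw (unit_ob D), K^o);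
  fuK : (fu \o fu' = \1)%VF;
  fuK' : (fu' \o fu = \1)%VF;
  fh_lun : forall X : D,
    (fh (lun X) \o (ft _ _ \o tmap fu \1) = tlunit (fw X))%VF;
  fh_run : forall X : D,
    (fh (run X) \o (ft _ _ \o tmap \1 fu) = trunit (fw X))%VF;
  fo : forall X : M, 'Hom(hmod_space X, fw (F X));
  fo' : forall X : M, 'Hom(fw (F X), hmod_space X);
  foK : forall X, (fo X \o fo' X = \1)%VF;
  foK' : forall X, (fo' X \o fo X = \1)%VF;
  fh_fmap : forall (X Y : M) (f : Defs.hom X Y),
    (fh (fmap F f) \o fo X = fo Y \o hhom_fun f)%VF;
  fh_f2 : forall X Y : M,
    (fh (f2 F X Y) \o (ft _ _ \o tmap (fo X) (fo Y)) = fo (ten X Y))%VF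
}.

Local Obligation Tactic :=
  try by move=> *; rewrite ?tmap_id ?comp_lfun1l ?comp_lfun1r.

Program Definition forget_fiber : fiber (forget H) :=
  @Fiber (Vec K) (forget H) id (fun _ _ => id) _ _ _ _
    (fun _ _ => \1%VF) (fun _ _ => \1%VF) _ _ _ _ \1%VF \1%VF _ _ _ _
    (fun _ => \1%VF) (fun _ => \1%VF) _ _ _ _.

Program Definition id_fiber : fiber (idFunctor M) :=
  @Fiber M (idFunctor M) (fun X => hmod_space X) (fun X Y f => hhom_fun f) _ _ _ _
    (fun _ _ => \1%VF) (fun _ _ => \1%VF) _ _ _ _ \1%VF \1%VF _ _ _ _
    (fun _ => \1%VF) (fun _ => \1%VF) _ _ _ _.
Next Obligation. by move=> X Y; apply: hhom_inj. Qed.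

(** Once the coproduct of [a] is expanded into pure tensors, this is naturality of the associator.
    [A1] and [A2] are given by their values on pure tensors, the form in which [actnS] describes
    [actn]. *)
Lemma tassoc_act2 (X Y : hmodule H) (U V : vectType K) (al : U -> 'End(V))
    (A1 : 'Hom(tens H U, 'End(tens (htens X Y) V)))
    (A2 : 'Hom(tens H (tens H U), 'End(tens X (tens Y V)))) :
  (forall a t, A1 (pure a t) = tmap (act (htens X Y) a) (al t)) ->
  (forall a b t, A2 (pure a (pure b t)) = tmap (act X a) (tmap (act Y b) (al t))) ->
  forall b, A2 (tassoc _ _ U (tmap (comul H) \1%VF b)) =
    (tassoc _ _ _ \o A1 b \o tassoc' _ _ _)%VF.
Proof.
move=> e1 e2 b; elim/tens_ind: b => [c x y ex ey|a t].
  by rewrite !linearP /= ex ey lfun_compDr lfun_compDl.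
rewrite e1 tmapE id_lfunE [act _ a]comp_lfunE; move: (comul H a) => s.
elim/tens_ind: s => [c x y ex ey|c d].
  rewrite pureDl pureZl !linearP /= ex ey (tmap_bilin _ _ _ _).2.
  by rewrite lfun_compDr lfun_compDl.
rewrite tassocE e2 act2E tassoc_nat -comp_lfunA.
by rewrite (tassocK _ _ _).2 comp_lfun1r.
Qed.

Definition regm : hmodule H :=
  @HModule K H H (linfun (@amull K H)) (etrans (lfunE _ _) (amull1 H))
    (fun a b => etrans (lfunE _ _)
       (etrans (amullM a b) (congr2 _ (esym (lfunE _ a)) (esym (lfunE _ b))))).

Fixpoint regs n : obs M n :=
  if n is m.+1 return obs M n then (regm, regs m) else tt.

Definition T n : vectType K := tp (regs n).

Fixpoint actn n : forall X : obs M n, 'Hom(T n, 'End(tp X)) :=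
  match n return forall X : obs M n, 'Hom(T n, 'End(tp X)) with
  | 0 => fun _ => linfun (fun c : K^o => c *: \1%VF)
  | m.+1 => fun X => tlift (fun a t => tmap (act X.1 a) (actn X.2 t))
  end.

Lemma actn0 (X : obs M 0) (c : K^o) : actn X c = c *: \1%VF.
Proof.
pose f (c : K^o) : 'End(K^o) := c *: \1%VF.
have lf : linear f by move=> a x y; rewrite /f scalerDl scalerA.
pose G := HB.pack_for {linear K^o -> 'End(K^o)} f
  (GRing.isSemilinear.Build K _ _ _ f (GRing.semilinear_linear lf)).
exact: (lfunE G).
Qed.

Lemma actnS n (X : obs M n.+1) a (t : T n) :
  actn X (pure a t) = tmap (act X.1 a) (actn X.2 t).
Proof.
rewrite /= tliftE //; apply: bilin_comp (tmap_bilin _ _ _ _); exact: linearP.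
Qed.

(** [eta], [cmid] and [clast] are the cofaces of the cobar complex. They mirror [dy_first],
    [dy_merge] and [dy_last], including the treatment of an index that is too large. *)
Definition eta n : 'Hom(T n, T n.+1) := pureh (T n) (1 : H).

Fixpoint cmid n (i : nat) : 'Hom(T n.+1, T n.+2) :=
  match n, i return 'Hom(T n.+1, T n.+2) with
  | m.+1, j.+1 => tmap \1 (cmid m j)
  | m.+1, 0 => (tassoc _ _ (T m.+1) \o tmap (comul H) \1)%VF
  | 0, _ => (tassoc _ _ (T 0) \o tmap (comul H) \1)%VF
  end.

Fixpoint clast n : 'Hom(T n, T n.+1) :=
  match n return 'Hom(T n, T n.+1) with
  | 0 => pureh K^o (1 : H)
  | m.+1 => tmap \1 (clast m)
  end.

Lemma actn_eta n (X : obs M n.+1) (t : T n) :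
  actn X (eta n t) = tmap \1 (actn X.2 t).
Proof. by rewrite purehE actnS act1. Qed.

Lemma actn_mid0 n (X Y : M) (Z : obs M n) (b : tens H (T n)) :
  @actn n.+2 (X, (Y, Z)) (tassoc _ _ (T n) (tmap (comul H) \1%VF b)) =
  (tassoc _ _ (tp Z) \o @actn n.+1 (ten X Y, Z) b \o tassoc' _ _ (tp Z))%VF.
Proof.
apply: (@tassoc_act2 X Y _ _ (actn Z)) => [a t|a c t].
  exact: (@actnS n (ten X Y, Z)).
by rewrite (@actnS n.+1 (X, (Y, Z))) (@actnS n (Y, Z)).
Qed.

Lemma actn_mid n i (X : obs M n.+2) (b : T n.+1) :
  actn X (cmid n i b) = (mrg' i X \o actn (Defs.merge i X) b \o mrg i X)%VF.
Proof.
elim: n i X b => [|n IH] [|i] [X Y] b;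
  try by rewrite comp_lfunE; case: Y => Y Z; exact: actn_mid0.
move: b; apply: tens_ind => [c x y ex ey|a t].
  by rewrite !linearP /= ex ey lfun_compDr lfun_compDl.
rewrite [cmid n.+1 i.+1]/= tmapE id_lfunE !actnS IH.
by rewrite -!tmap_comp comp_lfun1l comp_lfun1r.
Qed.

End Fibers.

(** * Tensors representing families, and the differential on tensors *)

Section Representability.
Local Open Scope ring_scope.
Variables (K : fieldType) (H : hopfAlgebra K).
Local Notation M := (Hmod H).
Local Notation T := (T H).
Local Notation eta := (eta H).
Local Notation cmid := (cmid H).
Local Notation clast := (clast H).
Local Notation fiber := (@fiber K H).

Lemma actn_last n (X : obs M n.+1) (b : T n) :
  actn X (clast n b) = (snc X \o tmap (actn (ofront X) b) \1 \o snc' X)%VF.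
Proof.
elim: n X b => [|n IH] X b.
  rewrite purehE actnS act1 !actn0; apply: tens_lfun_ext => x c.
  rewrite !comp_lfunE trunitE tmapE !purehE tmapE rpurehE !id_lfunE !scale_lfunE.
  rewrite !id_lfunE tlunitE scalerA pureZl -pureZr; congr pure.
  by rewrite -[RHS]/(_ * _) -[X in X * c * _]/(b * 1) !mulr1.
elim/tens_ind: b => [c x y ex ey|a t].
  rewrite !linearP /= ex ey (tmap_bilin _ _ _ _).2.
  by rewrite lfun_compDr lfun_compDl.
rewrite tmapE id_lfunE !actnS IH /= -[RHS]comp_lfunA.
transitivity (tmap \1 (snc X.2) \o (tassoc _ _ _ \o
   tmap (tmap (act X.1 a) (actn (ofront X.2) t)) \1) \o
   (tassoc' _ _ _ \o tmap \1 (snc' X.2)))%VF; last by rewrite !comp_lfunA.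
rewrite tassoc_nat -!comp_lfunA (comp_lfunA (tassoc _ _ _)) (tassocK _ _ _).2.
by rewrite comp_lfun1l -!tmap_comp comp_lfun1l comp_lfun1r.
Qed.

Definition cmiddle n : 'Hom(T n, T n.+1) :=
  match n return 'Hom(T n, T n.+1) with
  | 0 => 0
  | m.+1 => \sum_(i < m.+1) (-1) ^+ i.+1 *: cmid m i
  end.

Definition cdiff n : 'Hom(T n, T n.+1) :=
  (eta n + cmiddle n + (-1) ^+ n.+1 *: clast n).

Section Represent.
Variables (D : monoidalCategory K) (F : tensorFunctor M D) (W : fiber F).

Fixpoint fJ n : forall X : obs M n, 'Hom(tp X, fw W (tpow F X)) :=
  match n return forall X : obs M n, 'Hom(tp X, fw W (tpow F X)) with
  | 0 => fun _ => fu W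
  | m.+1 => fun X => (ft W _ _ \o tmap (fo W X.1) (fJ X.2))%VF
  end.

Fixpoint fJ' n : forall X : obs M n, 'Hom(fw W (tpow F X), tp X) :=
  match n return forall X : obs M n, 'Hom(fw W (tpow F X), tp X) with
  | 0 => fun _ => fu' W
  | m.+1 => fun X => (tmap (fo' W X.1) (fJ' X.2) \o ft' W _ _)%VF
  end.

Lemma fJK n (X : obs M n) : (fJ' X \o fJ X = \1)%VF.
Proof.
elim: n X => [|n IH] X; first exact: fuK'.
by apply: comp_lfun_inv; rewrite ?ftK' // -tmap_comp IH foK' tmap_id.
Qed.

Lemma fJK' n (X : obs M n) : (fJ X \o fJ' X = \1)%VF.
Proof.
elim: n X => [|n IH] X; first exact: fuK.
by apply: comp_lfun_inv; rewrite ?ftK // -tmap_comp IH foK tmap_id.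
Qed.

Lemma fh_inverses (X Y : D) (f : Defs.hom X Y) (g : Defs.hom Y X) :
  inverses f g -> (fh W g \o fh W f = \1)%VF /\ (fh W f \o fh W g = \1)%VF.
Proof. by case=> gf fg; rewrite -!fh_comp gf fg !fh1. Qed.

(** The rules that follow, one for each way of building a coherence morphism, let a morphism of D be
    translated into a linear map piece by piece. *)
Definition intertwines (X Y : D) (U V : vectType K) (JX : 'Hom(U, fw W X))
    (JY : 'Hom(V, fw W Y)) (f : Defs.hom X Y) (g : 'Hom(U, V)) : Prop :=
  (fh W f \o JX = JY \o g)%VF.

Lemma intertwines_comp (X Y Z : D) (U V Q : vectType K) (JX : 'Hom(U, fw W X))
    (JY : 'Hom(V, fw W Y)) (JZ : 'Hom(Q, fw W Z))
    (f : Defs.hom X Y) (g : Defs.hom Y Z) f' g' :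
  intertwines JX JY f f' -> intertwines JY JZ g g' ->
  intertwines JX JZ (Defs.comp g f) (g' \o f')%VF.
Proof.
by rewrite /intertwines fh_comp => ef eg; rewrite -comp_lfunA ef !comp_lfunA eg.
Qed.

Lemma intertwines_inv (X Y : D) (U V : vectType K) (JX : 'Hom(U, fw W X))
    (JY : 'Hom(V, fw W Y)) (f : Defs.hom X Y) (g : Defs.hom Y X) f' g' :
  inverses f g -> (f' \o g' = \1)%VF ->
  intertwines JX JY f f' -> intertwines JY JX g g'.
Proof.
move=> /fh_inverses[gf _] fg' ef; rewrite /intertwines.
by rewrite -[JY]comp_lfun1r -fg' (comp_lfunA JY) -ef !comp_lfunA gf comp_lfun1l.
Qed.

Lemma intertwines_id (X : D) (U : vectType K) (JX : 'Hom(U, fw W X)) :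
  intertwines JX JX (idm X) \1.
Proof. by rewrite /intertwines fh1 comp_lfun1l comp_lfun1r. Qed.

Lemma intertwines_ten (X X' Y Y' : D) (U U' V V' : vectType K)
    (JX : 'Hom(U, fw W X)) (JX' : 'Hom(U', fw W X'))
    (JY : 'Hom(V, fw W Y)) (JY' : 'Hom(V', fw W Y')) f f' g g' :
  intertwines JX JX' f f' -> intertwines JY JY' g g' ->
  intertwines (ft W _ _ \o tmap JX JY) (ft W _ _ \o tmap JX' JY')
    (tenm f g) (tmap f' g').
Proof.
rewrite /intertwines => ef eg.
by rewrite comp_lfunA fh_ten -!comp_lfunA -!tmap_comp ef eg.
Qed.

Lemma intertwines_asc (X Y Z : D) (U V Q : vectType K) (JX : 'Hom(U, fw W X))
    (JY : 'Hom(V, fw W Y)) (JZ : 'Hom(Q, fw W Z)) :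
  intertwines (ft W _ _ \o tmap (ft W _ _ \o tmap JX JY) JZ)
    (ft W _ _ \o tmap JX (ft W _ _ \o tmap JY JZ))
    (asc X Y Z) (tassoc U V Q).
Proof.
rewrite /intertwines.
have -> : tmap (ft W _ _ \o tmap JX JY) JZ =
    (tmap (ft W _ _) \1 \o tmap (tmap JX JY) JZ)%VF.
  by rewrite -tmap_comp comp_lfun1l.
have -> : tmap JX (ft W _ _ \o tmap JY JZ) =
    (tmap \1 (ft W _ _) \o tmap JX (tmap JY JZ))%VF.
  by rewrite -tmap_comp comp_lfun1l.
have := congr1 (fun h => h \o tmap (tmap JX JY) JZ)%VF (fh_asc W X Y Z).
by rewrite -!comp_lfunA => ->; rewrite tassoc_nat.
Qed.

Lemma intertwines_mergem n i (X : obs M n.+2) :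
  intertwines (fJ X) (fJ (Defs.merge i X)) (mergem F i X) (mrg i X).
Proof.
have m0 m (Y : obs M m.+2) :
    intertwines (fJ Y) (fJ (merge0 Y)) (mergem0 F Y) (tassoc' _ _ _).
  (* [mergem0] is [f2], tensored with an identity, after [asc']. On underlying spaces [f2] is the
     identity, which is the factor inserted here. *)
  rewrite -[tassoc' _ _ _]comp_lfun1l -tmap_id.
  apply: intertwines_comp; last first.
    apply: intertwines_ten (intertwines_id _).
    by rewrite /intertwines comp_lfun1r; apply: fh_f2.
  apply: (intertwines_inv (ascK _ _ _)); first exact: (tassocK _ _ _).2.
  exact: intertwines_asc.
elim: n i X => [|n IH] [|i] X; try exact: m0.
by apply: intertwines_ten; [apply: intertwines_id | apply: IH].
Qed.

Lemma intertwines_mergem' n i (X : obs M n.+2) :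
  intertwines (fJ (Defs.merge i X)) (fJ X) (mergem' F i X) (mrg' i X).
Proof.
apply: (intertwines_inv (mergemK F i X)); first exact: (mrgK _ _).2.
exact: intertwines_mergem.
Qed.

Lemma intertwines_snocm n (X : obs M n.+1) :
  intertwines (ft W _ _ \o tmap (fJ (ofront X)) (fo W (olast X))) (fJ X)
    (snocm F X) (snc X).
Proof.
elim: n X => [|n IH] X.
  apply: (@intertwines_comp _ _ _ _ _ _ _ (fo W X.1)).
    have := congr1 (fun h => h \o tmap \1 (fo W X.1))%VF (fh_lun W (F X.1)).
    by rewrite -!comp_lfunA -tmap_comp comp_lfun1l comp_lfun1r tlunit_nat.
  apply: (@intertwines_inv _ _ _ _ _ _ (run _) _ (trunit _)).
  - exact: runK.
  - exact: (trunitK _).2.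
  have := congr1 (fun h => h \o tmap (fo W X.1) \1)%VF (fh_run W (F X.1)).
  by rewrite -!comp_lfunA -tmap_comp comp_lfun1l comp_lfun1r trunit_nat.
apply: intertwines_comp; first exact: intertwines_asc.
by apply: intertwines_ten; [apply: intertwines_id | apply: IH].
Qed.

Lemma intertwines_snocm' n (X : obs M n.+1) :
  intertwines (fJ X) (ft W _ _ \o tmap (fJ (ofront X)) (fo W (olast X)))
    (snocm' F X) (snc' X).
Proof.
apply: (intertwines_inv (snocmK F X)); first exact: (sncK _).2.
exact: intertwines_snocm.
Qed.

Definition represents n (b : T n) (f : Defs.family F n) : Prop :=
  forall X, intertwines (fJ X) (fJ X) (f X) (actn X b).

Lemma intertwinesD (X Y : D) (U V : vectType K) (JX : 'Hom(U, fw W X))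
    (JY : 'Hom(V, fw W Y)) a f f' g g' :
  intertwines JX JY f f' -> intertwines JX JY g g' ->
  intertwines JX JY (a *: f + g) (a *: f' + g').
Proof.
rewrite /intertwines => ef eg.
by rewrite fh_linear lfun_compDl ef eg lfun_compDr.
Qed.

Lemma intertwines_add (X Y : D) (U V : vectType K) (JX : 'Hom(U, fw W X))
    (JY : 'Hom(V, fw W Y)) f f' g g' :
  intertwines JX JY f f' -> intertwines JX JY g g' ->
  intertwines JX JY (f + g) (f' + g').
Proof. by move=> ef eg; have := intertwinesD 1 ef eg; rewrite !scale1r. Qed.

Lemma intertwines0 (X Y : D) (U V : vectType K) (JX : 'Hom(U, fw W X))
    (JY : 'Hom(V, fw W Y)) : intertwines JX JY 0 0.
Proof.
have := fh_linear W 0 (0 : Defs.hom X Y) 0; rewrite scaler0 addr0 scale0r add0r => e.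
have : fh W 0 = 0 :> 'Hom(fw W X, fw W Y).
  by have := fh_linear W (-1) (0 : Defs.hom X Y) 0; rewrite scaler0 addr0 scaleN1r addNr.
by rewrite /intertwines => ->; rewrite comp_lfun0l comp_lfun0r.
Qed.

Lemma intertwinesZ (X Y : D) (U V : vectType K) (JX : 'Hom(U, fw W X))
    (JY : 'Hom(V, fw W Y)) a f f' :
  intertwines JX JY f f' -> intertwines JX JY (a *: f) (a *: f').
Proof. by move=> ef; have := intertwinesD a ef (intertwines0 _ _); rewrite !addr0. Qed.

Lemma represents_sum n (I : finType) (a : I -> K) (b : I -> T n)
    (f : I -> Defs.family F n) :
  (forall i, represents (b i) (f i)) ->
  represents (\sum_i a i *: b i) (fun X => \sum_i a i *: f i X).
Proof.
move=> bf X; rewrite linear_sum /=.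
rewrite !big_mkcond /=; elim: (index_enum I) => [|i r IH].
  by rewrite !big_nil; apply: intertwines0.
by rewrite !big_cons linearZ_LR; apply: intertwinesD (IH); apply: bf.
Qed.

Lemma representsD n a (b c : T n) (f g : Defs.family F n) :
  represents b f -> represents c g ->
  represents (a *: b + c) (fun X => a *: f X + g X).
Proof. by move=> bf cg X; rewrite linearP; apply: intertwinesD. Qed.

Lemma represents_middle n (b : T n) (f : Defs.family F n) (X : obs M n.+1) :
  represents b f -> intertwines (fJ X) (fJ X) (dy_middle f X) (actn X (cmiddle n b)).
Proof.
case: n b f X => [|n] b f X bf.
  by rewrite zero_lfunE (linear0 (actn X)); apply: intertwines0.
rewrite sum_lfunE /dy_middle; elim: (index_enum _) => [|i r IH].
  by rewrite !big_nil (linear0 (actn X)); apply: intertwines0.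
rewrite !big_cons (linearD (actn X)); apply: intertwines_add IH.
rewrite scale_lfunE (linearZ_LR (actn X)); apply: intertwinesZ.
change (intertwines (fJ X) (fJ X) (dy_merge i f X) (actn X (cmid n i b))).
rewrite actn_mid -comp_lfunA.
apply: intertwines_comp; last exact: intertwines_mergem'.
by apply: intertwines_comp; [exact: intertwines_mergem | apply: bf].
Qed.

Lemma represents_diff n (b : T n) (f : Defs.family F n) :
  represents b f -> represents (cdiff n b) (dy_diff f).
Proof.
move=> bf X; rewrite /cdiff !add_lfunE scale_lfunE /dy_diff !(linearD (actn X)).
rewrite (linearZ_LR (actn X)).
apply: intertwines_add; last first.
  apply: intertwinesZ.
  change (intertwines (fJ X) (fJ X) (dy_last f X) (actn X (clast n b))).
  rewrite actn_last -comp_lfunA /dy_last.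
  apply: intertwines_comp; last exact: intertwines_snocm.
  apply: intertwines_comp; first exact: intertwines_snocm'.
  by apply: intertwines_ten; [apply: bf | apply: intertwines_id].
apply: intertwines_add (represents_middle _ bf).
change (intertwines (fJ X) (fJ X) (dy_first f X) (actn X (eta n b))).
rewrite actn_eta.
by apply: intertwines_ten; [exact: intertwines_id | exact: bf].
Qed.

End Represent.
End Representability.

(** * Evaluation on the regular module *)

Section Evaluation.
Local Open Scope ring_scope.
Variables (K : fieldType) (H : hopfAlgebra K).
Local Notation M := (Hmod H).
Local Notation T := (T H).
Local Notation cdiff := (cdiff H).
Local Notation regs := (regs H).
Local Notation regm := (regm H).
Local Notation fiber := (@fiber K H).

Fixpoint vecs n : obs M n -> Type :=
  match n return obs M n -> Type with
  | 0 => fun _ => unit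
  | m.+1 => fun X => (hmod_space X.1 * vecs X.2)%type
  end.

Fixpoint purn n : forall X : obs M n, vecs X -> tp X :=
  match n return forall X : obs M n, vecs X -> tp X with
  | 0 => fun _ _ => (1 : K^o)
  | m.+1 => fun X v => pure v.1 (purn v.2)
  end.

Lemma purn_ext n (X : obs M n) (U : vectType K) (f g : 'Hom(tp X, U)) :
  (forall v, f (purn v) = g (purn v)) -> f = g.
Proof.
elim: n X f g => [|n IH] X f g fg.
  apply/lfunP => c; have := fg tt; rewrite /= => e.
  by rewrite -[c]mulr1 -[c * 1]/(c *: (1 : K^o)) !linearZ_LR /= e.
apply: tens_lfun_ext => x t; rewrite -!(purehE x) -!comp_lfunE.
congr (fun_of_lfun _ _); apply: IH => v; rewrite !comp_lfunE !purehE.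
exact: (fg (x, v)).
Qed.

Lemma regm_act (a b : H) : act regm a b = a * b.
Proof.
have -> : act regm a = amull a by apply: lfunE.
by rewrite lfunE.
Qed.

Definition orbit_fun (X : hmodule H) (x : X) (a : H) : X := act X a x.

Lemma orbit_linear (X : hmodule H) (x : X) : linear (orbit_fun x).
Proof. by move=> c a b; rewrite /orbit_fun linearP add_lfunE scale_lfunE. Qed.

HB.instance Definition _ (X : hmodule H) (x : X) :=
  GRing.isSemilinear.Build K H X _ (orbit_fun x)
    (GRing.semilinear_linear (orbit_linear x)).

Lemma orbit_hlin (X : hmodule H) (x : X) :
  linfun (orbit_fun x) \in hlin (X := regm) (Y := X).
Proof.
apply/hlinP => a; apply/lfunP => b.
by rewrite !comp_lfunE !(lfunE (orbit_fun x)) /= /orbit_fun regm_act actM comp_lfunE.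
Qed.

Definition orbit (X : hmodule H) (x : X) : hhom regm X := HHom (orbit_hlin x).

Lemma orbitE (X : hmodule H) (x : X) a : orbit x a = act X a x.
Proof. exact: (lfunE (orbit_fun x)). Qed.

Fixpoint orbits n : forall X : obs M n, vecs X -> homs (regs n) X :=
  match n return forall X : obs M n, vecs X -> homs (regs n) X with
  | 0 => fun _ _ => tt
  | m.+1 => fun X v => (orbit v.1, orbits v.2)
  end.

Lemma tpm_orbits n (X : obs M n) (v : vecs X) (b : T n) :
  tpm (orbits v) b = actn X b (purn v).
Proof.
elim: n X v b => [|n IH] X v b.
  by rewrite actn0 scale_lfunE !id_lfunE /= [_ *: _]mulr1.
move: b; apply: tens_ind => [c x y ex ey|a t].
  by rewrite !lfunPE ex ey add_lfunE scale_lfunE.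
by rewrite actnS tmapE [hhom_fun _ _]orbitE IH tmapE.
Qed.

Fixpoint vone n : vecs (regs n) :=
  match n return vecs (regs n) with
  | 0 => tt
  | m.+1 => ((1 : H), vone m)
  end.

Lemma tpm_one n (b : T n) : tpm (orbits (vone n)) b = b.
Proof.
suff -> : tpm (orbits (vone n)) = \1%VF by rewrite id_lfunE.
elim: n {b} => [|n IH] //; apply: etrans (tmap_id _ _); rewrite -IH.
congr tmap; apply/lfunP => a; rewrite id_lfunE.
by apply: etrans (orbitE (X := regm) _ _) _; rewrite regm_act mulr1.
Qed.

Lemma actn_one n (b : T n) : actn (regs n) b (purn (vone n)) = b.
Proof. by rewrite -tpm_orbits tpm_one. Qed.

Lemma actn_nat n (X Y : obs M n) (u : homs X Y) (b : T n) :
  (tpm u \o actn X b = actn Y b \o tpm u)%VF.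
Proof.
elim: n X Y u b => [|n IH] X Y u b.
  by rewrite !actn0 /= comp_lfun1l comp_lfun1r.
move: b; apply: tens_ind => [c x y ex ey|a t].
  by rewrite !lfunPE lfun_compDr lfun_compDl ex ey.
by rewrite !actnS -!tmap_comp IH (hlinP _ (hhom_lin u.1)).
Qed.

Lemma tpm_orbits_one n (X : obs M n) (v : vecs X) :
  tpm (orbits v) (purn (vone n)) = purn v.
Proof.
elim: n X v => [|n IH] X v; first by rewrite id_lfunE.
by rewrite tmapE IH [hhom_fun _ _]orbitE act1 id_lfunE.
Qed.

Section Naturality.
Variables (D : monoidalCategory K) (F : tensorFunctor M D) (W : fiber F).

Lemma intertwines_tpowm n (X Y : obs M n) (u : homs X Y) :
  intertwines (fJ W X) (fJ W Y) (tpowm F u) (tpm u).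
Proof.
elim: n X Y u => [|n IH] X Y u; first exact: intertwines_id.
by apply: intertwines_ten (IH _ _ _); apply: fh_fmap.
Qed.

Lemma intertwines_eq n (X Y : obs M n) f g (f' g' : 'Hom(tp X, tp Y)) :
  intertwines (fJ W X) (fJ W Y) f f' -> intertwines (fJ W X) (fJ W Y) g g' ->
  f = g <-> f' = g'.
Proof.
rewrite /intertwines => ef eg; split=> [fg|fg].
  rewrite -[f']comp_lfun1l -[g']comp_lfun1l -(fJK W) -!comp_lfunA.
  by rewrite -ef -eg fg.
apply: (fh_inj (f0 := W)); rewrite -[LHS]comp_lfun1r -[RHS]comp_lfun1r -(fJK' W).
by rewrite !comp_lfunA ef eg fg.
Qed.

Lemma represents_natural n (b : T n) (f : Defs.family F n) :
  represents W b f -> natural f.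
Proof.
move=> bf X Y u; apply/(intertwines_eq _ _)/(actn_nat u b).
  by apply: intertwines_comp; [apply: bf | apply: intertwines_tpowm].
by apply: intertwines_comp; [apply: intertwines_tpowm | apply: bf].
Qed.

Lemma natural_represents n (f : Defs.family F n) :
  natural f -> exists b, represents W b f.
Proof.
move=> nf; pose b : T n := fJ' W _ (fh W (f (regs n)) (fJ W _ (purn (vone n)))).
exists b => X; apply: purn_ext => v; rewrite !comp_lfunE.
have h (z : T n) : fh W (tpowm F (orbits v)) (fJ W _ z) = fJ W X (tpm (orbits v) z).
  by have /lfunP/(_ z) := intertwines_tpowm (orbits v); rewrite !comp_lfunE.
(* A pure tensor of vectors is the image of 1 ⊗ ... ⊗ 1 under the orbit maps from the regular
   module, and naturality pulls these maps through [f]. *)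
rewrite -[in LHS]tpm_orbits_one -h -comp_lfunE -fh_comp -nf fh_comp comp_lfunE.
by rewrite -[fh W (f _) _]id_lfunE -(fJK' W) comp_lfunE h tpm_orbits.
Qed.

Lemma represents_inj n (b c : T n) (f : Defs.family F n) :
  represents W b f -> represents W c f -> b = c.
Proof.
move=> bf cf; have /(intertwines_eq (bf _) (cf _)) e : f (regs n) = f (regs n) by [].
by rewrite -[b]actn_one -[c]actn_one e.
Qed.

Lemma represents_eq n (b : T n) (f g : Defs.family F n) :
  represents W b f -> represents W b g -> forall X, f X = g X.
Proof. by move=> bf bg X; apply/(intertwines_eq (bf X) (bg X)). Qed.

Lemma represents0 n (b : T n) (f : Defs.family F n) :
  represents W b f -> (forall X, f X = 0) <-> b = 0.
Proof.
have z0 : represents W (0 : T n) (fun X => 0).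
  by move=> X; rewrite lfun0E; apply: intertwines0.
move=> bf; split=> [f0|b0].
  by apply: represents_inj bf _ => X; rewrite f0; apply: z0.
by move=> X; move: bf; rewrite b0 => /represents_eq/(_ z0).
Qed.
End Naturality.

(** The shape of [dy_dim], for predicates on one vector space, so that it applies to the
    subcomplexes and to the double complex as well. *)
Definition qdim (V : lmodType K) (Z B : V -> Prop) d : Prop :=
  exists c : 'I_d -> V,
    [/\ forall i, Z (c i),
        forall z, Z z -> exists a : 'I_d -> K, B (z - \sum_i a i *: c i)
      & forall a : 'I_d -> K, B (\sum_i a i *: c i) -> forall i, a i = 0].

Definition ccocycle (N : forall n, T n -> Prop) n (z : T n) : Prop :=
  N n z /\ cdiff n z = 0.

Definition ccoboundary (N : forall n, T n -> Prop) n : T n -> Prop :=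
  match n return T n -> Prop with
  | 0 => fun z => z = 0
  | m.+1 => fun z => exists2 y : T m, N m y & z = cdiff m y
  end.

Lemma dy_dim_qdim (D : monoidalCategory K) (F : tensorFunctor M D)
    (W : fiber F) (N : forall n, T n -> Prop) n d :
  (forall n (b : T n), N n b <-> exists f : Defs.family F n, represents W b f) ->
  qdim (@ccocycle N n) (@ccoboundary N n) d -> dy_dim F n d.
Proof.
move=> NP [c [cZ cG cF]].
have /boolp.choice[f fP] : forall i, exists f, represents W (c i) f.
  by move=> i; apply/NP; case: (cZ i).
have cobP (z : T n) (h : Defs.family F n) : represents W z h ->
    ccoboundary N z <-> dy_coboundary h.
  case: n {c cZ cG cF f fP} z h => [|m] z h zh; first by apply: iff_sym; apply: represents0 zh.
  split=> [[y Ny zE]|[g ng hE]].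
    have [g yg] := (NP _ y).1 Ny; exists g; first exact: represents_natural yg.
    by apply: represents_eq zh _; rewrite zE; apply: represents_diff.
  have [y yg] := natural_represents W ng; exists y; first by apply/NP; exists g.
  apply: represents_inj zh _ => X; rewrite hE; exact: represents_diff.
have sumP (a : 'I_d -> K) :
    represents W (\sum_i a i *: c i) (fun X => \sum_i a i *: f i X).
  exact: represents_sum.
exists f; split=> [i|h [nh h0]|a].
- split; first exact: represents_natural (fP i).
  by apply/(represents0 (represents_diff (fP i))); case: (cZ i).
- have [b bh] := natural_represents W nh.
  have [|a ab] := cG b.
    split; first by apply/NP; exists h.
    exact/(represents0 (represents_diff bh)).
  exists a; apply/(cobP _ _ _).1: ab => X.
  have -> : h X - \sum_i a i *: f i X = -1 *: (\sum_i a i *: f i X) + h X.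
    by rewrite scaleN1r addrC.
  have -> : b - \sum_i a i *: c i = -1 *: (\sum_i a i *: c i) + b.
    by rewrite scaleN1r addrC.
  exact: representsD (sumP a) bh X.
by move=> /(cobP _ _ (sumP a))/cF.
Qed.
End Evaluation.

(** * Cochains of the identity functor as a centralizer *)

Section TensorAction.
Local Open Scope ring_scope.
Variables (K : fieldType) (H : hopfAlgebra K).
Local Notation M := (Hmod H).
Local Notation T := (T H).
Local Notation regs := (regs H).

Fixpoint tactn n : forall X : obs M n, 'Hom(H, 'End(tp X)) :=
  match n return forall X : obs M n, 'Hom(H, 'End(tp X)) with
  | 0 => fun _ => hunit_act H
  | m.+1 => fun X =>
      (tlift (fun c d => tmap (act X.1 c) (tactn X.2 d)) \o comul H)%VF
  end.

Lemma tactnSE n (X : obs M n.+1) c d :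
  tlift (fun c d => tmap (act X.1 c) (tactn X.2 d)) (pure c d) =
  tmap (act X.1 c) (tactn X.2 d).
Proof. rewrite tliftE //; apply: bilin_comp (tmap_bilin _ _ _ _); exact: linearP. Qed.

Lemma tactn_fJ n (X : obs M n) (a : H) :
  (act (tpow (idFunctor M) X) a \o fJ (id_fiber H) X =
   fJ (id_fiber H) X \o tactn X a)%VF.
Proof.
elim: n X a => [|n IH] X a.
  by rewrite /= comp_lfun1l comp_lfun1r.
case: X => X Y; rewrite [fJ _ _]comp_lfun1l [tactn _ _]comp_lfunE.
rewrite [act _ a]comp_lfunE; move: (comul H a); apply: tens_ind => [c x y ex ey|c d].
  by rewrite !lfunPE lfun_compDr lfun_compDl ex ey.
by rewrite act2E (@tactnSE n (X, Y)) -!tmap_comp IH comp_lfun1l comp_lfun1r.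
Qed.

Lemma represents_forget n (b : T n) : exists f, represents (forget_fiber H) b f.
Proof.
exists (fun X => fJ (forget_fiber H) X \o actn X b \o fJ' (forget_fiber H) X)%VF => X.
rewrite /intertwines -[fh _ _]/(_ \o _ \o _)%VF -!comp_lfunA.
by rewrite (fJK (forget_fiber H)) comp_lfun1r.
Qed.

Lemma represents_id n (b : T n) :
  (exists f, represents (id_fiber H) b f) <->
  (forall X a, (actn X b \o tactn X a = tactn X a \o actn X b)%VF).
Proof.
pose J n (X : obs M n) := fJ (id_fiber H) X.
pose J' n (X : obs M n) := fJ' (id_fiber H) X.
have JK m (X : obs M m) : (J' _ X \o J _ X = \1)%VF := fJK (id_fiber H) X.
have JK' m (X : obs M m) : (J _ X \o J' _ X = \1)%VF := fJK' (id_fiber H) X.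
split=> [[f bf] X a|bC].
  have e : (hhom_fun (f X) \o J n X = J n X \o actn X b)%VF := bf X.
  have t := tactn_fJ X a; have l := (hlinP _ (hhom_lin (f X))) a.
  rewrite -[LHS]comp_lfun1l -[RHS]comp_lfun1l -(JK _ X) -!comp_lfunA; congr (_ \o _)%VF.
  rewrite comp_lfunA -e -comp_lfunA -t comp_lfunA l.
  by rewrite [RHS]comp_lfunA -t -[RHS]comp_lfunA -e comp_lfunA.
have lin X : (J _ X \o actn X b \o J' _ X)%VF \in
    hlin (X := tpow (idFunctor M) X) (Y := tpow (idFunctor M) X).
  apply/hlinP => a; have t := tactn_fJ X a.
  have t' : (J' _ X \o act (tpow (idFunctor M) X) a = tactn X a \o J' _ X)%VF.
    rewrite -[LHS]comp_lfun1r -(JK' _ X) comp_lfunA -[(_ \o act _ a \o _)%VF]comp_lfunA.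
    by rewrite t comp_lfunA JK comp_lfun1l.
  have e : ((J _ X \o actn X b \o J' _ X) \o act (tpow (idFunctor M) X) a =
      act (tpow (idFunctor M) X) a \o (J _ X \o actn X b \o J' _ X))%VF.
    by rewrite -comp_lfunA t' comp_lfunA -(comp_lfunA (J _ X)) bC !comp_lfunA t.
  exact: e.
exists (fun X => HHom (lin X)) => X.
by rewrite /intertwines -[fh _ _]/(_ \o _ \o _)%VF -!comp_lfunA JK comp_lfun1r.
Qed.

(** Inherited from the module structure of [tpow] along the isomorphism [fJ], which replaces an
    induction through iterated coproducts. *)
Lemma tactnM n (X : obs M n) a b : tactn X (a * b) = (tactn X a \o tactn X b)%VF.
Proof.
have JK : (fJ' (id_fiber H) X \o fJ (id_fiber H) X = \1)%VF := fJK (id_fiber H) X.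
rewrite -[LHS]comp_lfun1l -[RHS]comp_lfun1l -JK -!comp_lfunA; congr (_ \o _)%VF.
rewrite -tactn_fJ actM -comp_lfunA.
by rewrite [(act _ b \o _)%VF]tactn_fJ !comp_lfunA -tactn_fJ.
Qed.

Lemma tactn1 n (X : obs M n) : tactn X 1 = \1%VF.
Proof.
have JK : (fJ' (id_fiber H) X \o fJ (id_fiber H) X = \1)%VF := fJK (id_fiber H) X.
by rewrite -[LHS]comp_lfun1l -JK -comp_lfunA -tactn_fJ act1 comp_lfun1l JK.
Qed.
(** With c and y multiplication by g and x_i on a fixed side, [gop] and [xop] are multiplication on
    that side by the iterated coproducts g ⊗ ... ⊗ g and the sum of all 1 ⊗ ... ⊗ 1 ⊗ x_i ⊗ g ⊗ ...
    ⊗ g. Abstract c and y serve both sides. *)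
Fixpoint gop (c : 'End(H)) n : 'End(T n) :=
  match n return 'End(T n) with
  | 0 => \1%VF
  | m.+1 => tmap c (gop c m)
  end.

Fixpoint xop (c y : 'End(H)) n : 'End(T n) :=
  match n return 'End(T n) with
  | 0 => 0
  | m.+1 => tmap \1 (xop c y m) + tmap y (gop c m)
  end.

Lemma gopE c n (a : H) (t : T n) : gop c n.+1 (pure a t) = pure (c a) (gop c n t).
Proof. exact: tmapE. Qed.

Lemma xopE c y n (a : H) (t : T n) :
  xop c y n.+1 (pure a t) = pure a (xop c y n t) + pure (y a) (gop c n t).
Proof. by rewrite add_lfunE !tmapE id_lfunE. Qed.

End TensorAction.

Section Centralizer.
Local Open Scope ring_scope.
Variables (K : fieldType) (k : nat).
Local Notation H := (Bk_hopf K k).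
Local Notation M := (Hmod H).
Local Notation T := (T H).

Local Notation gleft := (gop (H := H) (amull (Bk_g K k))).
Local Notation gright := (gop (H := H) (amulr (Bk_g K k))).
Local Notation xleft i := (xop (H := H) (amull (Bk_g K k)) (amull (Bk_x K i))).
Local Notation xright i := (xop (H := H) (amulr (Bk_g K k)) (amulr (Bk_x K i))).

(** Commutation is asked for the generators; since [tactn] is multiplicative, [central_represents]
    extends it to all of B_k. *)
Definition central n (b : T n) : Prop :=
  gleft n b = gright n b /\ forall i, xleft i n b = xright i n b.

Lemma tactn_g n (X : obs M n.+1) :
  tactn X (Bk_g K k) = tmap (act X.1 (Bk_g K k)) (tactn X.2 (Bk_g K k)).
Proof. by rewrite [tactn _ _]comp_lfunE [comul _ _]Bk_comul_g tactnSE. Qed.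

Lemma tactn_x n (X : obs M n.+1) i :
  tactn X (Bk_x K i) = tmap \1 (tactn X.2 (Bk_x K i)) +
    tmap (act X.1 (Bk_x K i)) (tactn X.2 (Bk_g K k)).
Proof.
by rewrite [tactn _ _]comp_lfunE [comul _ _]Bk_comul_x lfunDE !tactnSE act1.
Qed.

Lemma tactn0_g (X : obs M 0) : tactn X (Bk_g K k) = \1%VF.
Proof. by rewrite [tactn _ _]hunit_actE [counit _ _]Bk_counit_g scale1r. Qed.

Lemma tactn0_x (X : obs M 0) i : tactn X (Bk_x K i) = 0.
Proof. by rewrite [tactn _ _]hunit_actE [counit _ _]Bk_counit_x scale0r. Qed.

Lemma actn_gleft n (X : obs M n) (b : T n) :
  actn X (gleft n b) = (tactn X (Bk_g K k) \o actn X b)%VF.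
Proof.
elim: n X b => [|n IH] X b; first by rewrite tactn0_g comp_lfun1l id_lfunE.
move: b; apply: tens_ind => [c x y ex ey|a t].
  by rewrite !lfunPE lfun_compDr ex ey.
by rewrite tmapE !actnS tactn_g IH -tmap_comp lfunE -actM.
Qed.

Lemma actn_gright n (X : obs M n) (b : T n) :
  actn X (gright n b) = (actn X b \o tactn X (Bk_g K k))%VF.
Proof.
elim: n X b => [|n IH] X b; first by rewrite tactn0_g comp_lfun1r id_lfunE.
move: b; apply: tens_ind => [c x y ex ey|a t].
  by rewrite !lfunPE lfun_compDl ex ey.
by rewrite tmapE !actnS tactn_g IH -tmap_comp lfunE -actM.
Qed.

Lemma actn_xleft i n (X : obs M n) (b : T n) :
  actn X (xleft i n b) = (tactn X (Bk_x K i) \o actn X b)%VF.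
Proof.
elim: n X b => [|n IH] X b.
  by rewrite tactn0_x comp_lfun0l zero_lfunE lfun0E.
move: b; apply: tens_ind => [c x y ex ey|a t].
  by rewrite !lfunPE lfun_compDr ex ey.
rewrite add_lfunE lfunDE !tmapE !actnS tactn_x IH actn_gleft.
by rewrite comp_lfunDl -!tmap_comp id_lfunE lfunE -actM comp_lfun1l.
Qed.

Lemma actn_xright i n (X : obs M n) (b : T n) :
  actn X (xright i n b) = (actn X b \o tactn X (Bk_x K i))%VF.
Proof.
elim: n X b => [|n IH] X b.
  by rewrite tactn0_x comp_lfun0r zero_lfunE lfun0E.
move: b; apply: tens_ind => [c x y ex ey|a t].
  by rewrite !lfunPE lfun_compDl ex ey.
rewrite add_lfunE lfunDE !tmapE !actnS tactn_x IH actn_gright.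
by rewrite comp_lfunDr -!tmap_comp id_lfunE lfunE -actM comp_lfun1r.
Qed.

Lemma central_represents n (b : T n) :
  central b <-> exists f, represents (id_fiber H) b f.
Proof.
split=> [[bg bx]|/represents_id bC].
  apply/represents_id => X; apply: Bk_ind.
  - by move=> c x y ex ey; rewrite !lfunPE lfun_compDl lfun_compDr ex ey.
  - by rewrite tactn1 comp_lfun1l comp_lfun1r.
  - by move=> x y ex ey; rewrite tactnM comp_lfunA ex -comp_lfunA ey comp_lfunA.
  - by rewrite -actn_gleft bg actn_gright.
  - by move=> i; rewrite -actn_xleft bx actn_xright.
split=> [|i].
  have e : actn (regs H n) (gleft n b) = actn (regs H n) (gright n b).
    exact: etrans (actn_gleft _ b) (etrans (esym (bC _ _)) (esym (actn_gright _ b))).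
  by rewrite -[LHS]actn_one e actn_one.
have e : actn (regs H n) (xleft i n b) = actn (regs H n) (xright i n b).
  exact: etrans (actn_xleft i _ b) (etrans (esym (bC _ _)) (esym (actn_xright i _ b))).
by rewrite -[LHS]actn_one e actn_one.
Qed.
End Centralizer.

(** * The cobar complex *)

Section Cobar.
Local Open Scope ring_scope.
Variables (K : fieldType) (H : hopfAlgebra K).
Local Notation T := (T H).
Local Notation cmid := (cmid H).
Local Notation clast := (clast H).
Local Notation cdiff := (cdiff H).
Local Notation cmiddle := (cmiddle H).

Definition cdup n : 'Hom(tens H (T n), tens H (tens H (T n))) :=
  (tassoc H H (T n) \o tmap (comul H) \1)%VF.

(** The differential of the cofree resolution K -> B -> B ⊗ B -> ... of the trivial comodule. It is
    defined by recursion on the first factor, with signs such that the cobar differential is 1 ⊗ t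
    minus [cpath t]. *)
Fixpoint cpath n : 'Hom(T n, T n.+1) :=
  match n return 'Hom(T n, T n.+1) with
  | 0 => pureh K^o (1 : H)
  | m.+1 => cdup m - tmap \1 (cpath m)
  end.

Lemma cdupE n a (t : T n) : cdup n (pure a t) = tassoc _ _ _ (pure (comul H a) t).
Proof. by rewrite comp_lfunE tmapE id_lfunE. Qed.

Lemma cpathE n a (t : T n) :
  cpath n.+1 (pure a t) = cdup n (pure a t) - pure a (cpath n t).
Proof. by rewrite add_lfunE opp_lfunE tmapE id_lfunE. Qed.

Lemma cpath0E (c : K^o) : cpath 0 c = pure (1 : H) c.
Proof. exact: purehE. Qed.

Lemma cmid0 n : cmid n 0 = cdup n. Proof. by case: n. Qed.

Section TmapLinear.
Variables V W W' : vectType K.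
Local Notation tmap1 := (@tmap K V V W W' \1%VF).

Lemma tmap1Z c f : tmap1 (c *: f) = c *: tmap1 f.
Proof. exact: bilinZr (tmap_bilin _ _ _ _). Qed.

Lemma tmap1D f g : tmap1 (f + g) = tmap1 f + tmap1 g.
Proof. by have := (tmap_bilin V V W W').1 \1%VF 1 f g; rewrite !scale1r. Qed.

Lemma tmap1N f : tmap1 (- f) = - tmap1 f.
Proof. by rewrite -scaleN1r tmap1Z scaleN1r. Qed.

Lemma tmap1_0 : tmap1 0 = 0.
Proof. by rewrite -[0 in LHS](scale0r 0) tmap1Z scale0r. Qed.

Lemma tmap1_sum (I : finType) (F : I -> 'Hom(W, W')) :
  tmap1 (\sum_i F i) = \sum_i tmap1 (F i).
Proof. exact: bilin_sumr (tmap_bilin _ _ _ _). Qed.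
End TmapLinear.

Lemma cpath_mid n : cpath n = - cmiddle n + (-1) ^+ n *: clast n.
Proof.
elim: n => [|n IH]; first by rewrite oppr0 add0r scale1r.
have -> : cmiddle n.+1 = - cdup n - tmap \1%VF (cmiddle n).
  rewrite /cmiddle big_ord_recl expr1 scaleN1r cmid0; congr (_ + _).
  case: n {IH} => [|n]; first by rewrite big_ord0 tmap1_0 oppr0.
  rewrite tmap1_sum -sumrN; apply: eq_bigr => i _.
  by rewrite tmap1Z -scaleNr [(-1) ^+ _]exprS mulN1r.
rewrite [cpath n.+1]/= [in LHS]IH tmap1D tmap1Z tmap1N.
by rewrite !opprD !opprK exprS mulN1r scaleNr addrA.
Qed.

Lemma cdiffE n (t : T n) : cdiff n t = pure (1 : H) t - cpath n t.
Proof.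
rewrite /(cdiff n) cpath_mid exprS mulN1r scaleNr.
by rewrite !(add_lfunE, opp_lfunE) purehE opprD opprK addrA.
Qed.

Lemma T_ext n (U : vectType K) (f g : 'Hom(T n.+1, U)) :
  (forall (a : H) (t : T n), f (pure a t) = g (pure a t)) -> forall t, f t = g t.
Proof. by move=> fg; apply/lfunP; apply: tens_lfun_ext. Qed.

Lemma T_ind n (P : T n.+1 -> Prop) :
  (forall c x y, P x -> P y -> P (c *: x + y)) ->
  (forall (a : H) (t : T n), P (pure a t)) -> forall t, P t.
Proof. exact: tens_ind. Qed.

Lemma comulAE (a : H) :
  tassoc _ _ _ (tmap (comul H) \1%VF (comul H a)) = tmap \1%VF (comul H) (comul H a).
Proof. by have /lfunP/(_ a) := comulA H; rewrite !comp_lfunE. Qed.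

Lemma cdup_dup n (a : H) (t : T n) :
  cdup n.+1 (cdup n (pure a t)) = tmap \1%VF (cdup n) (cdup n (pure a t)).
Proof.
rewrite cdupE.
(* [psi] carries the spectator [t] along, so that coassociativity can be applied to [a] alone. *)
have [psi psiE] : exists psi : 'Hom(tens H (tens H H), tens H (tens H (tens H (T n)))),
    forall c s, psi (pure c s) = pure c (tassoc H H (T n) (pure s t)).
  exists (tmap \1 (tassoc H H (T n) \o rpureh _ t)) => c s.
  by rewrite tmapE id_lfunE comp_lfunE rpurehE.
transitivity (psi (tassoc _ _ _ (tmap (comul H) \1%VF (comul H a)))).
  elim/tens_ind: (comul H a) => [c x y ex ey|c d].
    by rewrite pureDl pureZl !lfunPE ex ey.
  rewrite tassocE cdupE tmapE id_lfunE.
  elim/tens_ind: (comul H c) => [r x y ex ey|u v].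
    by rewrite !pureDl !pureZl !lfunPE ex ey.
  by rewrite !tassocE psiE tassocE.
rewrite comulAE; elim/tens_ind: (comul H a) => [c x y ex ey|c d].
  by rewrite pureDl pureZl !lfunPE ex ey.
by rewrite tassocE !tmapE !id_lfunE psiE cdupE.
Qed.

Lemma cpath_path n (t : T n) : cpath n.+1 (cpath n t) = 0.
Proof.
elim: n t => [|n IH] t.
  rewrite cpath0E cpathE cdupE cpath0E comul1 -pure1 tassocE; exact: subrr.
elim/T_ind: t => [c x y ex ey|a t]; first by rewrite !lfunPE ex ey scaler0 addr0.
rewrite (cpathE a t) lfunBE cpathE IH pure0r subr0.
suff -> : cpath n.+2 (cdup n (pure a t)) = cdup n.+1 (pure a (cpath n t)).
  by rewrite subrr.
have -> : cpath n.+2 (cdup n (pure a t)) = cdup n.+1 (cdup n (pure a t)) -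
    tmap \1%VF (cpath n.+1) (cdup n (pure a t)) by rewrite add_lfunE opp_lfunE.
rewrite cdup_dup !cdupE; elim/tens_ind: (comul H a) => [c x y ex ey|c d].
  by rewrite !(pureDl, pureZl) !lfunPE -ex -ey scalerBr opprD addrACA.
by rewrite !tassocE !tmapE !id_lfunE cpathE (pureDr _ (cdup _ _)) pureNr opprD opprK addNKr.
Qed.

Lemma cdiff_diff n (t : T n) : cdiff n.+1 (cdiff n t) = 0.
Proof.
rewrite !cdiffE lfunBE cpath_path subr0 cpathE cdupE comul1 -pure1 tassocE.
by rewrite (pureDr _ (pure _ _)) pureNr opprB addrCA addrAC subrr add0r subrr.
Qed.

Definition caug n : 'Hom(T n.+1, T n) := (tlunit (T n) \o tmap (counit H) \1)%VF.

Lemma caugE n (a : H) (t : T n) : caug n (pure a t) = counit H a *: t.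
Proof. by rewrite comp_lfunE tmapE id_lfunE tlunitE. Qed.

Lemma counitlE (a : H) : tlunit H (tmap (counit H) \1%VF (comul H a)) = a.
Proof. by have /lfunP/(_ a) := counitl H; rewrite !comp_lfunE id_lfunE. Qed.

Lemma caug_dup n (a : H) (t : T n) : caug n.+1 (cdup n (pure a t)) = pure a t.
Proof.
rewrite -[in RHS](counitlE a) cdupE.
elim/tens_ind: (comul H a) => [c x y ex ey|c d].
  by rewrite !(pureDl, pureZl) !lfunPE ex ey pureDl pureZl.
by rewrite tassocE caugE tmapE id_lfunE tlunitE pureZl.
Qed.

Lemma caug_path n (t : T n.+1) :
  caug n.+1 (cpath n.+1 t) + cpath n (caug n t) = t.
Proof.
elim/T_ind: t => [c x y ex ey|a t].
  by rewrite !lfunPE -[in RHS]ex -[in RHS]ey scalerDr addrACA.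
by rewrite cpathE lfunBE caug_dup !caugE lfunZE subrK.
Qed.

End Cobar.

(** * Composable tensors *)

Section Letters.
Local Open Scope ring_scope.
Variables (K : fieldType) (H : hopfAlgebra K).
Local Notation T := (T H).
Local Notation cdiff := (cdiff H).
Local Notation cpath := (cpath H).
Local Notation cdup := (cdup H).
Local Notation caug := (caug H).

Variables (L R : bool -> 'End(H)).
Hypothesis Lproj : forall e e' a, L e (L e' a) = (e == e')%:R *: L e' a.
Hypothesis Rsum : forall a, R false a + R true a = a.
Hypothesis LR : forall e r a, L e (R r a) = R r (L e a).
(** The coproduct cuts an arrow in two: the outer letters are kept, and by [comulRL] the two new
    inner letters agree. *)
Hypothesis comulL : forall e a, tmap (L e) \1%VF (comul H a) = comul H (L e a).
Hypothesis comulR : forall e a, tmap \1%VF (R e) (comul H a) = comul H (R e a).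
Hypothesis comulRL : forall e a,
  tmap (R e) \1%VF (comul H a) = tmap \1%VF (L e) (comul H a).
Hypothesis R1 : forall e, R e 1 = (e == false)%:R *: 1.
Hypothesis L1 : forall e, L e 1 = (e == false)%:R *: 1.

Lemma pure_comb (V W : vectType K) (x : V) c (u v : W) :
  pure x (- (c *: u) - v) = - pure (c *: x) u - pure x v.
Proof. by rewrite pureDr !pureNr pureZr pureZl. Qed.

(* L and R project onto vectors with a given left or right letter; f is the
   letter in which the last factor has to end, and the empty tensor counts as
   starting in f. *)
Definition first (f : bool) n (e : bool) : 'End(T n) :=
  match n return 'End(T n) with
  | 0 => (e == f)%:R *: \1%VF
  | m.+1 => tmap (L e) \1
  end.

(** In B_k the counit sees only 1 and g, whose two letters coincide. The mismatch between such a
    factor and the next one can therefore be tested against its left letter [e]. *)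
Definition cutfirst (f : bool) n (e : bool) : 'Hom(T n.+1, T n) :=
  (caug n \o tmap (L e) (\1 - first f n e))%VF.

(* The counit is applied before the first mismatch, e being the letter in which
   the tensor is required to start. *)
Fixpoint cut (f : bool) n (e : bool) : 'Hom(T n.+1, T n) :=
  match n return 'Hom(T n.+1, T n) with
  | 0 => - cutfirst f 0 e
  | m.+1 => - cutfirst f m.+1 e - \sum_r tmap (R r \o L e) (cut f m r)
  end.

(** The projection onto the composable tensors from the letter [e] to the letter [f]. *)
Fixpoint match_proj (f : bool) n (e : bool) : 'End(T n) :=
  match n return 'End(T n) with
  | 0 => (e == f)%:R *: \1%VF
  | m.+1 => \sum_r tmap (R r \o L e) (match_proj f m r)
  end.

Lemma firstE f n e a (t : T n) : first f n.+1 e (pure a t) = pure (L e a) t.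
Proof. by rewrite tmapE id_lfunE. Qed.

Lemma cutfirstE f n e a (t : T n) :
  cutfirst f n e (pure a t) = counit H (L e a) *: (t - first f n e t).
Proof. by rewrite comp_lfunE tmapE caugE add_lfunE opp_lfunE id_lfunE. Qed.

Lemma cut0E f e a (t : T 0) :
  cut f 0 e (pure a t) = - (counit H (L e a) *: (t - first f 0 e t)).
Proof. by rewrite opp_lfunE cutfirstE. Qed.

Lemma cutE f n e a (t : T n.+1) :
  cut f n.+1 e (pure a t) = - (counit H (L e a) *: (t - first f n.+1 e t))
    - \sum_r pure (R r (L e a)) (cut f n r t).
Proof.
rewrite add_lfunE !opp_lfunE cutfirstE sum_lfunE; congr (_ - _).
by apply: eq_bigr => r _; rewrite tmapE comp_lfunE.
Qed.

Lemma match_projE f n e a (t : T n) :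
  match_proj f n.+1 e (pure a t) = \sum_r pure (R r (L e a)) (match_proj f n r t).
Proof.
by rewrite sum_lfunE; apply: eq_bigr => r _; rewrite tmapE comp_lfunE.
Qed.

Lemma first_path n e (t : T n) :
  first false n.+1 e (cpath n t) = cpath n (first false n e t).
Proof.
case: n t => [|n] t.
  by rewrite !cpath0E firstE L1 scale_lfunE id_lfunE pureZl pureZr.
elim/T_ind: t => [c x y ex ey|a t]; first by rewrite !lfunPE ex ey.
rewrite cpathE lfunBE !firstE cpathE; congr (_ - _).
rewrite !cdupE -comulL; elim/tens_ind: (comul H a) => [c x y ex ey|c d].
  by rewrite !(pureDl, pureZl) !lfunPE ex ey pureDl pureZl lfunPE.
by rewrite tmapE id_lfunE !tassocE tmapE id_lfunE.
Qed.

Lemma sumRL (V : vectType K) e (b : H) (t : V) :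
  \sum_r pure (R r (L e b)) t = pure (L e b) t.
Proof. by rewrite big_bool /= -pureDl addrC Rsum. Qed.

(** Projecting the first copy of [b] to the left letter [e] and removing it by the counit returns
    [L e b], which starts in [e], so there is no mismatch to detect. *)
Lemma cut_dup_first f n e (b : H) (t : T n) :
  cutfirst f n.+1 e (cdup n (pure b t)) = 0.
Proof.
have h s : cutfirst f n.+1 e (tassoc _ _ _ (pure s t)) =
    pure (tlunit _ (tmap (counit H) (\1 - L e)%VF (tmap (L e) \1%VF s))) t.
  elim/tens_ind: s => [c x y ex ey|c d].
    by rewrite !(pureDl, pureZl) !lfunPE ex ey pureDl pureZl.
  rewrite tassocE cutfirstE firstE !tmapE id_lfunE tlunitE pureZl.
  by rewrite add_lfunE opp_lfunE id_lfunE pureDl pureNl.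
rewrite cdupE h comulL -[(\1 - L e)%VF]comp_lfun1r.
have -> s : tlunit H (tmap (counit H) ((\1 - L e) \o \1)%VF s) =
   (\1 - L e)%VF (tlunit _ (tmap (counit H) \1%VF s)).
  elim/tens_ind: s => [c x y ex ey|c d]; first by rewrite !lfunPE ex ey.
  by rewrite !tmapE !tlunitE comp_lfun1r id_lfunE lfunZE.
rewrite counitlE add_lfunE opp_lfunE id_lfunE Lproj eqxx scale1r subrr.
exact: pure0l.
Qed.

Lemma counitrE (b : H) : trunit H (tmap \1%VF (counit H) (comul H b)) = b.
Proof. by have /lfunP/(_ b) := counitr H; rewrite !comp_lfunE id_lfunE. Qed.

(** By [comulRL], once the first leg of a coproduct has right letter [r], the second leg already has
    left letter [r]. *)
Lemma comulRLL (U : vectType K) e r (psi : 'Hom(H, U)) (b : H) :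
  tmap (R r \o L e) (psi \o L r) (comul H b) = tmap (R r \o L e) psi (comul H b).
Proof.
have cR : (R r \o L e = L e \o R r)%VF by apply/lfunP => a; rewrite !comp_lfunE LR.
have LL : (L r \o L r = L r)%VF.
  by apply/lfunP => a; rewrite comp_lfunE Lproj eqxx scale1r.
have RR (chi : 'Hom(H, U)) : tmap (L e \o R r) chi (comul H b) =
    tmap (L e) (chi \o L r) (comul H b).
  have -> : tmap (L e \o R r) chi = (tmap (L e) chi \o tmap (R r) \1)%VF.
    by rewrite -tmap_comp comp_lfun1r.
  have -> : tmap (L e) (chi \o L r) = (tmap (L e) chi \o tmap \1 (L r))%VF.
    by rewrite -tmap_comp comp_lfun1r.
  by rewrite !comp_lfunE comulRL.
by rewrite cR !RR -comp_lfunA LL.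
Qed.

Lemma RL_comul_counit e r (b : H) :
  trunit H (tmap (R r \o L e) (counit H \o L r)%VF (comul H b)) = R r (L e b).
Proof.
rewrite comulRLL.
have -> : tmap (R r \o L e) (counit H) =
    (tmap (R r \o L e) \1 \o tmap \1 (counit H))%VF.
  by rewrite -tmap_comp comp_lfun1r comp_lfun1l.
have /lfunP/(_ (tmap \1%VF (counit H) (comul H b))) := trunit_nat (R r \o L e)%VF.
by rewrite !comp_lfunE counitrE => ->.
Qed.

Lemma sum_RL_comul e r' (b : H) :
  \sum_r tmap (R r \o L e) (R r' \o L r) (comul H b) = comul H (R r' (L e b)).
Proof.
under eq_bigr do rewrite comulRLL.
rewrite -comulR -comulL; elim/tens_ind: (comul H b) => [c x y ex ey|c d].
  under eq_bigr do rewrite lfunPE; rewrite big_split -scaler_sumr /= ex ey.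
  by rewrite !lfunPE.
by under eq_bigr do rewrite tmapE comp_lfunE; rewrite sumRL !tmapE !id_lfunE.
Qed.

Lemma cut_dup0 f e (b : H) (t : T 0) : cut f 1 e (cdup 0 (pure b t)) =
  \sum_r pure (R r (L e b)) (t - first f 0 r t).
Proof.
rewrite add_lfunE !opp_lfunE cut_dup_first oppr0 add0r sum_lfunE -sumrN.
apply: eq_bigr => r _; rewrite cdupE -RL_comul_counit.
elim/tens_ind: (comul H b) => [c x y ex ey|c d].
  by rewrite !(pureDl, pureZl) !lfunPE opprD -scalerN ex ey pureDl pureZl.
by rewrite tassocE !tmapE trunitE pureZl cut0E pureNr opprK pureZr !comp_lfunE.
Qed.

(** In the first sum the second copy of [b] is removed in front of a mismatch with [t]; in the
    second the mismatch lies inside [t] or after it, and the coproduct commutes with the cut. *)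
Lemma cut_dup f n e (b : H) (t : T n.+1) : cut f n.+2 e (cdup n.+1 (pure b t)) =
  \sum_r pure (R r (L e b)) (t - first f n.+1 r t) +
  \sum_r cdup n (pure (R r (L e b)) (cut f n r t)).
Proof.
rewrite add_lfunE !opp_lfunE cut_dup_first oppr0 add0r sum_lfunE -sumrN.
have h r s : tmap (R r \o L e) (cut f n.+1 r) (tassoc _ _ _ (pure s t)) =
    - pure (trunit H (tmap (R r \o L e) (counit H \o L r)%VF s)) (t - first f n.+1 r t)
    - \sum_r' tassoc _ _ _ (pure (tmap (R r \o L e) (R r' \o L r) s) (cut f n r' t)).
  elim/tens_ind: s => [c x y ex ey|c d].
    rewrite !(pureDl, pureZl) !lfunPE ex ey !(pureDl, pureZl).
    under [in RHS]eq_bigr do rewrite lfunPE pureDl pureZl lfunPE.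
    by rewrite big_split /= -scaler_sumr !opprD !scalerDr !scalerN addrACA.
  rewrite tassocE !tmapE trunitE cutE; apply: etrans (pure_comb _ _ _ _) _.
  rewrite !comp_lfunE; congr (_ - _); rewrite (bilin_sumr _ _ (pure_bilin _ _)).
  by apply: eq_bigr => r' _; rewrite tmapE tassocE !comp_lfunE.
under eq_bigr do rewrite cdupE h RL_comul_counit opprD !opprK.
rewrite big_split /= exchange_big; congr (_ + _); apply: eq_bigr => r' _.
rewrite -lfun_sumE -(bilin_suml _ _ (pure_bilin _ _)) sum_RL_comul cdupE.
by [].
Qed.

Definition cut_path (f : bool) n (e : bool) : 'End(T n) :=
  match n return 'End(T n) with
  | 0 => (cut f 0 e \o cpath 0)%VF
  | m.+1 => (cut f m.+1 e \o cpath m.+1)%VF + (cpath m \o cut f m e)%VF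
  end.

Lemma cut_pathE n e (t : T n) :
  cut_path false n e t = first false n e t - match_proj false n e t.
Proof.
elim: n e t => [|n IH] e t.
  rewrite subrr comp_lfunE cpath0E cut0E L1 scale_lfunE id_lfunE.
  by case: e; rewrite ?scale1r ?subrr ?scaler0 ?scale0r ?lfun0E ?scale0r oppr0.
elim/T_ind: t => [c x y ex ey|b t].
  by rewrite !lfunPE ex ey scalerBr opprD addrACA.
rewrite firstE match_projE.
(* [C] collects the coproducts of [b] and [y] the removals of [b]. Both cancel between the two
   composites, and [S + E] is the homotopy formula for the tail. *)
have ab (V : zmodType) (A C S E y : V) :
    A + C - (- y - S) + (- y - (C - E)) = A + (S + E).
  rewrite !opprB opprK !addrA addrK.
  by rewrite -!addrA [C + _]addrC !addrA subrK.
have -> : cut_path false n.+1 e (pure b t) =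
    \sum_r pure (R r (L e b)) (t - first false n r t + cut_path false n r t).
  rewrite add_lfunE !comp_lfunE cpathE lfunBE cutE first_path -lfunBE -lfunZE.
  case: n t {IH} => [|n] t.
    rewrite cut_dup0 cut0E lfunNE.
    rewrite opprB opprK addrA addrK -big_split; apply: eq_bigr => r _ /=.
    by rewrite -pureDr comp_lfunE.
  rewrite cut_dup cutE lfunBE lfunNE lfun_sumE.
  under [X in _ + (_ - X)]eq_bigr do rewrite cpathE.
  rewrite [X in _ + (_ - X)]big_split /= sumrN ab -!big_split; apply: eq_bigr => r _ /=.
  by rewrite -!pureDr add_lfunE !comp_lfunE.
under eq_bigr do rewrite IH addrA subrK pureDr pureNr.
by rewrite big_split /= sumrN sumRL.
Qed.

(** The differential is 1 ⊗ t minus [cpath t]. Since 1 is a loop at the letter 1, cutting 1 ⊗ t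
    gives [first t - t] minus 1 ⊗ [cut t], which replaces the term [first t] of [cut_pathE] by
    [t]. *)
Lemma cut_diff n (t : T n.+1) :
  cut false n.+1 false (cdiff n.+1 t) + cdiff n (cut false n false t) =
  match_proj false n.+1 false t - t.
Proof.
have := cut_pathE false t; rewrite add_lfunE !comp_lfunE => h.
rewrite !cdiffE lfunBE addrACA -opprD h.
rewrite cutE L1 scale1r counit1 scale1r big_bool /= !R1 scale0r scale1r pure0l add0r.
by rewrite subrK !opprB addrC addrA subrK.
Qed.

Section Stability.
Variables c y : 'End(H).
Hypothesis L_c : forall e a, L (~~ e) (c a) = c (L e a).
Hypothesis R_c : forall e a, R (~~ e) (c a) = c (R e a).
Hypothesis L_y : forall e a, L e (y a) = y (L e a).
Hypothesis R_y : forall e a, R (~~ e) (y a) = y (R e a).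
Hypothesis counit_c : forall a, counit H (c a) = counit H a.
Hypothesis counit_y : forall a, counit H (y a) = 0.

Lemma first_gop f n e (t : T n) :
  first (~~ f) n (~~ e) (gop c n t) = gop c n (first f n e t).
Proof.
case: n t => [|n] t; first by rewrite !id_lfunE !scale_lfunE !id_lfunE; case: e f => [] [].
elim/T_ind: t => [r u v eu ev|a t]; first by rewrite !lfunPE eu ev.
by rewrite gopE !firstE gopE L_c.
Qed.

Lemma first_xop f n e (t : T n) :
  first (~~ f) n e (xop c y n t) = xop c y n (first f n e t).
Proof.
case: n t => [|n] t; first by rewrite !zero_lfunE lfun0E.
elim/T_ind: t => [r u v eu ev|a t]; first by rewrite !lfunPE eu ev.
rewrite xopE lfunDE !firstE xopE.
by congr (_ + pure _ _); apply: L_y.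
Qed.

Lemma cut_gop f n e (t : T n.+1) :
  cut (~~ f) n (~~ e) (gop c n.+1 t) = gop c n (cut f n e t).
Proof.
elim: n e t => [|n IH] e t.
  suff : (cut (~~ f) 0 (~~ e) \o gop c 1 = gop c 0 \o cut f 0 e)%VF.
    by move/lfunP/(_ t); rewrite !comp_lfunE.
  apply/lfunP; apply: T_ext => a s; rewrite !comp_lfunE.
  rewrite gopE !cut0E lfunNE lfunZE lfunBE first_gop.
  by congr (- (_ *: _)); rewrite L_c; apply: counit_c.
elim/T_ind: t => [r u v eu ev|a t]; first by rewrite !lfunPE eu ev.
rewrite gopE !cutE lfunBE lfunNE lfunZE lfunBE first_gop; congr (_ - _).
  by congr (- (_ *: _)); rewrite L_c; apply: counit_c.
rewrite lfun_sumE !big_bool /= addrC L_c; congr (_ + _); rewrite gopE.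
  by rewrite -(R_c true) -(IH true).
by rewrite -(R_c false) -(IH false).
Qed.

(** Factors before y are untouched, y moves only its right letter, and c moves both letters of each
    later factor: mismatches stay in place and only the final letter changes, whence the parameter
    [f]. The counit kills the factor that carries y, so that factor is never the one removed. *)
Lemma cut_xop f n e (t : T n.+1) :
  cut (~~ f) n e (xop c y n.+1 t) = xop c y n (cut f n e t).
Proof.
elim: n e t => [|n IH] e t.
  suff : (cut (~~ f) 0 e \o xop c y 1 = xop c y 0 \o cut f 0 e)%VF.
    by move/lfunP/(_ t); rewrite !comp_lfunE.
  apply/lfunP; apply: T_ext => a s; rewrite !comp_lfunE.
  rewrite xopE zero_lfunE pure0r add0r cut0E L_y.
  by rewrite counit_y scale0r oppr0 zero_lfunE.
elim/T_ind: t => [r u v eu ev|a t]; first by rewrite !lfunPE eu ev.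
rewrite xopE lfunDE !cutE L_y counit_y scale0r oppr0 sub0r first_xop.
rewrite lfunBE lfunNE lfunZE lfunBE -addrA -opprD; congr (_ - _).
rewrite lfun_sumE !big_bool /= !xopE !IH.
have [yt yf] := (R_y true (L e a), R_y false (L e a)); rewrite /= in yt yf.
have [ct cf] := (cut_gop f true t, cut_gop f false t); rewrite /= in ct cf.
by rewrite yt yf ct cf [X in _ + X = _]addrC addrACA.
Qed.
End Stability.

Section Supercentral.
Variables c y c' y' : 'End(H).
Hypothesis cc' : forall e r a,
  c (R r (L e a)) = (-1) ^+ (e (+) r) *: c' (R r (L e a)).
Hypothesis yy' : forall e r a, y (R r (L e a)) = (-1) ^+ r *: y' (R r (L e a)).

(** Each factor contributes the product of its two letter signs; along a composable tensor the inner
    letters cancel in pairs. *)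
Lemma gop_match f n e (t : T n) : gop c n (match_proj f n e t) =
  (-1) ^+ (e (+) f) *: gop c' n (match_proj f n e t).
Proof.
elim: n e t => [|n IH] e t.
  rewrite !id_lfunE scale_lfunE id_lfunE scalerA.
  by case: e f => [] []; rewrite /= ?mulr0 ?scale0r // expr0 mul1r.
elim/T_ind: t => [r u v eu ev|a t].
  by rewrite !lfunPE eu ev scalerDr !scalerA mulrC.
rewrite match_projE !lfun_sumE scaler_sumr; apply: eq_bigr => r _.
rewrite !gopE cc' IH pureZl pureZr scalerA; congr (_ *: _).
by rewrite -signr_addb addbA addbK.
Qed.

(** The factor with y contributes the sign of its right letter r, the later factors (-1)^(r + f). So
    r cancels, and the sign is the same for every position of y. *)
Lemma xop_match f n e (t : T n) : xop c y n (match_proj f n e t) =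
  (-1) ^+ f *: xop c' y' n (match_proj f n e t).
Proof.
elim: n e t => [|n IH] e t; first by rewrite !zero_lfunE scaler0.
elim/T_ind: t => [r u v eu ev|a t].
  by rewrite !lfunPE eu ev scalerDr !scalerA mulrC.
rewrite match_projE !lfun_sumE scaler_sumr; apply: eq_bigr => r _.
rewrite !xopE IH gop_match yy' pureZl !pureZr scalerDr scalerA; congr (_ + _ *: _).
by rewrite -signr_addb addbA addbb.
Qed.
End Supercentral.

End Letters.

(** * Eigenprojections of involutions *)

Section SignProjection.
Local Open Scope ring_scope.
Variables (K : fieldType) (V : vectType K) (s : 'End(V)).
Hypothesis two : 2%:R != 0 :> K.
Hypothesis ss : forall v, s (s v) = v.

Definition sproj (e : bool) : 'End(V) := 2%:R^-1 *: (\1%VF + (-1) ^+ e *: s).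

Lemma sprojE e v : sproj e v = 2%:R^-1 *: (v + (-1) ^+ e *: s v).
Proof. by rewrite scale_lfunE add_lfunE scale_lfunE id_lfunE. Qed.

Lemma s_sproj e v : s (sproj e v) = (-1) ^+ e *: sproj e v.
Proof.
rewrite sprojE lfunZE lfunDE lfunZE ss [RHS]scalerA mulrC -[RHS]scalerA; congr (_ *: _).
by rewrite scalerDr scalerA -expr2 sqrr_sign scale1r addrC.
Qed.

Lemma sproj_proj e e' v : sproj e (sproj e' v) = (e == e')%:R *: sproj e' v.
Proof.
rewrite sprojE s_sproj scalerA -[X in X + _]scale1r -scalerDl scalerA; congr (_ *: _).
case: e e' => [] []; rewrite /= ?expr0 ?expr1 ?mulrNN ?mulr1 ?mul1r ?mulN1r ?subrr ?mulr0 //;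
by rewrite -[1 + 1]/(2%:R) mulVf.
Qed.

Lemma sproj_sum v : sproj false v + sproj true v = v.
Proof.
rewrite !sprojE -scalerDr /= expr0 expr1 scale1r scaleN1r addrACA subrr addr0.
by rewrite -mulr2n -scaler_nat scalerA mulVf // scale1r.
Qed.

Lemma sproj_comm (d e : bool) (f : 'End(V)) :
  (forall v, s (f v) = (-1) ^+ d *: f (s v)) ->
  forall v, sproj (e (+) d) (f v) = f (sproj e v).
Proof.
move=> sf v; rewrite !sprojE sf lfunZE lfunDE lfunZE scalerA; congr (_ *: (_ + _ *: _)).
by rewrite signr_addb -mulrA -expr2 sqrr_sign mulr1.
Qed.

Lemma sproj_fixed e v : s v = v -> sproj e v = (e == false)%:R *: v.
Proof.
move=> sv; rewrite sprojE sv; case: e => /=.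
  by rewrite expr1 scaleN1r subrr scaler0 scale0r.
by rewrite expr0 !scale1r -mulr2n -scaler_nat scalerA mulVf // scale1r.
Qed.
End SignProjection.

Section SignProjectionPairs.
Local Open Scope ring_scope.

Lemma sproj_commute (K : fieldType) (V : vectType K) (s s' : 'End(V)) e r :
  (forall v, s (s' v) = s' (s v)) ->
  forall v, sproj s e (sproj s' r v) = sproj s' r (sproj s e v).
Proof.
move=> ss v; have c : s (sproj s' r v) = sproj s' r (s v).
  by rewrite !sprojE lfunZE lfunDE lfunZE ss.
by rewrite ![sproj s e _]sprojE c lfunZE lfunDE lfunZE.
Qed.

Lemma tmap_sprojl (K : fieldType) (V W : vectType K) (s : 'End(V)) e
    (t : tens V W) : tmap (sproj s e) \1%VF t = sproj (tmap s \1) e t.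
Proof.
elim/tens_ind: t => [c x y ex ey|v w]; first by rewrite !lfunPE ex ey.
by rewrite sprojE !tmapE id_lfunE sprojE pureZl pureDl pureZl.
Qed.

Lemma tmap_sprojr (K : fieldType) (V W : vectType K) (s : 'End(W)) e
    (t : tens V W) : tmap \1%VF (sproj s e) t = sproj (tmap \1 s) e t.
Proof.
elim/tens_ind: t => [c x y ex ey|v w]; first by rewrite !lfunPE ex ey.
by rewrite sprojE !tmapE id_lfunE sprojE pureZr pureDr pureZr.
Qed.

End SignProjectionPairs.

(** * The letters of B_k *)

Section BkLetters.
Local Open Scope ring_scope.
Variables (K : fieldType) (k : nat).
Hypothesis two : 2%:R != 0 :> K.
Local Notation B := (Bk K k).
Local Notation g := (Bk_g K k).
Local Notation x := (@Bk_x K k).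

Lemma tau_def : {f : 'End(B) | [/\ {morph f : a b / a * b}, f 1 = 1,
  f g = - g & forall i, f (x i) = x i]}.
Proof.
exists (Bk_lift (- g) x); split; [|exact: Bk_lift1|exact: Bk_lift_g|exact: Bk_lift_x].
apply: Bk_liftM => [|i|i|i j]; rewrite ?mulrNN ?Bk_gg ?Bk_xx //; last exact: Bk_xxN.
by rewrite mulNr Bk_gx mulrN.
Qed.

Lemma rho_def : {f : 'End(B) | [/\ {morph f : a b / a * b}, f 1 = 1,
  f g = - g & forall i, f (x i) = - x i]}.
Proof.
exists (Bk_lift (- g) (fun i => - x i)).
split; [|exact: Bk_lift1|exact: Bk_lift_g|by move=> i; rewrite Bk_lift_x].
by apply: Bk_liftM => [|i|i|i j]; rewrite ?mulrNN ?Bk_gg ?Bk_xx ?Bk_gx //; exact: Bk_xxN.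
Qed.

(* On g^e x_I, tau is the sign (-1)^e of the left letter and rho the sign
   (-1)^(e + |I|) of the right letter. *)
Definition tau : 'End(B) := sval tau_def.
Definition rho : 'End(B) := sval rho_def.

Lemma tauM : {morph tau : a b / a * b}. Proof. by case: (svalP tau_def). Qed.
Lemma tau1 : tau 1 = 1. Proof. by case: (svalP tau_def). Qed.
Lemma tau_g : tau g = - g. Proof. by case: (svalP tau_def). Qed.
Lemma tau_x i : tau (x i) = x i. Proof. by case: (svalP tau_def). Qed.
Lemma rhoM : {morph rho : a b / a * b}. Proof. by case: (svalP rho_def). Qed.
Lemma rho1 : rho 1 = 1. Proof. by case: (svalP rho_def). Qed.
Lemma rho_g : rho g = - g. Proof. by case: (svalP rho_def). Qed.
Lemma rho_x i : rho (x i) = - x i. Proof. by case: (svalP rho_def). Qed.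

Lemma tau_tau a : tau (tau a) = a.
Proof.
suff /lfunP/(_ a) : (tau \o tau = \1)%VF by rewrite comp_lfunE id_lfunE.
apply: Bk_hom_ext => [|a1 a2|a1 a2||i]; rewrite ?comp_lfunE ?id_lfunE ?tauM //.
- by rewrite !tau1.
- by rewrite tau_g lfunNE tau_g opprK.
- by rewrite !tau_x.
Qed.

Lemma rho_rho a : rho (rho a) = a.
Proof.
suff /lfunP/(_ a) : (rho \o rho = \1)%VF by rewrite comp_lfunE id_lfunE.
apply: Bk_hom_ext => [|a1 a2|a1 a2||i]; rewrite ?comp_lfunE ?id_lfunE ?rhoM //.
- by rewrite !rho1.
- by rewrite rho_g lfunNE rho_g opprK.
- by rewrite rho_x lfunNE rho_x opprK.
Qed.

Lemma tau_rho a : tau (rho a) = rho (tau a).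
Proof.
suff /lfunP/(_ a) : (tau \o rho = rho \o tau)%VF by rewrite !comp_lfunE.
apply: Bk_hom_ext => [|a1 a2|a1 a2||i]; rewrite ?comp_lfunE ?rhoM ?tauM ?rhoM //.
- by rewrite tau1 !rho1 tau1.
- by rewrite tau_g rho_g !lfunNE tau_g rho_g.
- by rewrite tau_x rho_x lfunNE tau_x.
Qed.

Let idM : {morph (\1%VF : 'End(B)) : a b / a * b}.
Proof. by move=> a b; rewrite !id_lfunE. Qed.

Lemma comul_tau a : tmap tau \1%VF (Bk_comul K k a) = Bk_comul K k (tau a).
Proof.
suff /lfunP/(_ a) : (tmap tau \1 \o Bk_comul K k = Bk_comul K k \o tau)%VF.
  by rewrite !comp_lfunE.
apply: Bk_hom_ext => [|a1 a2|a1 a2||i]; rewrite ?comp_lfunE ?tauM ?Bk_comulM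
  ?(tmapM tauM idM) //.
- by rewrite tau1 Bk_comul1 -pure1 tmapE tau1 id_lfunE.
- by rewrite Bk_comul_g tmapE tau_g lfunNE Bk_comul_g id_lfunE pureNl.
- by rewrite tau_x Bk_comul_x lfunDE !tmapE !id_lfunE tau1 tau_x.
Qed.

Lemma comul_rho a : tmap \1%VF rho (Bk_comul K k a) = Bk_comul K k (rho a).
Proof.
suff /lfunP/(_ a) : (tmap \1 rho \o Bk_comul K k = Bk_comul K k \o rho)%VF.
  by rewrite !comp_lfunE.
apply: Bk_hom_ext => [|a1 a2|a1 a2||i]; rewrite ?comp_lfunE ?rhoM ?Bk_comulM
  ?(tmapM idM rhoM) //.
- by rewrite rho1 Bk_comul1 -pure1 tmapE rho1 id_lfunE.
- by rewrite Bk_comul_g tmapE rho_g lfunNE Bk_comul_g id_lfunE pureNr.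
- by rewrite rho_x lfunNE Bk_comul_x lfunDE !tmapE !id_lfunE rho_g rho_x !pureNr opprD.
Qed.

Lemma comul_rho_tau a :
  tmap rho \1%VF (Bk_comul K k a) = tmap \1%VF tau (Bk_comul K k a).
Proof.
suff /lfunP/(_ a) : (tmap rho \1 \o Bk_comul K k = tmap \1 tau \o Bk_comul K k)%VF.
  by rewrite !comp_lfunE.
apply: Bk_hom_ext => [|a1 a2|a1 a2||i]; rewrite ?comp_lfunE ?Bk_comulM
  ?(tmapM idM tauM) ?(tmapM rhoM idM) //.
- by rewrite Bk_comul1 -pure1 !tmapE rho1 tau1 !id_lfunE.
- by rewrite Bk_comul_g !tmapE rho_g tau_g !id_lfunE pureNl pureNr.
- by rewrite Bk_comul_x !lfunDE !tmapE !id_lfunE rho1 rho_x tau_g tau_x pureNl pureNr.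
Qed.

Definition lproj : bool -> 'End(B) := sproj tau.
Definition rproj : bool -> 'End(B) := sproj rho.

Lemma lproj_rproj e r a : lproj e (rproj r a) = rproj r (lproj e a).
Proof. exact: (sproj_commute _ _ tau_rho). Qed.

Lemma comul_lproj e a : tmap (lproj e) \1%VF (Bk_comul K k a) = Bk_comul K k (lproj e a).
Proof. by rewrite tmap_sprojl !sprojE comul_tau lfunZE lfunDE lfunZE. Qed.

Lemma comul_rproj e a : tmap \1%VF (rproj e) (Bk_comul K k a) = Bk_comul K k (rproj e a).
Proof. by rewrite tmap_sprojr !sprojE comul_rho lfunZE lfunDE lfunZE. Qed.

Lemma comul_rproj_lproj e a :
  tmap (rproj e) \1%VF (Bk_comul K k a) = tmap \1%VF (lproj e) (Bk_comul K k a).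
Proof. by rewrite tmap_sprojl tmap_sprojr !sprojE comul_rho_tau. Qed.

Lemma lproj1 e : lproj e 1 = (e == false)%:R *: 1.
Proof. exact: (sproj_fixed two e tau1). Qed.

Lemma rproj1 e : rproj e 1 = (e == false)%:R *: 1.
Proof. exact: (sproj_fixed two e rho1). Qed.

Lemma lproj_proj e e' a : lproj e (lproj e' a) = (e == e')%:R *: lproj e' a.
Proof. exact: sproj_proj tau_tau _ _ _. Qed.

Lemma rproj_sum a : rproj false a + rproj true a = a.
Proof. exact: sproj_sum. Qed.

Local Notation H := (Bk_hopf K k).
Local Notation T := (T H).
Local Notation cut := (cut (H := H) lproj rproj).
Local Notation match_proj := (match_proj (H := H) lproj rproj).

Lemma amullE (a b : B) : amull a b = a * b. Proof. by rewrite lfunE. Qed.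
Lemma amulrE (a b : B) : amulr a b = b * a. Proof. by rewrite lfunE. Qed.

(** Passing x_i through g^e x_I costs (-1)^(e + |I|), the sign of the right letter. Passing g costs
    (-1)^|I|, the product of both letter signs. These two rules make closed composable tensors
    central. *)
Lemma mulr_rho i a : a * x i = x i * rho a.
Proof.
elim/Bk_ind: a => [r u v eu ev||u v eu ev||j].
- by rewrite mulrDl -scalerAl lfunPE mulrDr -scalerAr eu ev.
- by rewrite rho1 mul1r mulr1.
- by rewrite rhoM -mulrA ev mulrA eu mulrA.
- by rewrite rho_g Bk_gx mulrN.
- by rewrite rho_x mulrN Bk_xxN.
Qed.

Lemma mulr_tau_rho a : a * g = g * rho (tau a).
Proof.
elim/Bk_ind: a => [r u v eu ev||u v eu ev||j].
- by rewrite mulrDl -scalerAl !lfunPE mulrDr -scalerAr eu ev.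
- by rewrite tau1 rho1 mul1r mulr1.
- by rewrite tauM rhoM -mulrA ev mulrA eu mulrA.
- by rewrite tau_g lfunNE rho_g opprK.
- by rewrite tau_x rho_x mulrN Bk_gx opprK.
Qed.

Lemma lproj_gl e a : lproj (~~ e) (amull g a) = amull g (lproj e a).
Proof.
rewrite -addbT; apply: sproj_comm => b.
by rewrite !amullE tauM tau_g mulNr scaleN1r.
Qed.

Lemma lproj_gr e a : lproj (~~ e) (amulr g a) = amulr g (lproj e a).
Proof.
rewrite -addbT; apply: sproj_comm => b.
by rewrite !amulrE tauM tau_g mulrN scaleN1r.
Qed.

Lemma rproj_gl e a : rproj (~~ e) (amull g a) = amull g (rproj e a).
Proof.
rewrite -addbT; apply: sproj_comm => b.
by rewrite !amullE rhoM rho_g mulNr scaleN1r.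
Qed.

Lemma rproj_gr e a : rproj (~~ e) (amulr g a) = amulr g (rproj e a).
Proof.
rewrite -addbT; apply: sproj_comm => b.
by rewrite !amulrE rhoM rho_g mulrN scaleN1r.
Qed.

Lemma lproj_xl i e a : lproj e (amull (x i) a) = amull (x i) (lproj e a).
Proof.
rewrite -{1}[e]addbF; apply: sproj_comm => b.
by rewrite !amullE tauM tau_x scale1r.
Qed.

Lemma lproj_xr i e a : lproj e (amulr (x i) a) = amulr (x i) (lproj e a).
Proof.
rewrite -{1}[e]addbF; apply: sproj_comm => b.
by rewrite !amulrE tauM tau_x scale1r.
Qed.

Lemma rproj_xl i e a : rproj (~~ e) (amull (x i) a) = amull (x i) (rproj e a).
Proof.
rewrite -addbT; apply: sproj_comm => b.
by rewrite !amullE rhoM rho_x mulNr scaleN1r.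
Qed.

Lemma rproj_xr i e a : rproj (~~ e) (amulr (x i) a) = amulr (x i) (rproj e a).
Proof.
rewrite -addbT; apply: sproj_comm => b.
by rewrite !amulrE rhoM rho_x mulrN scaleN1r.
Qed.

Lemma counit_gl a : Bk_counit K k (amull g a) = Bk_counit K k a.
Proof. by rewrite amullE Bk_counitM Bk_counit_g mul1r. Qed.

Lemma counit_gr a : Bk_counit K k (amulr g a) = Bk_counit K k a.
Proof. by rewrite amulrE Bk_counitM Bk_counit_g mulr1. Qed.

Lemma counit_xl i a : Bk_counit K k (amull (x i) a) = 0.
Proof. by rewrite amullE Bk_counitM Bk_counit_x mul0r. Qed.

Lemma counit_xr i a : Bk_counit K k (amulr (x i) a) = 0.
Proof. by rewrite amulrE Bk_counitM Bk_counit_x mulr0. Qed.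

Lemma rho_rproj r a : rho (rproj r a) = (-1) ^+ r *: rproj r a.
Proof. exact: (s_sproj rho_rho). Qed.

Lemma tau_lproj e a : tau (lproj e a) = (-1) ^+ e *: lproj e a.
Proof. exact: (s_sproj tau_tau). Qed.

Lemma x_supercentral i e r a : amull (x i) (rproj r (lproj e a)) =
  (-1) ^+ r *: amulr (x i) (rproj r (lproj e a)).
Proof.
rewrite amullE amulrE mulr_rho rho_rproj -scalerAr scalerA -expr2 sqrr_sign.
by rewrite scale1r.
Qed.

Lemma g_supercentral e r a : amull g (rproj r (lproj e a)) =
  (-1) ^+ (e (+) r) *: amulr g (rproj r (lproj e a)).
Proof.
rewrite amullE amulrE mulr_tau_rho -tau_rho rho_rproj -lproj_rproj lfunZE tau_lproj.
rewrite scalerA -signr_addb addbC -scalerAr scalerA -expr2 sqrr_sign.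
by rewrite scale1r.
Qed.

Lemma central_cut n (t : T n.+1) : central t -> central (cut false n false t).
Proof.
move=> [tg tx]; split=> [|i].
  rewrite -(cut_gop (H := H) lproj_gl rproj_gl counit_gl) tg.
  by rewrite (cut_gop (H := H) lproj_gr rproj_gr counit_gr).
rewrite -(cut_xop (H := H) lproj_gl rproj_gl (lproj_xl i) (rproj_xl i) counit_gl (counit_xl i)) tx.
by rewrite (cut_xop (H := H) lproj_gr rproj_gr (lproj_xr i) (rproj_xr i) counit_gr (counit_xr i)).
Qed.

Lemma central_match n (t : T n) : central (match_proj false n false t).
Proof.
split=> [|i].
  by rewrite (gop_match (H := H) g_supercentral) scale1r.
by rewrite (xop_match (H := H) g_supercentral (x_supercentral i)) scale1r.
Qed.

Lemma cut_cdiff n (t : T n.+1) :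
  cut false n.+1 false (cdiff H n.+1 t) + cdiff H n (cut false n false t) =
  match_proj false n.+1 false t - t.
Proof.
exact: (cut_diff (H := H) lproj_proj rproj_sum lproj_rproj comul_lproj comul_rproj
  comul_rproj_lproj rproj1 lproj1).
Qed.

End BkLetters.

(** * Comparing dimensions of quotients *)

Section Transfer.
Local Open Scope ring_scope.
Variable K : fieldType.

(** A linear relation that is total on both sides and matches boundaries with boundaries induces an
    isomorphism of the quotients, without a choice of representatives. *)
Lemma qdim_corr (V V' : lmodType K) (Z B : V -> Prop) (Z' B' : V' -> Prop)
    (Rel : V -> V' -> Prop) d :
  (forall a x x' y y', Rel x x' -> Rel y y' -> Rel (a *: x + y) (a *: x' + y')) ->
  Rel 0 0 ->
  (forall z, Z z -> exists z', Rel z z') ->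
  (forall z', Z' z' -> exists z, Rel z z') ->
  (forall z z', Rel z z' -> Z' z') -> (forall z z', Rel z z' -> Z z) ->
  (forall z z', Rel z z' -> B z <-> B' z') ->
  qdim Z B d -> qdim Z' B' d.
Proof.
move=> RD R0 ZR RZ RZ' RZ0 RB [c [cZ cG cF]].
have /boolp.choice[c' cc'] : forall i, exists z', Rel (c i) z'.
  by move=> i; apply: ZR.
have RS (a : 'I_d -> K) : Rel (\sum_i a i *: c i) (\sum_i a i *: c' i).
  elim: (index_enum _) => [|i r IH]; first by rewrite !big_nil.
  by rewrite !big_cons; apply: RD.
exists c'; split=> [i|z' Zz'|a].
- exact: RZ' (cc' i).
- have [z zz'] := RZ _ Zz'; have [a za] := cG z (RZ0 _ _ zz').
  have := RD (-1) _ _ _ _ (RS a) zz'; rewrite !scaleN1r addrC [- _ + z']addrC.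
  by exists a; apply/(RB (z - \sum_i a i *: c i)).
by move/(RB _ _ (RS a))/cF.
Qed.

(** The map [p] into the subcomplex is homotopic to the identity through [s], which preserves the
    subcomplex. In positive degrees the relation is that of being cohomologous in the large
    complex. *)
Lemma qdim_sub (H : hopfAlgebra K) (C : forall n, T H n -> Prop)
    (p : forall n, 'End(T H n)) (s : forall n, 'Hom(T H n.+1, T H n)) n d :
  (forall n a x y, C n x -> C n y -> C n (a *: x + y)) ->
  (forall t, C 0 t) -> (forall n t, C n.+1 (p n.+1 t)) ->
  (forall n t, C n.+1 t -> C n (s n t)) ->
  (forall n t, s n.+1 (cdiff H n.+1 t) + cdiff H n (s n t) = p n.+1 t - t) ->
  qdim (@ccocycle K H (fun _ _ => True) n)
       (@ccoboundary K H (fun _ _ => True) n) d ->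
  qdim (@ccocycle K H C n) (@ccoboundary K H C n) d.
Proof.
move=> CD C0 Cp Cs sp.
case: n => [|n].
  apply: (qdim_corr (Rel := fun z z' => z = z' /\ cdiff H 0 z = 0)).
  - by move=> a x x' y y' [-> ex] [-> ey]; rewrite lfunPE ex ey scaler0 addr0.
  - by rewrite lfun0E.
  - by move=> z [_ Zz]; exists z.
  - by move=> z [_ Zz]; exists z.
  - by move=> z z' [<- Zz].
  - by move=> z z' [].
  - by move=> z z' [<-].
have Cz m : C m 0.
  case: m => [|m]; first exact: C0.
  by have := Cp m 0; rewrite lfun0E.
apply: (qdim_corr (Rel := fun z z' => [/\ cdiff H _ z = 0, C n.+1 z',
   cdiff H _ z' = 0 & exists w, z - z' = cdiff H n w])).
- move=> a x x' y y' [ex Cx ex' [w ew]] [ey Cy ey' [v ev]].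
  split; [| exact: CD | |]; first by rewrite lfunPE ex ey scaler0 addr0.
    by rewrite lfunPE ex' ey' scaler0 addr0.
  by exists (a *: w + v); rewrite lfunPE -ew -ev scalerBr opprD addrACA.
- by split; rewrite ?lfun0E //; exists 0; rewrite lfun0E subrr.
- move=> z [_ Dz]; exists (p n.+1 z); have := sp n z; rewrite Dz lfun0E add0r => e.
  have pE : p n.+1 z = cdiff H n (s n z) + z by rewrite e subrK.
  split=> //; first by rewrite pE lfunDE cdiff_diff Dz addr0.
  by exists (- s n z); rewrite lfunNE e opprB.
- move=> z [cz Dz]; exists z; split=> //; by exists 0; rewrite lfun0E subrr.
- by move=> z z' [].
- by move=> z z' [].
move=> z z' [Dz cz' Dz' [w ew]]; split=> [[y _ ey]|[y _ ey]]; last first.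
  by exists (w + y) => //; rewrite lfunDE -ew -ey subrK.
have {y ey}[v ev] : exists v, z' = cdiff H n v.
  by exists (y - w); rewrite lfunBE -ew -ey opprB addrC subrK.
case: n w z z' v {Dz Dz' ew} cz' ev => [|n] w z z' v cz' ev; first by exists v.
(* When z' is the differential of v, [p v - s z'] equals v plus an exact term: it is a primitive of
   z' lying in the subcomplex. *)
have e : p n.+1 v = s n.+1 z' + cdiff H n (s n v) + v by rewrite ev sp subrK.
exists (p n.+1 v - s n.+1 z').
  by rewrite addrC -scaleN1r; apply: CD; [apply: Cs | apply: Cp].
by rewrite e addrAC [_ + cdiff H n _]addrC addrK lfunDE cdiff_diff add0r.
Qed.

Lemma central_lin k n a (t u : T (Bk_hopf K k) n) :
  central t -> central u -> central (a *: t + u).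
Proof. by move=> [tg tx] [ug ux]; split=> [|i]; rewrite !lfunPE ?tg ?tx ?ug ?ux. Qed.

Lemma qdim_central k n d : 2%:R != 0 :> K ->
  qdim (@ccocycle K (Bk_hopf K k) (fun _ _ => True) n)
       (@ccoboundary K (Bk_hopf K k) (fun _ _ => True) n) d ->
  qdim (@ccocycle K (Bk_hopf K k) (@central K k) n)
       (@ccoboundary K (Bk_hopf K k) (@central K k) n) d.
Proof.
move=> two; pose L := @lproj K k; pose R := @rproj K k.
apply: (@qdim_sub (Bk_hopf K k) (@central K k)
  (fun m => match_proj (H := Bk_hopf K k) L R false m false)
  (fun m => cut (H := Bk_hopf K k) L R false m false)).
- exact: central_lin.
- by split.
- by move=> m t; exact: central_match.
- by move=> m t; exact: central_cut.
- by move=> m t; exact: cut_cdiff.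
Qed.

End Transfer.

(** * The Koszul double complex *)

Section Koszul.
Local Open Scope ring_scope.
Variables (K : fieldType) (k : nat).
Local Notation B := (Bk K k).
Local Notation g := (Bk_g K k).
Local Notation x := (@Bk_x K k).
Local Notation Delta := (Bk_comul K k).
Local Notation eps := (Bk_counit K k).
Local Notation tau := (tau K k).

Section Functional.
Variable i : 'I_k.
Let G : 'M[K]_2 := delta_mx 0 0 - delta_mx 1 1.
Let X j : 'M[K]_2 := (i == j)%:R *: delta_mx 1 0.

(* The matrix coefficient (1, 0) of this representation is the skew-primitive
   functional dual to x_i; contracting the left factor of the coproduct with it
   gives a tau-derivation. *)
Definition drep : 'Hom(B, 'M[K]_2) := Bk_lift G X.

Let m2E (M N : 'M[K]_2) a b : (M * N) a b = M a 0 * N 0 b + M a 1 * N 1 b.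
Proof.
rewrite mxE !big_ord_recl big_ord0 addr0; congr (M _ _ * N _ _ + M _ _ * N _ _);
exact: val_inj.
Qed.

Let drep_rel : [/\ G * G = 1, forall j, G * X j = - (X j * G),
  forall j, X j * X j = 0 & forall j l, X j * X l = - (X l * X j)].
Proof.
have XX j l : X j * X l = 0.
  by rewrite /X -scalerAl -scalerAr -[_ * _]/(_ *m _) mul_delta_mx_0 // !scaler0.
split=> [|j|j|j l]; rewrite ?XX ?oppr0 //.
  apply/matrixP => a b; rewrite !m2E !mxE.
  by case: a => [] [|[|//]] ?; case: b => [] [|[|//]] ? /=;
    rewrite ?(subr0, sub0r, oppr0, opprK, addr0, add0r, mulr0, mul0r, mulrN, mulr1, mulNr,
      mul1r, opprK).
apply/matrixP => a b; rewrite [RHS]mxE !m2E !mxE.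
by case: a => [] [|[|//]] ?; case: b => [] [|[|//]] ? /=;
  rewrite ?(subr0, sub0r, oppr0, opprK, addr0, add0r, mulr0, mul0r, mulrN, mulr1, mulNr,
    mul1r).
Qed.

Let drepM a b : drep (a * b) = drep a * drep b.
Proof. by case: drep_rel => *; apply: Bk_liftM. Qed.
Let drep1 : drep 1 = 1. Proof. exact: Bk_lift1. Qed.
Let drep_g : drep g = G. Proof. exact: Bk_lift_g. Qed.
Let drep_x j : drep (x j) = X j. Proof. exact: Bk_lift_x. Qed.

Let drep01 a : drep a 0 1 = 0.
Proof.
elim/Bk_ind: a => [r u v eu ev||u v eu ev||j].
- by rewrite lfunPE !mxE eu ev mulr0 addr0.
- by rewrite drep1 mxE.
- by rewrite drepM m2E eu ev mulr0 mul0r addr0.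
- by rewrite drep_g !mxE subr0.
- by rewrite drep_x !mxE mulr0.
Qed.

Let drep00 a : drep a 0 0 = eps a.
Proof.
elim/Bk_ind: a => [r u v eu ev||u v eu ev||j].
- by rewrite !lfunPE !mxE eu ev.
- by rewrite drep1 mxE Bk_counit1.
- by rewrite drepM m2E eu ev drep01 mul0r addr0 Bk_counitM.
- by rewrite drep_g !mxE subr0 Bk_counit_g.
- by rewrite drep_x !mxE mulr0 Bk_counit_x.
Qed.

Let drep11 a : drep a 1 1 = eps (tau a).
Proof.
elim/Bk_ind: a => [r u v eu ev||u v eu ev||j].
- by rewrite !lfunPE !mxE eu ev.
- by rewrite drep1 tau1 mxE Bk_counit1.
- by rewrite drepM m2E eu ev drep01 mulr0 add0r tauM Bk_counitM.
- by rewrite drep_g !mxE sub0r tau_g lfunNE Bk_counit_g.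
- by rewrite drep_x !mxE mulr0 tau_x Bk_counit_x.
Qed.

Let dfun (a : B) : K^o := drep a 1 0.
Let dfun_linear : linear dfun.
Proof. by move=> r u v; rewrite /dfun lfunPE !mxE. Qed.
Let dlin : {linear B -> K^o} := HB.pack_for {linear B -> K^o} dfun
  (GRing.isSemilinear.Build K B K^o _ dfun (GRing.semilinear_linear dfun_linear)).
Let dlt : 'Hom(B, K^o) := linfun dlin.
Let dltE a : dlt a = drep a 1 0. Proof. exact: lfunE. Qed.
Let dltM a b : dlt (a * b) = dlt a * eps b + eps (tau a) * dlt b.
Proof. by rewrite !dltE drepM m2E drep00 drep11. Qed.

Lemma pd_def : {f : 'End(B) | [/\ forall a b, f (a * b) = f a * b + tau a * f b,
  f g = 0 & forall j, f (x j) = (i == j)%:R *: g]}.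
Proof.
exists (tlunit B \o tmap dlt \1 \o Delta)%VF.
(* [dlt] satisfies a Leibniz rule twisted by ε ∘ τ on the left; contracting the coproduct turns that
   twist into τ. *)
have twist a : tlunit B (tmap (eps \o tau)%VF \1%VF (Delta a)) = tau a.
  have -> : tmap (eps \o tau) \1 = (tmap eps \1 \o tmap tau \1)%VF
      :> 'Hom(tens B B, tens K^o B).
    by rewrite -tmap_comp comp_lfun1l.
  rewrite comp_lfunE comul_tau; exact: (counitlE (H := Bk_hopf K k)).
split=> [a b||j].
- rewrite !comp_lfunE Bk_comulM.
  have e s t : tlunit B (tmap dlt \1%VF (s * t)) =
      tlunit B (tmap dlt \1%VF s) * tlunit B (tmap eps \1%VF t) +
      tlunit B (tmap (eps \o tau)%VF \1%VF s) * tlunit B (tmap dlt \1%VF t).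
    elim/tens_ind: s => [c u v eu ev|u v].
      by rewrite mulrDl -scalerAl !lfunPE eu ev !mulrDl -!scalerAl scalerDr addrACA.
    elim/tens_ind: t => [c w z eu ev|w z].
      by rewrite mulrDr -scalerAr !lfunPE eu ev !mulrDr -!scalerAr scalerDr addrACA.
    rewrite pureM !tmapE !tlunitE !id_lfunE dltM comp_lfunE -!scalerAl -!scalerAr.
    by rewrite !scalerA scalerDl.
  rewrite e twist; congr (_ * _ + _).
  exact: (counitlE (H := Bk_hopf K k)).
- rewrite !comp_lfunE Bk_comul_g tmapE tlunitE dltE drep_g !mxE /= subr0.
  exact: scale0r.
rewrite !comp_lfunE Bk_comul_x lfunDE !tmapE lfunDE !tlunitE !id_lfunE !dltE drep1 drep_x.
by rewrite !mxE /= scale0r add0r mulr1.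
Qed.
End Functional.

Definition pd i : 'End(B) := sval (pd_def i).

Lemma pdM i a b : pd i (a * b) = pd i a * b + tau a * pd i b.
Proof. by case: (svalP (pd_def i)). Qed.
Lemma pd_g i : pd i g = 0. Proof. by case: (svalP (pd_def i)). Qed.
Lemma pd_x i j : pd i (x j) = (i == j)%:R *: g.
Proof. by case: (svalP (pd_def i)). Qed.

Lemma pd1 i : pd i 1 = 0.
Proof.
by apply: (addrI (pd i 1)); rewrite addr0 -{3}[1]mulr1 pdM tau1 mulr1 mul1r.
Qed.

Lemma tau_pd i a : tau (pd i a) = - pd i (tau a).
Proof.
elim/Bk_ind: a => [r u v eu ev||u v eu ev||j].
- by rewrite !lfunPE eu ev opprD scalerN.
- by rewrite tau1 pd1 lfun0E oppr0.
- by rewrite pdM lfunDE !tauM eu ev pdM opprD mulNr mulrN.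
- by rewrite tau_g lfunNE pd_g lfun0E !oppr0.
- by rewrite tau_x pd_x lfunZE tau_g scalerN.
Qed.

Lemma pd_pd i j a : pd i (pd j a) = - pd j (pd i a).
Proof.
elim/Bk_ind: a => [r u v eu ev||u v eu ev||l].
- by rewrite !lfunPE eu ev opprD scalerN.
- by rewrite !pd1 !lfun0E oppr0.
- rewrite !pdM !lfunDE !pdM eu ev !tau_tau !tau_pd !mulNr mulrN addrACA.
  by rewrite [LHS]/= [in RHS]opprD opprB [_ - pd j (pd i u) * v]addrC opprD.
- by rewrite !pd_g !lfun0E oppr0.
- by rewrite !pd_x !lfunZE !pd_g !scaler0 oppr0.
Qed.

Lemma comul_pd i a : tmap (pd i) \1%VF (Delta a) = Delta (pd i a).
Proof.
elim/Bk_ind: a => [r u v eu ev||u v eu ev||j].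
- by rewrite !lfunPE eu ev.
- by rewrite Bk_comul1 -pure1 tmapE pd1 pure0l lfun0E.
- rewrite pdM lfunDE !Bk_comulM -eu -ev -comul_tau.
  elim/tens_ind: (Delta u) => [c s t es et|s t].
    by rewrite mulrDl -scalerAl !lfunPE es et !mulrDl -!scalerAl scalerDr addrACA.
  elim/tens_ind: (Delta v) => [c w z ew ez|w z].
    by rewrite mulrDr -scalerAr !lfunPE ew ez !mulrDr -!scalerAr scalerDr addrACA.
  by rewrite pureM !tmapE pdM !id_lfunE pureDl !pureM.
- by rewrite Bk_comul_g tmapE pd_g lfun0E pure0l.
- by rewrite Bk_comul_x lfunDE !tmapE pd1 pure0l add0r pd_x lfunZE id_lfunE pureZl Bk_comul_g.
Qed.

(** [pd i] replaces x_i by g and multiplication by x_i g restores it, since g^2 = 1. By [pd_mo] the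
    two families behave like annihilation and creation operators. *)
Definition mo i : 'End(B) := amull (x i * g).

Lemma pd_mo i j a : pd i (mo j a) + mo j (pd i a) = (i == j)%:R *: a.
Proof.
rewrite !amullE -!mulrA !pdM pd_x pd_g mul0r add0r tau_x tau_g.
by rewrite mulNr mulrN -scalerAl (mulrA g g) Bk_gg mul1r subrK.
Qed.

Lemma lproj_pd i e a : lproj K k (~~ e) (pd i a) = pd i (lproj K k e a).
Proof. by rewrite -addbT; apply: sproj_comm => b; rewrite tau_pd scaleN1r. Qed.

Lemma lproj_mo i e a : lproj K k (~~ e) (mo i a) = mo i (lproj K k e a).
Proof.
rewrite -addbT; apply: sproj_comm => b.
by rewrite !amullE !tauM tau_x tau_g mulrN mulNr scaleN1r.
Qed.

(** The number operator: by [nop_cbas] it counts the x_i in a basis vector. *)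
Definition nop : 'End(B) := \sum_i (mo i \o pd i)%VF.

Lemma nopE a : nop a = \sum_i mo i (pd i a).
Proof. by rewrite sum_lfunE; apply: eq_bigr => i _; rewrite comp_lfunE. Qed.

Lemma nop1 : nop 1 = 0.
Proof. by rewrite nopE big1 // => i _; rewrite pd1 lfun0E. Qed.

Lemma nop_g a : nop (g * a) = g * nop a.
Proof.
rewrite !nopE mulr_sumr; apply: eq_bigr => i _.
rewrite !amullE pdM pd_g mul0r add0r tau_g mulNr mulrN.
by rewrite !mulrA Bk_gx !mulNr.
Qed.

Lemma nop_x i a : nop (x i * a) = x i * a + x i * nop a.
Proof.
rewrite !nopE mulr_sumr (bigD1 i) //= [in RHS](bigD1 i) //= addrA; congr (_ + _).
  rewrite pdM pd_x eqxx scale1r tau_x lfunDE !amullE -!mulrA (mulrA g g) Bk_gg mul1r.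
  by congr (_ + _); rewrite !mulrA -(mulrA (x i) g) Bk_gx mulrN mulNr !mulrA Bk_xx !mul0r oppr0.
apply: eq_bigr => j /negPf ji.
rewrite pdM pd_x ji scale0r mul0r add0r tau_x !amullE !mulrA -(mulrA (x j) g) Bk_gx.
by rewrite mulrN mulrA mulNr (Bk_xxN _ j i) !mulNr opprK.
Qed.

Lemma nop_pd i a : nop (pd i a) = pd i (nop a) - pd i a.
Proof.
rewrite !nopE lfun_sumE; have e j : mo j (pd j (pd i a)) =
    pd i (mo j (pd j a)) - (i == j)%:R *: pd j a.
  by rewrite -pd_mo opprD addrA subrr add0r (pd_pd j i) lfunNE.
rewrite (eq_bigr _ (fun j _ => e j)) sumrB; congr (_ - _).
rewrite (bigD1 i) //= eqxx scale1r big1 ?addr0 // => j ji.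
by rewrite eq_sym (negPf ji) scale0r.
Qed.

Definition xdeg (S : {set 'I_k.+1}) : nat := #|S :\ ord0|.

Lemma nop_prod (r : seq 'I_k.+1) (S : {set 'I_k.+1}) (e : 'I_k.+1 -> B) :
  (forall i, e i = cgen _ i) ->
  nop (\prod_(i <- r | i \in S) e i) =
  (count [pred i | (i \in S) && (i != ord0)] r)%:R *: \prod_(i <- r | i \in S) e i.
Proof.
move=> eE; elim: r => [|i r IH]; first by rewrite !big_nil nop1 scale0r.
rewrite !big_cons; case: ifP => iS /=; rewrite iS //= eE.
case: (unliftP ord0 i) => [j ->|->] /=.
  by rewrite -[cgen _ _]/(x j) nop_x IH natrD scalerDl scale1r scalerAr.
by rewrite -[cgen _ _]/g nop_g IH scalerAr.
Qed.

Lemma nop_cbas S : nop (cbas _ S) = (xdeg S)%:R *: (cbas _ S : B).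
Proof.
rewrite cbas_prod (nop_prod _ _ (fun i => erefl)); congr (_%:R *: _).
rewrite -sum1_count /= /xdeg -sum1_card; apply: eq_bigl => i.
by rewrite !inE andbC.
Qed.

Lemma counit_cbas S : eps (cbas _ S) = (xdeg S == 0%N)%:R.
Proof.
rewrite cbas_prod.
have -> : eps (\prod_(i in S) cgen _ i) = \prod_(i in S) (i == ord0)%:R.
  elim: (index_enum _) => [|i r IH]; first by rewrite !big_nil Bk_counit1.
  rewrite !big_cons; case: ifP => // _; rewrite Bk_counitM IH; congr (_ * _).
  case: (unliftP ord0 i) => [j ->|->].
    by rewrite [eps _](Bk_counit_x K j).
  by rewrite [eps _](Bk_counit_g K k).
rewrite /xdeg cards_eq0; have [/eqP S0|S0] := boolP (S :\ ord0 == set0).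
  rewrite big1 // => i iS; have := in_set0 i; rewrite -S0 !inE iS andbT.
  by move/negbFE ->.
case: (elimT (set0Pn _) S0) => i; rewrite !inE => /andP[/negPf i0 iS].
by rewrite (bigD1 i) //= i0 mul0r.
Qed.

Lemma tau_cbas S : tau (cbas _ S) = (-1) ^+ (ord0 \in S) *: (cbas _ S : B).
Proof.
rewrite cbas_prod.
have h (r : seq 'I_k.+1) : uniq r -> tau (\prod_(i <- r | i \in S) cgen _ i) =
    (-1) ^+ ((ord0 \in r) && (ord0 \in S)) *: (\prod_(i <- r | i \in S) cgen _ i : B).
  elim: r => [|i r IH]; first by rewrite !big_nil tau1 scale1r.
  move=> /= /andP[ir /IH{}IH]; rewrite !big_cons inE.
  case: (unliftP ord0 i) ir => [j ->|->] ir.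
    rewrite (negPf (neq_lift ord0 j)) /=; case: ifP => _; last exact: IH.
    by rewrite tauM IH [tau _](tau_x K j) scalerAr.
  rewrite eqxx /=; move: IH; rewrite (negPf ir) /= scale1r.
  case: ifP => _ IH; last by rewrite scale1r.
  by rewrite tauM IH [tau _](tau_g K k) mulNr scaleN1r.
by rewrite h ?index_enum_uniq // mem_index_enum.
Qed.

(* The inverse of m + nop, except that 1 / 0 = 0 at m = 0 in degree 0. *)
Definition jfun (m : nat) (b : B) : B :=
  [ffun S => ((m + xdeg S)%:R^-1 : K) * (b : {ffun _ -> K}) S].

Lemma jfun_linear m : linear (jfun m).
Proof.
move=> c u v; apply/ffunP => S; rewrite !ffunE mulrDr; congr (_ + _).
by rewrite -[c *: u S]/(c * u S) mulrCA.
Qed.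

Definition jop (m : nat) : 'End(B) := linfun (HB.pack_for {linear B -> B} (jfun m)
  (GRing.isSemilinear.Build K B B _ (jfun m) (GRing.semilinear_linear (jfun_linear m)))).

Lemma jopE m b : jop m b = jfun m b. Proof. exact: lfunE. Qed.

Lemma jop_eig m (c : K) b : nop b = c *: b -> jop m b = (m%:R + c)^-1 *: b.
Proof.
move=> bc; rewrite jopE; apply/ffunP => S; rewrite !ffunE -[RHS]/(_ * _).
have : (xdeg S)%:R * (b : {ffun _ -> K}) S = c * (b : {ffun _ -> K}) S.
  have /ffunP/(_ S) := bc; rewrite !ffunE -[c *: _]/(c * _) => <-.
  rewrite {2}[b]cliff_sum lfun_sumE sum_ffunE (bigD1 S) //= big1 ?addr0.
    by rewrite lfunZE nop_cbas !ffunE eqxx mulrC; congr (_ * _); rewrite [_ *: 1]mulr1.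
  by move=> S' S'S; rewrite lfunZE nop_cbas !ffunE eq_sym (negPf S'S) ![_ *: 0]mulr0.
move/eqP; rewrite -subr_eq0 -mulrBl mulf_eq0 => /orP[|/eqP -> ]; last by rewrite !mulr0.
by rewrite subr_eq0 natrD => /eqP ->.
Qed.

Lemma jop_cbas m S : jop m (cbas _ S) = (m + xdeg S)%:R^-1 *: (cbas _ S : B).
Proof. by rewrite (jop_eig m (nop_cbas S)) natrD. Qed.

Lemma Bk_lfun_ext (U : vectType K) (f h : 'Hom(B, U)) :
  (forall S, f (cbas _ S) = h (cbas _ S)) -> forall a, f a = h a.
Proof. by move=> fh; apply: cliff_ext => // c u v; rewrite lfunPE. Qed.

(** [pd i] lowers the number of x's by one, so m plus that number becomes m + 1 plus the new one. *)
Lemma pd_jop i m a : pd i (jop m a) = jop m.+1 (pd i a).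
Proof.
rewrite -!comp_lfunE; apply: Bk_lfun_ext => S; rewrite !comp_lfunE jop_cbas lfunZE.
have e : nop (pd i (cbas _ S)) = ((xdeg S)%:R - 1) *: pd i (cbas _ S).
  by rewrite nop_pd nop_cbas lfunZE scalerBl scale1r.
by rewrite (jop_eig _ e) natrD -natr1 addrCA -addrA addrCA addrN addr0 addrC.
Qed.

Lemma lproj_cbas e S :
  lproj K k e (cbas _ S) =
    2%:R^-1 *: ((1 + (-1) ^+ e * (-1) ^+ (ord0 \in S)) *: (cbas _ S : B)).
Proof. by rewrite sprojE tau_cbas scalerDl scale1r -!scalerA. Qed.

Lemma lproj_jop e m a : lproj K k e (jop m a) = jop m (lproj K k e a).
Proof.
rewrite -!comp_lfunE; apply: Bk_lfun_ext => S; rewrite !comp_lfunE.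
by rewrite jop_cbas lproj_cbas !lfunZE lproj_cbas jop_cbas !scalerA -mulrA mulrC.
Qed.

Hypothesis natK : forall m, m.+1%:R != 0 :> K.

Lemma nop_jop m a : m.+1%:R *: jop m.+1 a + nop (jop m.+1 a) = a.
Proof.
rewrite -[nop _]comp_lfunE -scale_lfunE -add_lfunE -[RHS]id_lfunE.
apply: Bk_lfun_ext => S; rewrite add_lfunE scale_lfunE comp_lfunE id_lfunE.
rewrite jop_cbas lfunZE nop_cbas !scalerA -scalerDl mulrC -mulrDr -natrD mulVf ?scale1r //; exact: natK.
Qed.

(** With left letter 1, the only basis vector without x's is 1; [nop] kills it and the counit
    restores it. On all others [jop 0] inverts [nop]. *)
Lemma lproj0 a : lproj K k false a =
  jop 0 (nop (lproj K k false a)) + eps (lproj K k false a) *: 1.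
Proof.
have [f fE] : exists f : 'End(B), forall b, f b = eps b *: 1.
  exists (tlunit B \o rpureh K^o (1 : B) \o eps)%VF => b.
  by rewrite !comp_lfunE rpurehE tlunitE.
rewrite -fE -!comp_lfunE -add_lfunE; apply: Bk_lfun_ext => S.
rewrite add_lfunE !comp_lfunE lproj_cbas !lfunZE expr0 mul1r -!scalerDr.
case S0: (ord0 \in S); first by rewrite expr1 subrr !scale0r.
congr (_ *: (_ *: _)); rewrite nop_cbas lfunZE jop_cbas add0n fE counit_cbas.
case: eqP => [dS|]; last first.
  by case: (xdeg S) => // d _; rewrite scalerA mulfV ?natK // scale1r scale0r addr0.
rewrite dS scale0r add0r scale1r; apply: (congr1 (cbas _)).
move/eqP: dS; rewrite cards_eq0 => /eqP/setP dS; apply/setP => i.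
have := dS i; rewrite !inE; case: eqP => [->|_] //=; by rewrite S0.
Qed.

End Koszul.

(** * Rows, columns and zigzags of the double complex *)

Section KoszulComplex.
Local Open Scope ring_scope.
Variables (K : fieldType) (H : hopfAlgebra K) (k : nat).
Local Notation T := (T H).
Local Notation cdiff := (cdiff H).
Local Notation cpath := (cpath H).
Local Notation caug := (caug H).
Local Notation MI := {ffun 'I_k -> nat}.

Variables (L : bool -> 'End(H)) (pd mo : 'I_k -> 'End(H)) (jop : nat -> 'End(H)).
Hypothesis two : 2%:R != 0 :> K.
Hypothesis LL : forall e a, L e (L e a) = L e a.
Hypothesis L1 : forall e, L e 1 = (e == false)%:R *: 1.
Hypothesis comulL : forall e a, tmap (L e) \1%VF (comul H a) = comul H (L e a).
Hypothesis pd1 : forall i, pd i 1 = 0.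
Hypothesis pd_pd : forall i j a, pd i (pd j a) = - pd j (pd i a).
Hypothesis comul_pd : forall i a, tmap (pd i) \1%VF (comul H a) = comul H (pd i a).
Hypothesis pd_mo : forall i j a, pd i (mo j a) + mo j (pd i a) = (i == j)%:R *: a.
Hypothesis L_pd : forall i e a, L (~~ e) (pd i a) = pd i (L e a).
Hypothesis L_mo : forall i e a, L (~~ e) (mo i a) = mo i (L e a).
Hypothesis L_jop : forall e m a, L e (jop m a) = jop m (L e a).
Hypothesis pd_jop : forall i m a, pd i (jop m a) = jop m.+1 (pd i a).
Hypothesis deg_jop : forall m a,
  m.+1%:R *: jop m.+1 a + \sum_i mo i (pd i (jop m.+1 a)) = a.
Hypothesis L0 : forall a, L false a =
  jop 0 (\sum_i mo i (pd i (L false a))) + counit H (L false a) *: 1.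

Definition hd (f : 'End(H)) n : 'End(T n.+1) := tmap f \1.

Lemma hdE f n (a : H) (t : T n) : hd f n (pure a t) = pure (f a) t.
Proof. by rewrite tmapE id_lfunE. Qed.

Lemma hd_path f n (t : T n.+1) :
  (forall a, tmap f \1%VF (comul H a) = comul H (f a)) ->
  cpath n.+1 (hd f n t) = hd f n.+1 (cpath n.+1 t).
Proof.
move=> fc; elim/T_ind: t => [c x y ex ey|a t]; first by rewrite !lfunPE ex ey.
rewrite hdE !cpathE lfunBE hdE; congr (_ - _).
rewrite !cdupE -fc; elim/tens_ind: (comul H a) => [c x y ex ey|c d].
  by rewrite !(pureDl, pureZl) !lfunPE pureDl pureZl lfunPE ex ey.
by rewrite tmapE id_lfunE !tassocE hdE.
Qed.

Definition addi (t : MI) (i : 'I_k) : MI := [ffun j => (t j + (j == i))%N].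
Definition subi (t : MI) (i : 'I_k) : MI := [ffun j => (t j - (j == i))%N].
Definition mdeg (t : MI) : nat := \sum_i t i.

Lemma mdeg_addi (t : MI) i : mdeg (addi t i) = (mdeg t).+1.
Proof.
rewrite /mdeg (bigD1 i) //= [in RHS](bigD1 i) //= ffunE eqxx addn1 addSn.
by congr (_ + _).+1; apply: eq_bigr => j /negPf ji; rewrite ffunE ji addn0.
Qed.

Lemma addiK (t : MI) i : subi (addi t i) i = t.
Proof. by apply/ffunP => j; rewrite !ffunE addnK. Qed.

Lemma subiK (t : MI) i : (0 < t i)%N -> addi (subi t i) i = t.
Proof.
move=> ti; apply/ffunP => j; rewrite !ffunE subnK //.
by case: eqP => // ->.
Qed.

Lemma mdeg_subi (t : MI) i : (0 < t i)%N -> mdeg t = (mdeg (subi t i)).+1.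
Proof. by move=> ti; rewrite -(mdeg_addi (subi t i) i) subiK. Qed.

Lemma subi_addi (t : MI) i j : (0 < t i)%N -> subi (addi t j) i = addi (subi t i) j.
Proof.
move=> ti; apply/ffunP => l; rewrite !ffunE addnBAC //.
by case: eqP => // ->.
Qed.

Lemma subiC (t : MI) i j : subi (subi t i) j = subi (subi t j) i.
Proof. by apply/ffunP => l; rewrite !ffunE -!subnDA addnC. Qed.

Lemma hd_pd_pd i j n (u : T n.+1) :
  hd (pd i) n (hd (pd j) n u) = - hd (pd j) n (hd (pd i) n u).
Proof.
elim/T_ind: u => [c x y ex ey|a t]; first by rewrite !lfunPE ex ey scalerN opprD.
by rewrite !hdE pd_pd pureNl.
Qed.

Lemma hd_pd_mo i j n (u : T n.+1) :
  hd (pd i) n (hd (mo j) n u) + hd (mo j) n (hd (pd i) n u) = (i == j)%:R *: u.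
Proof.
elim/T_ind: u => [c x y ex ey|a t].
  by rewrite !lfunPE addrACA -scalerDr ex ey scalerDr !scalerA mulrC.
by rewrite !hdE -pureDl pd_mo pureZl.
Qed.

Lemma hd_L_pd i e n (u : T n.+1) :
  hd (L (~~ e)) n (hd (pd i) n u) = hd (pd i) n (hd (L e) n u).
Proof.
elim/T_ind: u => [c x y ex ey|a t]; first by rewrite !lfunPE ex ey.
by rewrite !hdE L_pd.
Qed.

Lemma hd_L_mo i e n (u : T n.+1) :
  hd (L (~~ e)) n (hd (mo i) n u) = hd (mo i) n (hd (L e) n u).
Proof.
elim/T_ind: u => [c x y ex ey|a t]; first by rewrite !lfunPE ex ey.
by rewrite !hdE L_mo.
Qed.

Lemma hd_L_jop e m n (u : T n.+1) :
  hd (L e) n (hd (jop m) n u) = hd (jop m) n (hd (L e) n u).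
Proof.
elim/T_ind: u => [c x y ex ey|a t]; first by rewrite !lfunPE ex ey.
by rewrite !hdE L_jop.
Qed.

Lemma hd_pd_jop i m n (u : T n.+1) :
  hd (pd i) n (hd (jop m) n u) = hd (jop m.+1) n (hd (pd i) n u).
Proof.
elim/T_ind: u => [c x y ex ey|a t]; first by rewrite !lfunPE ex ey.
by rewrite !hdE pd_jop.
Qed.

Lemma hd_LL e n (u : T n.+1) : hd (L e) n (hd (L e) n u) = hd (L e) n u.
Proof.
elim/T_ind: u => [c x y ex ey|a t]; first by rewrite !lfunPE ex ey.
by rewrite !hdE LL.
Qed.

Definition hmp n (u : T n.+1) : T n.+1 := \sum_i hd (mo i) n (hd (pd i) n u).

Lemma hmp_lin n c (u v : T n.+1) : hmp (c *: u + v) = c *: hmp u + hmp v.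
Proof.
rewrite /hmp scaler_sumr -big_split; apply: eq_bigr => i _ /=.
by rewrite !lfunPE.
Qed.

Lemma hmpE n a (t : T n) : hmp (pure a t) = pure (\sum_i mo i (pd i a)) t.
Proof.
rewrite /hmp (bilin_suml _ _ (pure_bilin _ _)).
by apply: eq_bigr => i _; rewrite !hdE.
Qed.

Lemma hd_deg_jop m n (u : T n.+1) :
  m.+1%:R *: hd (jop m.+1) n u + hmp (hd (jop m.+1) n u) = u.
Proof.
elim/T_ind: u => [c x y ex ey|a t].
  by rewrite lfunPE hmp_lin scalerDr addrACA ey scalerA mulrC -scalerA -scalerDr ex.
by rewrite hdE hmpE -pureZl -pureDl deg_jop.
Qed.

Lemma hd_L0 n (u : T n.+1) : hd (L false) n u =
  hd (jop 0) n (hmp (hd (L false) n u)) + pure (1 : H) (caug n (hd (L false) n u)).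
Proof.
elim/T_ind: u => [c x y ex ey|a t].
  by rewrite !lfunPE hmp_lin !lfunPE pureDr pureZr addrACA -scalerDr -ex -ey.
by rewrite !hdE hmpE hdE caugE pureZr -pureZl -pureDl -L0.
Qed.

(* The factor t i makes the truncated subtraction in subi t i harmless. *)
Definition kos n (F : MI -> T n.+1) (t : MI) : T n.+1 :=
  \sum_i (t i)%:R *: hd (pd i) n (F (subi t i)).

(** If [F t] is read as the coefficient of the divided power y^t / t!, then [kos] is the sum of the
    y_i [pd i] and [koh] the sum of the (d/dy_i) [mo i]. This is where the factor [t i] in [kos]
    comes from. *)
Definition koh n (F : MI -> T n.+1) (t : MI) : T n.+1 :=
  \sum_i hd (mo i) n (F (addi t i)).

(** The parity condition is stable: [pd] and [mo] flip the left letter while [kos] and [koh] shift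
    the degree by one. *)
Definition chain n m (F : MI -> T n.+1) : Prop :=
  (forall t, mdeg t != m -> F t = 0) /\ (forall t, hd (L (odd m)) n (F t) = F t).

Lemma kos_lin n a (F G : MI -> T n.+1) : kos (a *: F + G) = a *: kos F + kos G.
Proof.
apply/funext => t; rewrite -[RHS]/(a *: kos F t + kos G t) /kos scaler_sumr -big_split /=.
apply: eq_bigr => i _; rewrite -[(a *: F + G) _]/(a *: F (subi t i) + G (subi t i)).
by rewrite lfunPE scalerDr !scalerA mulrC.
Qed.

Lemma kos0 n : kos (0 : MI -> T n.+1) = 0.
Proof.
apply/funext => t; rewrite /kos big1 // => i _; rewrite [X in hd _ _ X](_ : _ = 0) //.
by rewrite lfun0E scaler0.
Qed.

Lemma chain_lin n m a (F G : MI -> T n.+1) :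
  chain m F -> chain m G -> chain m (a *: F + G).
Proof.
move=> [F0 FL] [G0 GL]; split=> t; rewrite -[(a *: F + G) t]/(a *: F t + G t).
  by move=> tm; rewrite F0 // G0 // scaler0 addr0.
by rewrite lfunPE FL GL.
Qed.

Lemma chain0 n m : chain m (0 : MI -> T n.+1).
Proof. by split=> t //; exact: lfun0E. Qed.

Lemma chain_kos n m (F : MI -> T n.+1) : chain m F -> chain m.+1 (kos F).
Proof.
move=> [F0 FL]; split=> t; last first.
  rewrite lfun_sumE; apply: eq_bigr => i _.
  by rewrite lfunZE hd_L_pd FL.
move=> tm; rewrite /kos big1 // => i _; case: (posnP (t i)) => [->|ti].
  by rewrite scale0r.
rewrite F0 ?lfun0E ?scaler0 //; apply: contraNneq tm => <-.
by rewrite (mdeg_subi ti).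
Qed.

Lemma chain_koh n m (F : MI -> T n.+1) : chain m.+1 F -> chain m (koh F).
Proof.
move=> [F0 FL]; split=> t; last first.
  rewrite lfun_sumE; apply: eq_bigr => i _.
  by rewrite -{1}[odd m]negbK hd_L_mo FL.
move=> tm; rewrite /koh big1 // => i _.
by rewrite F0 ?lfun0E // mdeg_addi eqSS.
Qed.

(** Multiplications by the y_i commute and the [pd i] anticommute, so the double sum is its own
    negative. *)
Lemma kos_kos n (F : MI -> T n.+1) : kos (kos F) = 0.
Proof.
apply/funext => t; rewrite -[RHS]/(0 : T n.+1).
pose E i j := ((t i)%:R * (subi t i j)%:R) *:
  hd (pd i) n (hd (pd j) n (F (subi (subi t i) j))).
have -> : kos (kos F) t = \sum_i \sum_j E i j.
  apply: eq_bigr => i _; rewrite /kos lfun_sumE scaler_sumr; apply: eq_bigr => j _.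
  by rewrite lfunZE scalerA.
have EC i j : E i j = - E j i.
  rewrite /E hd_pd_pd subiC scalerN -!natrM; congr (- (_%:R *: _)).
  rewrite !ffunE; case: (eqVneq i j) => [->//|ij].
  by rewrite !subn0 mulnC.
have e : \sum_i \sum_j E i j = - \sum_i \sum_j E i j.
  rewrite [LHS]exchange_big -sumrN; apply: eq_bigr => i _.
  by rewrite -sumrN; apply: eq_bigr => j _; rewrite EC.
set X := \sum_i _ in e *; apply: (scalerI two).
by rewrite scaler0 scaler_nat mulr2n {2}e subrr.
Qed.

(** The Weyl relations of y_i and d/dy_j combine with the anticommutation of [pd] and [mo] into
    Euler's operator in y plus the number operator on the first factor. *)
Lemma kos_koh n (F : MI -> T n.+1) t :
  kos (koh F) t + koh (kos F) t = (mdeg t)%:R *: F t + hmp (F t).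
Proof.
pose A i j := F (addi (subi t i) j).
have -> : kos (koh F) t = \sum_i \sum_j (t i)%:R *: hd (pd i) n (hd (mo j) n (A i j)).
  by apply: eq_bigr => i _; rewrite /koh lfun_sumE scaler_sumr.
have -> : koh (kos F) t = \sum_i \sum_j (t i)%:R *: hd (mo j) n (hd (pd i) n (A i j))
    + hmp (F t).
  rewrite exchange_big -big_split; apply: eq_bigr => j _ /=.
  rewrite /kos lfun_sumE.
  have -> : hd (mo j) n (hd (pd j) n (F t)) =
      \sum_i (i == j)%:R *: hd (mo j) n (hd (pd i) n (F t)).
    rewrite (bigD1 j) //= eqxx scale1r big1 ?addr0 // => i /negPf ->.
    by rewrite scale0r.
  rewrite -big_split; apply: eq_bigr => i _ /=; rewrite lfunZE ffunE natrD scalerDl.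
  congr (_ + _).
    case: (posnP (t i)) => [->|ti]; first by rewrite !scale0r.
    by rewrite subi_addi.
  by case: eqP => [->|]; rewrite ?scale0r // addiK.
rewrite addrA -big_split; congr (_ + _).
rewrite /mdeg natr_sum scaler_suml; apply: eq_bigr => i _ /=.
rewrite -big_split /= (bigD1 i) //= big1 ?addr0 => [|j ji].
  rewrite -scalerDr hd_pd_mo eqxx scale1r /A.
  by case: (posnP (t i)) => [->|ti]; rewrite ?scale0r // subiK.
by rewrite -scalerDr hd_pd_mo eq_sym (negPf ji) scale0r scaler0.
Qed.

(** The primitive is [koh] of [F] divided by its total degree, m + 1 plus the number of x's in the
    first factor, which is never 0. [kos] preserves the total degree, hence commutes with this
    division. *)
Lemma kos_exact n m (F : MI -> T n.+1) : chain m.+1 F -> kos F = 0 ->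
  exists2 G, chain m G & kos G = F.
Proof.
move=> [F0 FL] kF; pose F' t := hd (jop m.+1) n (F t).
exists (koh F').
  apply: chain_koh; split=> t; first by move=> tm; rewrite /F' F0 // lfun0E.
  by rewrite /F' hd_L_jop FL.
have kF' : kos F' = 0.
  apply/funext => t; transitivity (hd (jop m.+2) n (kos F t)); last by rewrite kF lfun0E.
  rewrite lfun_sumE; apply: eq_bigr => i _.
  by rewrite lfunZE -hd_pd_jop.
apply/funext => t; have := kos_koh F' t; rewrite kF'.
have -> : koh (0 : MI -> T n.+1) t = 0.
  by rewrite /koh big1 // => i _; rewrite [X in hd _ _ X](_ : _ = 0) // lfun0E.
rewrite addr0 => ->; case: (eqVneq (mdeg t) m.+1) => [->|tm].
  exact: hd_deg_jop.
rewrite /F' F0 // lfun0E scaler0 add0r.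
by rewrite /hmp big1 // => i _; rewrite !lfun0E.
Qed.

Definition cpathF n (F : MI -> T n.+1) : MI -> T n.+2 := fun t => cpath n.+1 (F t).

Lemma cpathF_lin n a (F G : MI -> T n.+1) :
  cpathF (a *: F + G) = a *: cpathF F + cpathF G.
Proof.
apply/funext => t; rewrite -[RHS]/(a *: cpathF F t + cpathF G t) /cpathF.
by rewrite -[(a *: F + G) t]/(a *: F t + G t) lfunPE.
Qed.

Lemma cpathF0 n : cpathF (0 : MI -> T n.+1) = 0.
Proof. by apply/funext => t; rewrite /cpathF [X in cpath _ X](_ : _ = 0) // lfun0E. Qed.

Lemma cpathF_cpathF n (F : MI -> T n.+1) : cpathF (cpathF F) = 0.
Proof. by apply/funext => t; rewrite /cpathF cpath_path. Qed.

Lemma kos_cpathF n (F : MI -> T n.+1) : kos (cpathF F) = cpathF (kos F).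
Proof.
apply/funext => t; rewrite /cpathF /kos lfun_sumE; apply: eq_bigr => i _.
by rewrite lfunZE hd_path.
Qed.

Lemma chain_cpathF n m (F : MI -> T n.+1) : chain m F -> chain m (cpathF F).
Proof.
move=> [F0 FL]; split=> t; first by move=> tm; rewrite /cpathF F0 // lfun0E.
by rewrite /cpathF -hd_path // FL.
Qed.

Lemma cpathF_exact n m (F : MI -> T n.+2) : chain m F -> cpathF F = 0 ->
  exists2 G, chain m G & cpathF G = F.
Proof.
(* The counit contraction forgets the left letter, so the primitive is projected back to the letter
   of degree m; [cpath] commutes with that projection. *)
move=> [F0 FL] pF; exists (fun t => hd (L (odd m)) n (caug n.+1 (F t))).
  split=> t; first by move=> tm; rewrite F0 // !lfun0E.
  exact: hd_LL.
apply/funext => t; rewrite /cpathF hd_path // -[RHS]FL; congr (hd _ _ _).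
rewrite -[RHS](caug_path (F t)).
by move/(congr1 (fun f => f t)): pF; rewrite /cpathF => ->; rewrite lfun0E add0r.
Qed.

Lemma cpathF_exact0 (F : MI -> T 1) : cpathF F = 0 ->
  forall t, F t = pure (1 : H) (caug 0 (F t)).
Proof.
move=> pF t; rewrite -[LHS](caug_path (F t)).
move/(congr1 (fun f => f t)): pF; rewrite /cpathF => ->; rewrite lfun0E add0r.
exact: cpath0E.
Qed.

Definition bicocycle n m (F : MI -> T n.+1) : Prop :=
  [/\ chain m F, cpathF F = 0 & kos F = 0].

(** The quotient is column cohomology restricted to Koszul cocycles of degree m. For m = 0 it is
    cobar cohomology ([qdim_row]); for n = 0 it is the common kernel of both differentials. *)
Definition bicoboundary n m : (MI -> T n.+1) -> Prop :=
  match n return (MI -> T n.+1) -> Prop with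
  | 0 => fun F => F = 0
  | n'.+1 => fun F => exists G, [/\ chain m G, kos G = 0 & F = cpathF G]
  end.

(** Classes are related when they are [kos b] and [cpathF b] for one [b]. Exact rows provide [b]
    from the first, exact columns from the second. *)
Lemma zigzag n m d :
  qdim (@bicocycle n m.+1) (@bicoboundary n m.+1) d ->
  qdim (@bicocycle n.+1 m) (@bicoboundary n.+1 m) d.
Proof.
apply: (qdim_corr (Rel := fun x y => exists b,
  [/\ chain m b, y = cpathF b, x = kos b & cpathF x = 0])).
- move=> a x x' y y' [b [cb -> -> ex]] [c [cc -> -> ey]]; exists (a *: b + c).
  by split; rewrite ?kos_lin ?cpathF_lin ?ex ?ey ?scaler0 ?addr0 //; apply: chain_lin.
- by exists 0; split; rewrite ?kos0 ?cpathF0 //; apply: chain0.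
- move=> x [cx px kx]; have [b cb bx] := kos_exact cx kx.
  by exists (cpathF b), b.
- move=> y [cy py ky]; have [b cb by_] := cpathF_exact cy py.
  by exists (kos b), b; split=> //; rewrite -kos_cpathF by_.
- move=> x y [b [cb -> ex px]]; split; first exact: chain_cpathF.
    exact: cpathF_cpathF.
  by rewrite kos_cpathF -ex.
- move=> x y [b [cb _ ex px]]; split=> //; first by rewrite ex; apply: chain_kos.
  by rewrite ex kos_kos.
move=> x y [b [cb yb xb px]]; subst x y; case: n b cb px => [|n] b cb px.
  split=> [kb|[G [cG kG bG]]]; first by exists b.
  (* At the end of the zigzag the kernel of [cpath] consists of multiples of 1, which every [pd i]
     kills. *)
  have /cpathF_exact0 bGE : cpathF (b - G) = 0.
    by rewrite -scaleN1r addrC cpathF_lin bG scaleN1r addNr.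
  have -> : kos b = kos (b - G).
    by rewrite -scaleN1r addrC kos_lin kG scaler0 add0r.
  apply/funext => t; rewrite /kos big1 // => i _.
  by rewrite bGE hdE pd1 pure0l scaler0.
split=> [[G [cG kG bG]]|[G [cG kG bG]]].
  have [e ce eG] := kos_exact cG kG.
  exists (-1 *: cpathF e + b); split.
  - by apply: chain_lin => //; apply: chain_cpathF.
  - by rewrite kos_lin kos_cpathF eG bG scaleN1r addNr.
  - by rewrite cpathF_lin cpathF_cpathF scaler0 add0r.
have pbG : cpathF (-1 *: G + b) = 0 by rewrite cpathF_lin bG scaleN1r addNr.
have [e ce eG] := cpathF_exact (chain_lin (-1) cG cb) pbG.
exists (kos e); split; [exact: chain_kos | exact: kos_kos |].
by rewrite -kos_cpathF eG kos_lin kG scaler0 add0r.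
Qed.

(** Embeds the cobar complex, as constants 1 ⊗ z, into the double complex; by [inc_exact] its image
    is the kernel of [kos] in degree 0. *)
Definition inc n (z : T n) (t : MI) : T n.+1 :=
  if mdeg t == 0%N then pure (1 : H) z else 0.

Lemma inc_lin n a (y z : T n) : inc (a *: y + z) = a *: inc y + inc z.
Proof.
apply/funext => t; rewrite -[RHS]/(a *: inc y t + inc z t) /inc.
by case: ifP => _; rewrite ?scaler0 ?addr0 // pureDr pureZr.
Qed.

Lemma inc0 n : inc (0 : T n) = 0.
Proof. by apply/funext => t; rewrite /inc pure0r if_same. Qed.

Lemma inc_inj n (y z : T n) : inc y = inc z -> y = z.
Proof.
move/(congr1 (fun f => caug n (f [ffun=> 0%N]))); rewrite /inc.
have -> : mdeg [ffun=> 0%N] == 0%N by rewrite /mdeg big1 // => i _; rewrite ffunE.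
by rewrite !caugE counit1 !scale1r.
Qed.

Lemma chain_inc n (z : T n) : chain 0 (inc z).
Proof.
split=> t; rewrite /inc; first by move/negPf ->.
by case: ifP => _; rewrite ?lfun0E // hdE L1 scale1r.
Qed.

Lemma kos_inc n (z : T n) : kos (inc z) = 0.
Proof.
apply/funext => t; rewrite /kos big1 // => i _; rewrite /inc.
by case: ifP => _; rewrite ?lfun0E ?scaler0 // hdE pd1 pure0l scaler0.
Qed.

Lemma cpathF_inc n (z : T n) : cpathF (inc z) = inc (cdiff n z).
Proof.
apply/funext => t; rewrite /cpathF /inc; case: ifP => _; last exact: lfun0E.
rewrite cpathE cdupE comul1 -pure1 tassocE cdiffE.
by rewrite (pureDr (1 : H) (pure _ _)) pureNr.
Qed.

Lemma mdeg_eq0 (t : MI) i : mdeg t == 0%N -> t i = 0%N.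
Proof. by rewrite sum_nat_eq0 => /forallP/(_ i)/eqP. Qed.

Lemma inc_exact n (F : MI -> T n.+1) : chain 0 F -> kos F = 0 ->
  exists z, F = inc z.
Proof.
move=> [F0 FL] kF; pose o : MI := [ffun=> 0%N].
have o0 : mdeg o = 0%N by rewrite /mdeg big1 // => i _; rewrite ffunE.
have Fo t : mdeg t == 0%N -> t = o.
  by move=> t0; apply/ffunP => i; rewrite ffunE mdeg_eq0.
exists (caug n (F o)); apply/funext => t; rewrite /inc.
case: ifP => [/Fo ->|/negbT/F0 //]; have := hd_L0 (F o); rewrite (FL o) => {1}->.
rewrite /hmp big1 ?lfun0E ?add0r // => i _.
(* The value of [kos F] at the monomial y_i is [pd i] of the constant term. So all of these vanish,
   and [hd_L0] leaves only its counit term. *)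
have -> : hd (pd i) n (F o) = kos F (addi o i); last by rewrite kF lfun0E.
rewrite /kos (bigD1 i) //= big1 => [|j /negPf ji]; last first.
  by rewrite !ffunE ji scale0r.
by rewrite addiK !ffunE eqxx scale1r addr0.
Qed.

Lemma qdim_row n d :
  qdim (@bicocycle n 0) (@bicoboundary n 0) d ->
  qdim (@ccocycle K H (fun _ _ => True) n) (@ccoboundary K H (fun _ _ => True) n) d.
Proof.
apply: (qdim_corr (Rel := fun F z => F = inc z /\ cdiff n z = 0)).
- move=> a x x' y y' [-> ex] [-> ey]; split; first by rewrite inc_lin.
  by rewrite lfunPE ex ey scaler0 addr0.
- by rewrite inc0 lfun0E.
- move=> F [cF pF kF]; have [z zF] := inc_exact cF kF; exists z; split=> //.
  by apply: inc_inj; rewrite -cpathF_inc -zF pF inc0.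
- by move=> z [_ Dz]; exists (inc z).
- by move=> F z [_ Dz].
- move=> F z [-> Dz]; split; first exact: chain_inc.
    by rewrite cpathF_inc Dz inc0.
  exact: kos_inc.
move=> F z [Fz _]; subst F; case: n z => [|n] z.
  split=> [e|->]; last exact: inc0.
  by apply: inc_inj; rewrite inc0; exact: e.
split=> [[G [cG kG zG]]|[y _ ->]]; last first.
  by exists (inc y); split; rewrite ?kos_inc ?cpathF_inc //; apply: chain_inc.
have [y yG] := inc_exact cG kG; exists y => //; apply: inc_inj.
by rewrite zG yG cpathF_inc.
Qed.

Lemma qdim_koszul n m d :
  qdim (@bicocycle 0 (n + m)%N) (@bicoboundary 0 (n + m)%N) d ->
  qdim (@bicocycle n m) (@bicoboundary n m) d.
Proof.
elim: n m => [|n IH] m // h; apply: zigzag.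
by have := IH m.+1; rewrite addnS; apply.
Qed.

Lemma column_unit (F : MI -> T 1) m : @bicocycle 0 m F ->
  forall t, F t = (caug 0 (F t) : K^o) *: pure (1 : H) (1 : K^o).
Proof.
move=> [_ pF _] t; rewrite {1}(cpathF_exact0 pF t) -pureZr; congr pure.
by rewrite [RHS]mulr1.
Qed.

Lemma qdim_column_odd m : odd m ->
  qdim (@bicocycle 0 m) (@bicoboundary 0 m) 0.
Proof.
move=> om; exists (fun _ => 0); split=> [[]//|F Fm|a _ []//].
exists (fun _ => 0); rewrite big_ord0 subr0; apply/funext => t.
case: (Fm) => [[_ FL] _ _]; rewrite -FL (column_unit Fm) lfunZE hdE om L1.
by rewrite scale0r pure0l scaler0.
Qed.

(** Exponents of a monomial of degree m are at most m, so monomials are tuples over ['I_m.+1], the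
    form counted by [card_ord_partitions]. *)
Definition mono m (u : k.-tuple 'I_m.+1) : MI := [ffun i => tnth u i : nat].

Lemma mdeg_mono m (u : k.-tuple 'I_m.+1) : mdeg (mono u) = (\sum_(i <- u) i)%N.
Proof. by rewrite big_tuple; apply: eq_bigr => i _; rewrite ffunE. Qed.

Lemma mono_inj m : injective (@mono m).
Proof.
move=> u v /ffunP uv; apply: eq_from_tnth => i; apply: val_inj.
by have := uv i; rewrite !ffunE.
Qed.

Lemma mono_onto m (t : MI) : mdeg t = m -> exists u : k.-tuple 'I_m.+1, mono u = t.
Proof.
move=> tm; exists [tuple inord (t i) | i < k]; apply/ffunP => i.
rewrite ffunE tnth_mktuple inordK // ltnS -tm /mdeg (bigD1 i) //=.
exact: leq_addr.
Qed.

Lemma qdim_column_even m : ~~ odd m ->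
  qdim (@bicocycle 0 m) (@bicoboundary 0 m)
    #|[set t : k.-tuple 'I_m.+1 | (\sum_(i <- t) i)%N == m]|.
Proof.
move=> /negbTE om; set S := [set t | _].
pose c (j : 'I_#|S|) (t : MI) : T 1 :=
  if t == mono (enum_val j) then pure (1 : H) (1 : K^o) else 0.
have cZ j : @bicocycle 0 m (c j).
  have cm : mdeg (mono (enum_val j)) = m.
    by rewrite mdeg_mono; have := enum_valP j; rewrite inE => /eqP.
  split; first split=> t; rewrite /c.
  - by apply: contraNeq; case: (t =P mono _) => [-> _|_]; rewrite ?cm ?eqxx.
  - by rewrite om; case: ifP => _; rewrite ?lfun0E // hdE L1 scale1r.
  - apply/funext => t; rewrite /cpathF /c; case: ifP => _; last exact: lfun0E.
    rewrite cpathE cdupE comul1 -pure1 tassocE cpath0E; exact: subrr.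
  apply/funext => t; rewrite /kos big1 // => i _; rewrite /c.
  by case: ifP => _; rewrite ?lfun0E ?scaler0 // hdE pd1 pure0l scaler0.
have sumE (a : 'I_#|S| -> K) j :
    (\sum_i a i *: c i) (mono (enum_val j)) = a j *: pure (1 : H) (1 : K^o).
  transitivity (\sum_i a i *: c i (mono (enum_val j))); first by rewrite fct_sumE.
  rewrite (bigD1 j) //= big1 => [|i ij]; first by rewrite /c eqxx addr0.
  rewrite /c ifF ?scaler0 //; apply: contraNF ij => /eqP/mono_inj/enum_val_inj ->.
  exact: eqxx.
exists c; split=> // [F Fm|a a0 j]; last first.
  have := congr1 (fun f => caug 0 (f (mono (enum_val j)))) a0.
  rewrite sumE lfunZE caugE counit1 scale1r [caug 0 _](lfun0E (caug 0)).
  by rewrite [_ *: _]mulr1.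
exists (fun j => caug 0 (F (mono (enum_val j)))); apply/funext => t.
rewrite -[RHS]/(0 : T 1).
have -> (f h : MI -> T 1) : (f - h) t = f t - h t by [].
case: (eqVneq (mdeg t) m) => [tm|tm].
  have [u ut] := mono_onto tm.
  have uS : u \in S by rewrite inE -mdeg_mono ut tm.
  rewrite -ut -(enum_rankK_in uS uS) sumE -(column_unit Fm); exact: subrr.
case: (Fm) => [[F0 _] _ _]; rewrite F0 // sub0r fct_sumE big1 ?oppr0 // => j _.
case: (cZ j) => [[cm _] _ _].
  by rewrite -[LHS]/(caug 0 (F (mono (enum_val j))) *: c j t) cm // scaler0.
Qed.

Lemma qdim_cobar n :
  qdim (@ccocycle K H (fun _ _ => True) n) (@ccoboundary K H (fun _ _ => True) n)
    (if odd n then 0%N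
     else #|[set t : k.-tuple 'I_n.+1 | (\sum_(i <- t) i)%N == n]|).
Proof.
apply: qdim_row; apply: qdim_koszul; rewrite addn0.
by case: ifPn => on; [apply: qdim_column_odd | apply: qdim_column_even].
Qed.

End KoszulComplex.

(** * The dimensions for B_k *)

Section Cohomology.
Local Open Scope ring_scope.
Variables (K : fieldType) (k : nat).
Hypothesis natK : forall m, m.+1%:R != 0 :> K.
Local Notation H := (Bk_hopf K k.+1).

Lemma qdim_Bk n :
  qdim (@ccocycle K H (fun _ _ => True) n) (@ccoboundary K H (fun _ _ => True) n)
    (if odd n then 0%N else 'C((k + n)%N, n)).
Proof.
have two : 2%:R != 0 :> K := natK 1.
pose L := @lproj K k.+1.
have LL e a : L e (L e a) = L e a by rewrite lproj_proj // eqxx scale1r.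
have deg_jop m a : m.+1%:R *: @jop K k.+1 m.+1 a +
    \sum_i @mo K k.+1 i (@pd K k.+1 i (@jop K k.+1 m.+1 a)) = a.
  by rewrite -nopE nop_jop.
have L0 a : L false a = @jop K k.+1 0 (\sum_i @mo K k.+1 i (@pd K k.+1 i (L false a)))
    + @Bk_counit K k.+1 (L false a) *: 1.
  by rewrite -nopE -lproj0.
have := @qdim_cobar K H k.+1 L (@pd K k.+1) (@mo K k.+1) (@jop K k.+1) two LL.
move=> /(_ (@lproj1 K k.+1 two) (@comul_lproj K k.+1)).
move=> /(_ (@pd1 K k.+1) (@pd_pd K k.+1)).
move=> /(_ (@comul_pd K k.+1)).
move=> /(_ (@pd_mo K k.+1) (@lproj_pd K k.+1) (@lproj_mo K k.+1)).
move=> /(_ (@lproj_jop K k.+1) (@pd_jop K k.+1) deg_jop).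
move=> /(_ L0 n).
(* The count of monomials is ['C(k + n, k)]; symmetry of binomial coefficients gives the stated
   form. *)
by rewrite card_ord_partitions -(bin_sub (leq_addr n k)) addKn.
Qed.

Lemma dy_dim_forget n :
  dy_dim (forget H) n (if odd n then 0%N else 'C((k + n)%N, n)).
Proof.
apply: (dy_dim_qdim (W := forget_fiber H) _ (qdim_Bk n)) => m b.
by split=> // _; apply: represents_forget.
Qed.

Lemma dy_dim_id n :
  dy_dim (idFunctor (Hmod H)) n (if odd n then 0%N else 'C((k + n)%N, n)).
Proof.
apply: (dy_dim_qdim (W := id_fiber H) _ (qdim_central (natK 1) (qdim_Bk n))) => m b.
exact: central_represents.
Qed.
End Cohomology.

Theorem theorem1 (R : realType) (k : nat) (hk : (1 <= k)%N) (n : nat) :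
  let d := if odd n then 0%N else 'C(k + n - 1, n) in
  dy_dim (idFunctor (Hmod (Bk_hopf (complex R) k))) n d /\
  dy_dim (forget (Bk_hopf (complex R) k)) n d.
Proof.
case: k hk => // k _; rewrite addSn subn1 /=.
have natC m : (m.+1%:R != 0 :> complex R)%R by rewrite Num.Theory.pnatr_eq0.
by split; [apply: dy_dim_id | apply: dy_dim_forget].
Qed.
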